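(* Let $f,g\in\mathbb{C}\{x,y\}$ both vanish at the origin and be coprime. Then $$\mu(f,g)=\mu_0(fg)+\sum_{[\alpha:\beta]\in\mathcal{B}(f,g)^{*}}\big(\mu_0(\alpha f+\beta g)-\mu_{gen}(f,g)\big).$$
   Context: For $h\in\mathbb{C}\{x,y\}$, $\mu_0(h)=\dim_{\mathbb{C}}\mathbb{C}\{x,y\}/(h_x,h_y)\in\mathbb{N}_{\ge0}\cup\{\infty\}$ is its Milnor number, and $i_0(\cdot,\cdot)$ denotes the intersection number at $0$. The Milnor number of the pair is $\mu(f,g):=i_0(f_xg-g_xf,\;f_yg-g_yf)$. The map $\mathbb{P}^1\to\mathbb{N}_{\ge0}\cup\{\infty\}$, $[\alpha:\beta]\mapsto\mu_0(\alpha f+\beta g)$, is constant outside a finite set; this constant value is the generic Milnor number $\mu_{gen}(f,g)$, and the bifurcation set $\mathcal{B}(f,g)\subset\mathbb{P}^1$ is the finite set of $[\alpha:\beta]$ with $\mu_0(\alpha f+\beta g)\neq\mu_{gen}(f,g)$ (at these points the value is strictly larger). $\mathcal{B}(f,g)^*:=\mathcal{B}(f,g)\setminus\{[1:0],[0:1]\}$, i.e. the bifurcation set with the points corresponding to $f$ and $g$ removed. *)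

(* Defs.v *)
From HB Require Import structures.
From mathcomp Require Import all_boot all_order all_algebra.
From mathcomp Require Import complex.
From mathcomp Require Import boolp classical_sets reals.
Set Implicit Arguments. Unset Strict Implicit. Unset Printing Implicit Defensive.
Import Order.TTheory GRing.Theory Num.Theory.
Local Open Scope ring_scope.

Section Germs.
Variable R : realType.
Local Notation C := (R[i]).

(* A two-variable power series over C: a i j = coefficient of x^i y^j. *)
Definition ps := nat -> nat -> C.

(* Convergent power series: absolutely convergent on some polydisc,
   i.e. Cauchy estimates |a_ij| r^(i+j) <= M for some r > 0. *)
Definition convergent (a : ps) : Prop :=
  exists r : C, 0 < r /\ exists M : C, forall i j, `|a i j| * r ^+ (i + j) <= M.

Definition ps0 : ps := fun _ _ => 0.
Definition ps1 : ps := fun i j => if (i == 0%N) && (j == 0%N) then 1 else 0.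
Definition psadd (a b : ps) : ps := fun i j => a i j + b i j.
Definition psscale (c : C) (a : ps) : ps := fun i j => c * a i j.
Definition psmul (a b : ps) : ps := fun i j =>
  \sum_(k < i.+1) \sum_(l < j.+1) a k l * b (i - k)%N (j - l)%N.
Definition psdx (a : ps) : ps := fun i j => i.+1%:R * a i.+1 j.
Definition psdy (a : ps) : ps := fun i j => j.+1%:R * a i j.+1.

Definition in_ideal2 (p q h : ps) : Prop :=
  exists u v, convergent u /\ convergent v /\ h = psadd (psmul u p) (psmul v q).

Definition indep_mod (p q : ps) (s : seq ps) : Prop :=
  (forall a, a \in s -> convergent a) /\
  forall c : 'I_(size s) -> C,
    in_ideal2 p q (fun i j => \sum_(k < size s) c k * (nth ps0 s k) i j) ->
    forall k, c k = 0.

(* dim_C C{x,y}/(p,q) in N u {oo}; None stands for oo *)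
Definition is_codim (p q : ps) (d : option nat) : Prop :=
  match d with
  | Some n => (exists s, indep_mod p q s /\ size s = n) /\
              (forall s, indep_mod p q s -> (size s <= n)%N)
  | None => forall n, exists s, indep_mod p q s /\ size s = n
  end.
Definition codim (p q : ps) : option nat := xget None (is_codim p q).

Definition inum (a b : ps) : option nat := codim a b.
Definition milnor (h : ps) : option nat := codim (psdx h) (psdy h).

Definition milnor_pair (f g : ps) : option nat :=
  inum (psadd (psmul (psdx f) g) (psscale (-1) (psmul (psdx g) f)))
       (psadd (psmul (psdy f) g) (psscale (-1) (psmul (psdy g) f))).

Definition milnor_pencil (f g : ps) (al be : C) : option nat :=
  milnor (psadd (psscale al f) (psscale be g)).

(* m is the value of [alpha:beta] |-> mu_0(alpha f + beta g) outside a
   finite subset of P^1 (points [alpha:beta] = pairs (alpha,beta) != (0,0)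
   up to scaling; the finite exceptional set is given by representatives). *)
Definition is_generic_value (f g : ps) (m : option nat) : Prop :=
  exists E : seq (C * C),
    forall al be, (al, be) != (0, 0) ->
      (forall e, e \in E -> ~ exists l : C, l != 0 /\ al = l * e.1 /\ be = l * e.2) ->
      milnor_pencil f g al be = m.
Definition mu_gen (f g : ps) : option nat := xget None (is_generic_value f g).

(* [alpha : beta] in B(f,g)^*, with alpha, beta both nonzero, represented
   by (t, 1), t = alpha/beta != 0 *)
Definition in_bif_star (f g : ps) (t : C) : Prop :=
  t != 0 /\ milnor_pencil f g t 1 <> mu_gen f g.

Definition eadd (a b : option nat) : option nat :=
  match a, b with Some m, Some n => Some (m + n)%N | _, _ => None end.
Definition esub (a b : option nat) : option nat :=
  match a, b with
  | Some m, Some n => Some (m - n)%N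
  | None, Some _ => None
  | _, None => Some 0%N
  end.
Definition esum (s : seq (option nat)) : option nat := foldr eadd (Some 0%N) s.

Definition ps_unit (d : ps) : Prop := exists e, convergent e /\ psmul d e = ps1.
Definition ps_coprime (f g : ps) : Prop :=
  forall d u v, convergent d -> convergent u -> convergent v ->
    f = psmul d u -> g = psmul d v -> ps_unit d.

End Germs.

(* Main.v *)
(* Write h_c for the members of the pencil, I = i(f, g), and (A, B) for the components of
   g df - f dg, so that mu(f, g) = i(A, B). After a change of coordinates x := x + y^k no member
   of the pencil vanishes on x = 0; let e_c be the order of h_c(0, y). It is the same number e
   for all c but one.

   Since B is, up to a multiple of h_c, the product of the y-derivative of h_c with another member
   of the pencil, Teissier's formula i(h, h_y) = mu(h) + e - 1 gives
   i(h_c, B) = mu(h_c) + e_c - 1 + I. On a Puiseux branch of B, the derivative of f/g is A/g^2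
   times the derivative of x; so the order of A is determined by the common order of almost all
   h_c and the larger order of the exceptional one. Summing over the branches of B expresses
   i(A, B) by the numbers i(h_c, B), hence by the mu(h_c). The formula for mu(f, g) follows from
   mu(fg) = mu(f) + mu(g) + 2I - 1.

   Branches come from Puiseux's theorem for convergent series, which follows from Weierstrass
   division by Newton's algorithm. All branches of a germ Q are parametrised by x = t^N, y = Z(t)
   with the same N, so that N i(a, Q) is the sum of the t-orders of a(t^N, Z(t)). *)

Require Import Defs.
From HB Require Import structures.
From mathcomp Require Import all_boot all_order all_algebra.
From mathcomp Require Import ring zify.
From mathcomp Require Import complex.
From mathcomp Require Import boolp classical_sets reals.
Import Order.TTheory GRing.Theory Num.Theory.
Local Open Scope ring_scope.
Set Implicit Arguments. Unset Strict Implicit. Unset Printing Implicit Defensive.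

(** * Formal power series *)

(** Germs are never factored into irreducible ones, and members of the pencil may be non-reduced,
    with infinite Milnor number. After x := x^N a germ regular in y is a unit times a product of
    linear factors y - Z, possibly repeated, and intersection numbers with it become orders of
    series in one variable. All identities are kept additive in N with infinity added, and only
    finite terms are cancelled.

    The count behind the formula: let S be a finite set of members of the pencil containing f, g and
    all exceptional members. On a branch of B the values of the members in S are d, taken |S| - 1
    times, and one larger value v, while ord A + N = d + v. Hence they add up to ord A + N + (|S| -
    2) d. The 2 stands for f and g: their Milnor numbers stay uncompensated and merge into mu(fg),
    whereas each other member is compared with a generic one. A member of S outside the bifurcation
    set then contributes 0.

    The inequality mu_gen <= mu(h_c), without which truncated subtraction would be wrong, is proved
    separately with the Jacobian of f and g. *)

Definition fps (A : Type) : Type := nat -> A.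

HB.instance Definition _ (A : Type) := gen_eqMixin (fps A).
HB.instance Definition _ (A : Type) := gen_choiceMixin (fps A).

Section FpsRing.
Variable A : comNzRingType.
Implicit Types a b c : fps A.

Definition fps0 : fps A := fun _ => 0.
Definition fps1 : fps A := fun i => (i == 0%N)%:R.
Definition fps_add a b : fps A := fun i => a i + b i.
Definition fps_opp a : fps A := fun i => - a i.
Definition fps_mul a b : fps A := fun i => \sum_(k < i.+1) a k * b (i - k)%N.

Fact fps_addA : associative fps_add.
Proof. by move=> a b c; apply: funext => i; apply: addrA. Qed.
Fact fps_addC : commutative fps_add.
Proof. by move=> a b; apply: funext => i; apply: addrC. Qed.
Fact fps_add0 : left_id fps0 fps_add.
Proof. by move=> a; apply: funext => i; apply: add0r. Qed.
Fact fps_addN : left_inverse fps0 fps_opp fps_add.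
Proof. by move=> a; apply: funext => i; apply: addNr. Qed.
HB.instance Definition _ :=
  GRing.isZmodule.Build (fps A) fps_addA fps_addC fps_add0 fps_addN.

(** Coefficients of a product up to degree i see only truncations of the factors, so the ring laws
    and the Leibniz rule are inherited from polynomials. *)
Lemma fps_mul_poly a b i (p q : {poly A}) :
    (forall k, (k <= i)%N -> p`_k = a k) -> (forall k, (k <= i)%N -> q`_k = b k) ->
  forall k, (k <= i)%N -> (p * q)`_k = fps_mul a b k.
Proof.
move=> pa qb k ki; rewrite coefM; apply: eq_bigr => j _.
by rewrite pa ?qb //; have := ltn_ord j; lia.
Qed.

Lemma fps_trunc a i : exists p : {poly A}, forall k, (k <= i)%N -> p`_k = a k.
Proof. by exists (\poly_(k < i.+1) a k) => k ki; rewrite coef_poly ltnS ki. Qed.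

Fact fps_mulA : associative fps_mul.
Proof.
move=> a b c; apply: funext => i.
have [p pa] := fps_trunc a i; have [q qb] := fps_trunc b i; have [r rc] := fps_trunc c i.
rewrite -(fps_mul_poly pa (fps_mul_poly qb rc) (leqnn i)) mulrA.
by rewrite (fps_mul_poly (fps_mul_poly pa qb) rc).
Qed.
Fact fps_mulC : commutative fps_mul.
Proof.
move=> a b; apply: funext => i.
have [p pa] := fps_trunc a i; have [q qb] := fps_trunc b i.
by rewrite -(fps_mul_poly pa qb (leqnn i)) mulrC (fps_mul_poly qb pa).
Qed.
Fact fps_mul1 : left_id fps1 fps_mul.
Proof.
move=> a; apply: funext => i; rewrite /fps_mul big_ord_recl /= mul1r subn0.
by rewrite big1 ?addr0 // => k _; rewrite mul0r.
Qed.
Fact fps_mulDl : left_distributive fps_mul fps_add.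
Proof.
move=> a b c; apply: funext => i; rewrite /fps_mul /fps_add -big_split /=.
by apply: eq_bigr => k _; rewrite mulrDl.
Qed.
Fact fps_1neq0 : fps1 != 0.
Proof. by apply/eqP => /(congr1 (fun a => a 0%N)) /eqP; rewrite oner_eq0. Qed.
HB.instance Definition _ :=
  GRing.Zmodule_isComNzRing.Build (fps A) fps_mulA fps_mulC fps_mul1 fps_mulDl fps_1neq0.

Lemma fpsD a b i : (a + b) i = a i + b i. Proof. by []. Qed.
Lemma fpsN a i : (- a) i = - a i. Proof. by []. Qed.
Lemma fps_0 i : (0 : fps A) i = 0. Proof. by []. Qed.
Lemma fps_1 i : (1 : fps A) i = (i == 0%N)%:R. Proof. by []. Qed.
Lemma fpsM a b i : (a * b) i = \sum_(k < i.+1) a k * b (i - k)%N. Proof. by []. Qed.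
Lemma fps_sum I r (P : pred I) (F : I -> fps A) i :
  (\sum_(j <- r | P j) F j) i = \sum_(j <- r | P j) F j i.
Proof. by elim/big_rec2: _ => // j y1 y2 _ <-. Qed.

Lemma fpsM0 a b : (a * b) 0%N = a 0%N * b 0%N.
Proof. by rewrite fpsM big_ord1. Qed.

Definition fpsC (c : A) : fps A := fun i => if i == 0%N then c else 0.
Definition fpsX : fps A := fun i => (i == 1%N)%:R.

Lemma fpsCM (c : A) a i : (fpsC c * a) i = c * a i.
Proof.
rewrite fpsM big_ord_recl /= subn0 big1 ?addr0 // => k _.
by rewrite /fpsC mul0r.
Qed.

Fact fpsC_additive : {morph fpsC : c d / c - d}.
Proof. by move=> c d; apply: funext => -[|i] //; rewrite fpsD fpsN /fpsC /= subr0. Qed.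
Fact fpsC_multiplicative : monoid_morphism fpsC.
Proof.
split; first by apply: funext => -[|i].
by move=> c d; apply: funext => i; rewrite fpsCM /fpsC; case: eqP; rewrite ?mulr0.
Qed.
HB.instance Definition _ := GRing.isZmodMorphism.Build A (fps A) fpsC fpsC_additive.
HB.instance Definition _ := GRing.isMonoidMorphism.Build A (fps A) fpsC fpsC_multiplicative.

Lemma fpsXM a i : (fpsX * a) i = if i is i'.+1 then a i' else 0.
Proof.
rewrite fpsM; case: i => [|i]; first by rewrite big_ord1 mul0r.
rewrite 2!big_ord_recl /= mul0r add0r mul1r subn1 /= big1 ?addr0 // => k _.
by rewrite mul0r.
Qed.

Lemma fpsXnM n a i : (fpsX ^+ n * a) i = if (n <= i)%N then a (i - n)%N else 0.
Proof.
elim: n i => [|n IH] i; first by rewrite mul1r subn0.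
by rewrite exprS -mulrA fpsXM; case: i => //= i; rewrite IH.
Qed.

Lemma fpsXn n i : (fpsX ^+ n) i = (i == n)%:R.
Proof.
rewrite -[_ ^+ n]mulr1 fpsXnM; case: leqP => h; rewrite ?fps_1 ?subn_eq0 ?eqn_leq.
  by rewrite h andbT.
by rewrite [(n <= i)%N]leqNgt h andbF.
Qed.

Definition fps_deriv a : fps A := fun i => i.+1%:R * a i.+1.

Lemma fps_derivD a b : fps_deriv (a + b) = fps_deriv a + fps_deriv b.
Proof. by apply: funext => i; rewrite /fps_deriv !fpsD mulrDr. Qed.

Lemma fps_derivM a b : fps_deriv (a * b) = fps_deriv a * b + a * fps_deriv b.
Proof.
apply: funext => i; rewrite fpsD.
have [p pa] := fps_trunc a i.+1; have [q qb] := fps_trunc b i.+1.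
have -> : fps_deriv (a * b) i = (p * q)^`()`_i.
  by rewrite coef_deriv (fps_mul_poly pa qb) // -mulr_natl.
have dE c (r : {poly A}) : (forall k, (k <= i.+1)%N -> r`_k = c k) ->
    forall k, (k <= i)%N -> r^`()`_k = fps_deriv c k.
  by move=> rc k ki; rewrite coef_deriv rc // -mulr_natl.
have lei c (r : {poly A}) : (forall k, (k <= i.+1)%N -> r`_k = c k) ->
    forall k, (k <= i)%N -> r`_k = c k.
  by move=> rc k ki; apply/rc/leqW.
rewrite derivM coefD (fps_mul_poly (dE _ _ pa) (lei _ _ qb)) //.
by rewrite (fps_mul_poly (lei _ _ pa) (dE _ _ qb)).
Qed.

End FpsRing.
Arguments fpsX {A}.

Section FpsMap.
Variables (A B : comNzRingType) (f : {rmorphism A -> B}).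

Definition fps_map (a : fps A) : fps B := fun i => f (a i).

Fact fps_map_additive : {morph fps_map : a b / a - b}.
Proof. by move=> a b; apply: funext => i; rewrite /fps_map /= rmorphB. Qed.
Fact fps_map_multiplicative : monoid_morphism fps_map.
Proof.
split=> [|a b]; apply: funext => i; rewrite /fps_map; first by rewrite rmorph_nat.
by rewrite !fpsM rmorph_sum; apply: eq_bigr => k _; rewrite rmorphM.
Qed.
HB.instance Definition _ := GRing.isZmodMorphism.Build _ _ fps_map fps_map_additive.
HB.instance Definition _ :=
  GRing.isMonoidMorphism.Build _ _ fps_map fps_map_multiplicative.
End FpsMap.

Section FpsOrder.
Variable A : idomainType.
Implicit Types a b : fps A.

(* [None] is the order of the zero series. *)
Definition is_ord a (d : option nat) : Prop :=
  if d is Some n then a n <> 0 /\ forall i, (i < n)%N -> a i = 0 else a = 0.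

Lemma is_ord_ex a : exists d, is_ord a d.
Proof.
have [[n an]|a0] := pselect (exists n, a n != 0); last first.
  by exists None; apply: funext => i; apply/eqP/negP => ai; apply: a0; exists i; apply/negP.
have ex : exists n, a n != 0 by exists n.
exists (Some (ex_minn ex)); case: ex_minnP => m am min; split; first exact/eqP.
by move=> i im; apply/eqP; apply: contraLR im => /min; rewrite -leqNgt.
Qed.

Lemma is_ord_uniq a d e : is_ord a d -> is_ord a e -> d = e.
Proof.
case: d e => [m|] [n|] //=.
- move=> [am mi] [an ni]; have [mn|nm|-> //] := ltngtP m n.
    by case: am; apply: ni.
  by case: an; apply: mi.
- by move=> [am _] a0; rewrite a0 in am.
- by move=> a0 [an _]; rewrite a0 in an.
Qed.

Definition ord a : option nat := xget None (is_ord a).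

Lemma ordP a : is_ord a (ord a).
Proof. by have [d ad] := is_ord_ex a; apply: (xgetI _ ad). Qed.

Lemma ord_eq a d : is_ord a d -> ord a = d.
Proof. exact/is_ord_uniq/ordP. Qed.

Lemma ord_0 : ord 0 = None. Proof. exact: ord_eq. Qed.

Lemma ord_None a : ord a = None -> a = 0.
Proof. by have := ordP a; case: ord. Qed.

Lemma is_ordM a b d e : is_ord a d -> is_ord b e -> is_ord (a * b) (eadd d e).
Proof.
case: d e => [m|] [n|] /=; last 3 first.
- by move=> _ ->; rewrite mulr0.
- by move=> -> _; rewrite mul0r.
- by move=> -> _; rewrite mul0r.
move=> [am ma] [bn nb]; split=> [|i imn]; last first.
  rewrite fpsM big1 // => k _; have [km|mk] := ltnP k m; first by rewrite ma ?mul0r.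
  by rewrite nb ?mulr0 //; have := ltn_ord k; lia.
have mlt : (m < (m + n).+1)%N by lia.
rewrite fpsM (bigD1 (Ordinal mlt)) //= addKn big1 ?addr0 => [|k km].
  by apply/eqP; rewrite mulf_neq0 //; apply/eqP.
have [{}km|mk|kem] := ltngtP k m; first by rewrite ma ?mul0r.
  by rewrite nb ?mulr0 //; have := ltn_ord k; lia.
by move: km; rewrite -val_eqE /= kem eqxx.
Qed.

Lemma ordM a b : ord (a * b) = eadd (ord a) (ord b).
Proof. exact: ord_eq (is_ordM (ordP a) (ordP b)). Qed.

Lemma fps_mulf_eq0 a b : a * b = 0 -> a = 0 \/ b = 0.
Proof.
move=> ab0; have := ordM a b; rewrite ab0 ord_0.
by case Ea: (ord a) => [m|]; [case Eb: (ord b) => [n|] //|] => _;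
   [right|left]; apply: ord_None.
Qed.

End FpsOrder.
Opaque ord.

(** * Weighted norms and convergence *)

Record seminorm (R : realType) (A : comNzRingType) (nu : A -> R) : Prop := Seminorm {
  seminorm0 : nu 0 = 0;
  seminorm1 : nu 1 <= 1;
  seminorm_ge0 : forall a, 0 <= nu a;
  seminormD : forall a b, nu (a + b) <= nu a + nu b;
  seminormM : forall a b, nu (a * b) <= nu a * nu b;
  seminormN : forall a, nu (- a) = nu a }.

Section Seminorm.
Variables (R : realType) (A : comNzRingType).
Variable nu : A -> R.
Hypothesis nuP : seminorm nu.

Lemma seminorm_sum I r (P : pred I) (F : I -> A) :
  nu (\sum_(i <- r | P i) F i) <= \sum_(i <- r | P i) nu (F i).
Proof.
elim/big_rec2: _ => [|i x y _ xy]; first by rewrite (seminorm0 nuP).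
by apply: le_trans (seminormD nuP _ _) _; rewrite lerD2l.
Qed.

Lemma seminormX a n : nu (a ^+ n) <= nu a ^+ n.
Proof.
elim: n => [|n IH]; first exact: seminorm1.
rewrite !exprS; apply: le_trans (seminormM nuP _ _) _.
by rewrite ler_wpM2l // (seminorm_ge0 nuP).
Qed.

(** A weighted l^1 norm cut off at n terms. It is finite for every series, so convergence becomes a
    bound uniform in n and no limit is taken. *)
Definition fps_norm (r : R) (n : nat) (a : fps A) : R := \sum_(i < n) nu (a i) * r ^+ i.

Lemma cauchy_sum (x y : nat -> R) n :
  \sum_(i < n) \sum_(k < i.+1) x k * y (i - k)%N
  = \sum_(k < n) x k * \sum_(j < n - k) y j.
Proof.
elim: n => [|n IH]; first by rewrite !big_ord0.
rewrite big_ord_recr /= IH [RHS]big_ord_recr /= subSnn big_ord1.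
rewrite (big_ord_recr n) /= subnn addrA; congr (_ + _).
rewrite -big_split /=; apply: eq_bigr => k _.
by rewrite subSn ?big_ord_recr /= ?mulrDr // ltnW.
Qed.

(** The cut-off stays submultiplicative because the triangle k + j < n of index pairs lies inside
    the square k, j < n. *)
Lemma fps_norm_seminorm r n : 0 <= r -> (0 < n)%N -> seminorm (fps_norm r n).
Proof.
move=> r0; case: n => // n _; have rX i : 0 <= r ^+ i by rewrite exprn_ge0.
have nn a := seminorm_ge0 nuP a; split.
- by rewrite /fps_norm big1 // => i _; rewrite fps_0 (seminorm0 nuP) mul0r.
- rewrite /fps_norm big_ord_recl /= fps_1 mulr1 big1 ?addr0 => [|i _].
    exact: seminorm1.
  by rewrite fps_1 (seminorm0 nuP) mul0r.
- by move=> a; apply: sumr_ge0 => i _; rewrite mulr_ge0.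
- move=> a b; rewrite /fps_norm -big_split; apply: ler_sum => i _ /=.
  by rewrite -mulrDl ler_wpM2r // (seminormD nuP).
- move=> a b; apply: (@le_trans _ _ (\sum_(i < n.+1) \sum_(k < i.+1)
    (nu (a k) * r ^+ k) * (nu (b (i - k)%N) * r ^+ (i - k)))).
    apply: ler_sum => i _; rewrite fpsM.
    apply: le_trans (ler_wpM2r (rX _) (seminorm_sum _ _ _)) _.
    rewrite mulr_suml; apply: ler_sum => k _.
    rewrite mulrACA -exprD subnKC; last by rewrite -ltnS.
    by rewrite ler_wpM2r // (seminormM nuP).
  rewrite (cauchy_sum (fun k => nu (a k) * r ^+ k) (fun k => nu (b k) * r ^+ k)).
  rewrite /fps_norm mulr_suml; apply: ler_sum => k _.
  rewrite ler_wpM2l ?mulr_ge0 //.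
  rewrite -(big_mkord predT (fun j => nu (b j) * r ^+ j)).
  rewrite -(big_mkord predT (fun j => nu (b j) * r ^+ j)).
  rewrite (big_cat_nat (n := n.+1 - k) (p := n.+1)) ?leq_subr //= lerDl.
  by apply: sumr_ge0 => j _; rewrite mulr_ge0.
- move=> a; apply: eq_bigr => i _; by rewrite fpsN (seminormN nuP).
Qed.

End Seminorm.

Section Convergent.
Variable R : realType.
Local Notation C := (R[i]).
Local Notation F2 := (fps (fps C)).
Implicit Types a b : F2.

Lemma normc_seminorm : seminorm (@complex.ComplexField.Normc.normc R).
Proof.
split.
- exact: complex.ComplexField.Normc.normc0.
- by rewrite complex.ComplexField.Normc.normc1.
- by case=> x y; apply: sqrtr_ge0.
- exact: le_normcD.
- by move=> x y; rewrite complex.ComplexField.Normc.normcM.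
- exact: normcN.
Qed.

Local Notation normc := (@complex.ComplexField.Normc.normc R).

Definition norm2 (r s : R) n : F2 -> R := fps_norm (fps_norm normc s n) r n.

Lemma norm2_seminorm r s n : 0 <= r -> 0 <= s -> (0 < n)%N -> seminorm (norm2 r s n).
Proof. by move=> r0 s0 n0; do 2!apply: fps_norm_seminorm => //; apply: normc_seminorm. Qed.

Definition bounded2 (r s M : R) a : Prop := forall n, (0 < n)%N -> norm2 r s n a <= M.

Lemma normc_ge0 z : 0 <= normc z.
Proof. exact: (seminorm_ge0 normc_seminorm). Qed.

Lemma norm2E r s n a :
  norm2 r s n a = \sum_(i < n) \sum_(j < n) normc (a i j) * s ^+ j * r ^+ i.
Proof. by apply: eq_bigr => i _; rewrite /fps_norm mulr_suml. Qed.

Lemma norm2_coef r s n a i j : 0 <= r -> 0 <= s -> (i < n)%N -> (j < n)%N ->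
  normc (a i j) * s ^+ j * r ^+ i <= norm2 r s n a.
Proof.
move=> r0 s0 ni nj; have t0 i' j' : 0 <= normc (a i' j') * s ^+ j' * r ^+ i'.
  by rewrite !mulr_ge0 ?normc_ge0 ?exprn_ge0.
rewrite norm2E (bigD1 (Ordinal ni)) //= (bigD1 (Ordinal nj)) //= -addrA lerDl.
by rewrite addr_ge0 ?sumr_ge0 // => i' _; rewrite sumr_ge0.
Qed.

Lemma norm2_le r s r' s' n a : 0 <= r <= r' -> 0 <= s <= s' ->
  norm2 r s n a <= norm2 r' s' n a.
Proof.
move=> /andP[r0 rr] /andP[s0 ss]; rewrite !norm2E; apply: ler_sum => i _.
apply: ler_sum => j _; rewrite -!mulrA ler_wpM2l ?normc_ge0 //.
have [r'0 s'0] := (le_trans r0 rr, le_trans s0 ss).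
by rewrite ler_pM ?exprn_ge0 ?lerXn2r ?nnegrE.
Qed.

Lemma geo_half n : \sum_(i < n) 2%:R^-1 ^+ i <= 2 :> R.
Proof.
suff -> : \sum_(i < n) 2%:R^-1 ^+ i = 2 - 2 * 2%:R^-1 ^+ n :> R.
  by rewrite gerBl mulr_ge0 ?exprn_ge0 ?invr_ge0.
elim: n => [|n IH]; first by rewrite big_ord0 expr0 mulr1 subrr.
by rewrite big_ord_recr /= IH exprS; field.
Qed.

(** Halving both radii turns a bound on the single terms into one on their sum: each of the two
    geometric series adds up to at most 2, hence the 4. *)
Lemma bounded2_half (r s M : R) a : 0 < r -> 0 < s ->
  (forall i j, normc (a i j) * s ^+ j * r ^+ i <= M) -> bounded2 (r / 2) (s / 2) (M * 4) a.
Proof.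
move=> r0 s0 H n n0; rewrite norm2E.
have M0 : 0 <= M by apply: le_trans (H 0%N 0%N); rewrite !mulr1 normc_ge0.
apply: (@le_trans _ _ (\sum_(i < n) \sum_(j < n) M * (2%:R^-1 ^+ j * 2%:R^-1 ^+ i))).
  apply: ler_sum => i _; apply: ler_sum => j _; rewrite !exprMn.
  rewrite [leLHS](_ : _ = normc (a i j) * s ^+ j * r ^+ i * (2%:R^-1 ^+ j * 2%:R^-1 ^+ i)).
    by rewrite ler_wpM2r // mulr_ge0 ?exprn_ge0 ?invr_ge0.
  ring.
rewrite (eq_bigr (fun i : 'I_n => M * (\sum_(j < n) 2%:R^-1 ^+ j) * 2%:R^-1 ^+ i)); last first.
  by move=> i _; rewrite -mulrA mulr_suml mulr_sumr.
rewrite -mulr_sumr -mulrA ler_wpM2l // (_ : 4 = 2 * 2); last by ring.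
by rewrite ler_pM ?geo_half ?sumr_ge0 // => i _; rewrite exprn_ge0 ?invr_ge0.
Qed.

Lemma normC_normc (z : C) : `|z| = (normc z)%:C%C.
Proof. by rewrite normc_def; case: z. Qed.

Lemma convergent_bounded a :
  convergent (a : ps R) <-> exists r M, 0 < r /\ bounded2 r r M a.
Proof.
split=> [[r [r0 [M H]]]|[r [M [r0 H]]]].
  move: r0; rewrite ltcE /= => /andP[/eqP ir rr].
  have er : r = (complex.Re r)%:C%C by case: r ir {H rr} => x y /= ->.
  exists (complex.Re r / 2), (complex.Re M * 4); split; first by rewrite divr_gt0.
  apply: bounded2_half => // i j; have := H i j.
  rewrite er normC_normc -rmorphXn -rmorphM lecE /= => /andP[_].
  by rewrite exprD mulrA mulrAC.
exists r%:C%C; split; first by rewrite ltcR.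
exists M%:C%C => i j; rewrite normC_normc -rmorphXn -rmorphM lecR.
apply: le_trans (H (maxn i j).+1 isT).
rewrite addnC exprD mulrA; apply: norm2_coef; rewrite ?ltW // ltnS ?leq_maxl ?leq_maxr //.
Qed.

Lemma bounded2_le r s r' s' M a : 0 <= r <= r' -> 0 <= s <= s' ->
  bounded2 r' s' M a -> bounded2 r s M a.
Proof. by move=> rr ss H n n0; apply: le_trans (H n n0); apply: norm2_le. Qed.

Lemma bounded2_convergent r s M a : 0 < r -> 0 < s -> bounded2 r s M a ->
  convergent (a : ps R).
Proof.
move=> r0 s0 H; apply/convergent_bounded; exists (Num.min r s), M.
have m0 : 0 < Num.min r s by rewrite lt_min r0.
by split=> //; apply: bounded2_le H; rewrite ltW //= ge_min lexx ?orbT.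
Qed.

Lemma bounded2D r s M M' a b : 0 <= r -> 0 <= s ->
  bounded2 r s M a -> bounded2 r s M' b -> bounded2 r s (M + M') (a + b).
Proof.
move=> r0 s0 H H' n n0; apply: le_trans (seminormD (norm2_seminorm r0 s0 n0) _ _) _.
by rewrite lerD ?H ?H'.
Qed.

Lemma bounded2M r s M M' a b : 0 <= r -> 0 <= s ->
  bounded2 r s M a -> bounded2 r s M' b -> bounded2 r s (M * M') (a * b).
Proof.
move=> r0 s0 H H' n n0; have N := norm2_seminorm r0 s0 n0.
apply: le_trans (seminormM N _ _) _.
by rewrite ler_pM ?H ?H' ?(seminorm_ge0 N).
Qed.

Lemma bounded2N r s M a : 0 <= r -> 0 <= s ->
  bounded2 r s M a -> bounded2 r s M (- a).
Proof.
by move=> r0 s0 H n n0; rewrite (seminormN (norm2_seminorm r0 s0 n0)) H.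
Qed.

Lemma convergent2 a b : convergent (a : ps R) -> convergent (b : ps R) ->
  exists r M M', [/\ 0 < r, bounded2 r r M a & bounded2 r r M' b].
Proof.
move=> /convergent_bounded[r [M [r0 H]]] /convergent_bounded[r' [M' [r0' H']]].
have m0 : 0 < Num.min r r' by rewrite lt_min r0.
exists (Num.min r r'), M, M'; split=> //.
  by apply: bounded2_le H; rewrite ltW //= ge_min lexx ?orbT.
by apply: bounded2_le H'; rewrite ltW //= ge_min lexx ?orbT.
Qed.

Definition convp : {pred F2} := fun a => `[< convergent (a : ps R) >].

Fact convp_subring : subring_closed convp.
Proof.
split.
- apply/asboolP/convergent_bounded; exists 1, 1; split=> // n n0.
  exact: (seminorm1 (norm2_seminorm ler01 ler01 n0)).
- move=> a b /asboolP ca /asboolP cb; apply/asboolP.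
  have [r [M [M' [r0 H H']]]] := convergent2 ca cb; have r0' := ltW r0.
  exact: (bounded2_convergent r0 r0 (bounded2D r0' r0' H (bounded2N r0' r0' H'))).
- move=> a b /asboolP ca /asboolP cb; apply/asboolP.
  have [r [M [M' [r0 H H']]]] := convergent2 ca cb; have r0' := ltW r0.
  exact: (bounded2_convergent r0 r0 (bounded2M r0' r0' H H')).
Qed.
HB.instance Definition _ := GRing.isSubringClosed.Build F2 convp convp_subring.

End Convergent.

(** [fps (fps C)] unfolds to [ps], the outer index being the power of x, so germs and the
    coefficient arrays of the statement are related by conversion. *)
Record germ (R : realType) : Type := Germ { gval :> fps (fps R[i]); germP : gval \in @convp R }.
HB.instance Definition _ R := [isSub for @gval R].
HB.instance Definition _ R := [Choice of germ R by <:].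
HB.instance Definition _ R := [SubChoice_isSubComNzRing of germ R by <:].

(** * Substitution *)

Section Mdeg.
Variable C : comNzRingType.
Local Notation F2 := (fps (fps C)).
Implicit Types a b : F2.

(* Membership in the n-th power of the maximal ideal. *)
Definition mdeg n a : Prop := forall i j, (i + j < n)%N -> a i j = 0.

Lemma mdegD n a b : mdeg n a -> mdeg n b -> mdeg n (a + b).
Proof. by move=> ma mb i j ij; rewrite !fpsD ma ?mb ?addr0. Qed.
Lemma mdeg_le m n a : (m <= n)%N -> mdeg n a -> mdeg m a.
Proof. by move=> mn ma i j ij; apply: ma; lia. Qed.
Lemma mdeg_sum n I r (P : pred I) (F : I -> F2) :
  (forall i, P i -> mdeg n (F i)) -> mdeg n (\sum_(i <- r | P i) F i).
Proof. by move=> H; elim/big_ind: _ => //; apply: mdegD. Qed.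

Lemma fpsM2 a b i j : (a * b) i j =
  \sum_(k < i.+1) \sum_(l < j.+1) a k l * b (i - k)%N (j - l)%N.
Proof. by rewrite fpsM fps_sum. Qed.

Lemma mdegM m n a b : mdeg m a -> mdeg n b -> mdeg (m + n) (a * b).
Proof.
move=> ma nb i j ij; rewrite fpsM2 big1 // => k _; rewrite big1 // => l _.
have [kl|kl] := ltnP (k + l) m; first by rewrite ma ?mul0r.
by rewrite nb ?mulr0 //; have := ltn_ord k; have := ltn_ord l; lia.
Qed.

Lemma mdegMr n a b : mdeg n b -> mdeg n (a * b).
Proof. exact: (mdegM (m := 0)). Qed.

Lemma mdegX n a : mdeg 1 a -> mdeg n (a ^+ n).
Proof. by move=> ma; elim: n => // n IH; rewrite exprS; exact: (mdegM (m := 1) ma IH). Qed.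

End Mdeg.

Section Sub1.
Variables (C A : comNzRingType).
Local Notation F2 := (fps (fps C)).
Variables (psi : {rmorphism A -> F2}) (P : F2).
Hypothesis P1 : mdeg 1 P.

Definition sub1_upto n (a : fps A) : F2 := \sum_(k < n) psi (a k) * P ^+ k.

(** As P^k lies in the k-th power of the maximal ideal, the coefficient (i, j) is settled by the
    terms k <= i + j. The proof about P is an argument because the morphism structure depends on
    it. *)
Definition sub1 (_ : mdeg 1 P) (a : fps A) : F2 := fun i j => sub1_upto (i + j).+1 a i j.

Lemma sub1_uptoP n m a : (n <= m)%N -> mdeg n (sub1_upto m a - sub1_upto n a).
Proof.
move=> nm; rewrite /sub1_upto -!(big_mkord predT (fun k => psi (a k) * P ^+ k)).
rewrite (big_cat_nat (n := n) (p := m)) //= [X in X - _]addrC addrK big_nat_cond.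
apply: mdeg_sum => k /andP[/andP[nk _] _]; apply: mdeg_le nk _.
exact/mdegMr/mdegX.
Qed.

Lemma sub1E n a i j : (i + j < n)%N -> sub1 P1 a i j = sub1_upto n a i j.
Proof.
move=> ijn; have := sub1_uptoP a ijn (leqnn _).
by rewrite !fpsD !fpsN => /eqP; rewrite subr_eq0 => /eqP ->.
Qed.

Fact sub1_additive : {morph sub1 P1 : a b / a - b}.
Proof.
move=> a b; apply: funext => i; apply: funext => j.
rewrite /sub1 (_ : sub1_upto _ (a - b) = sub1_upto (i + j).+1 a - sub1_upto (i + j).+1 b) //.
by rewrite /sub1_upto -sumrB; apply: eq_bigr => k _; rewrite fpsD fpsN rmorphB mulrBl.
Qed.

Fact sub1_multiplicative : monoid_morphism (sub1 P1).
Proof.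
split=> [|a b]; apply: funext => i; apply: funext => j.
  rewrite /sub1 /sub1_upto big_ord_recl rmorph1 mulr1 big1 ?addr0 // => k _.
  by rewrite /= fps_1 rmorph0 mul0r.
set n := (i + j).+1; pose p (a : fps A) := \poly_(k < n) psi (a k).
have pE c m : (n <= m)%N -> sub1_upto n c = \sum_(k < m) (p c)`_k * P ^+ k.
  move=> nm; rewrite -(horner_coef_wide (n := m)) ?(leq_trans (size_poly _ _)) //.
  rewrite (horner_coef_wide (n := n)) ?size_poly //.
  by apply: eq_bigr => k _; rewrite coef_poly ltn_ord.
have pH c : sub1_upto n c = (p c).[P].
  by rewrite (pE c n) // -horner_coef_wide ?size_poly.
have -> : (sub1 P1 a * sub1 P1 b) i j = (sub1_upto n a * sub1_upto n b) i j.
  rewrite !fpsM2; apply: eq_bigr => k _; apply: eq_bigr => l _.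
  have [ki lj] := (ltn_ord k, ltn_ord l).
  by rewrite -!(@sub1E n) // /n; lia.
rewrite (@sub1E n) // !pH -hornerM.
(* The polynomials [p a * p b] and [p (a * b)] differ only in degrees at least n, where P^k does not
   reach the coefficient (i, j). *)
rewrite [X in X.[P]](_ : p (a * b) = (p a * p b) - (p a * p b - p (a * b))); last by ring.
rewrite hornerD hornerN 2!fpsD 2!fpsN [X in _ - X](_ : _ = 0) ?subr0 //.
set q := p a * p b - _; rewrite horner_coef.
apply: (mdeg_sum (n := n)) => // k _.
have [kn|nk] := ltnP k n; last first.
  by apply: mdeg_le nk _; apply/mdegMr/mdegX.
suff -> : q`_k = 0 by rewrite mul0r.
rewrite coefB coefM coef_poly kn fpsM rmorph_sum; apply/eqP; rewrite subr_eq0; apply/eqP.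
apply: eq_bigr => l _; rewrite rmorphM !coef_poly.
have ln : (l < n)%N by apply: leq_trans kn; apply: ltn_ord.
have kln : (k - l < n)%N by apply: leq_ltn_trans kn; apply: leq_subr.
by rewrite ln kln.
Qed.

HB.instance Definition _ :=
  GRing.isZmodMorphism.Build (fps A) F2 (sub1 P1) sub1_additive.
HB.instance Definition _ :=
  GRing.isMonoidMorphism.Build (fps A) F2 (sub1 P1) sub1_multiplicative.

Lemma sub1_C c : sub1 P1 (fpsC c) = psi c.
Proof.
apply: funext => i; apply: funext => j; rewrite /sub1 /sub1_upto big_ord_recl mulr1.
by rewrite big1 ?addr0 // => k _; rewrite /fpsC /= rmorph0 mul0r.
Qed.

Lemma sub1_X : sub1 P1 fpsX = P.
Proof.
apply: funext => i; apply: funext => j; rewrite (@sub1E (i + j).+2) //.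
rewrite /sub1_upto 2!big_ord_recl big1 => [|k _]; last first.
  by rewrite /fpsX /= rmorph0 mul0r.
by rewrite /fpsX /= rmorph0 rmorph1 mul0r mul1r add0r addr0.
Qed.

Lemma sub1_mdeg n a :
  (forall k, mdeg (n - k) (psi (a k))) -> mdeg n (sub1 P1 a).
Proof.
move=> H i j ij; apply: (mdeg_sum (n := n)) => // k _.
have [kn|/ltnW nk] := leqP k n.
  by rewrite -[X in mdeg X](subnK kn); apply: mdegM; [apply: H|apply: mdegX].
by apply: mdeg_le nk _; apply/mdegMr/mdegX.
Qed.

End Sub1.

(** * Convergence of selected, differentiated and substituted series *)

Section Convergence.
Variable R : realType.
Local Notation C := (R[i]).
Local Notation F2 := (fps (fps C)).
Local Notation normc := (@complex.ComplexField.Normc.normc R).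
Implicit Types a b P Q : F2.

Lemma convergent_coef a : convergent (a : ps R) <->
  exists r M, 0 < r <= 1 /\ forall i j, normc (a i j) * r ^+ (i + j) <= M.
Proof.
split=> [/convergent_bounded[r [M [r0 H]]]|[r [M [/andP[r0 _] H]]]].
  have m0 : 0 < Num.min r 1 by rewrite lt_min r0 ltr01.
  exists (Num.min r 1), M; split=> [|i j]; first by rewrite m0 ge_min lexx orbT.
  have H' : bounded2 (Num.min r 1) (Num.min r 1) M a.
    by apply: bounded2_le H; rewrite ltW //= ge_min lexx.
  apply: le_trans (H' (maxn i j).+1 isT); rewrite addnC exprD mulrA.
  by apply: norm2_coef; rewrite ?(ltW m0) // ltnS ?leq_maxl ?leq_maxr.
have r2 : 0 < r / 2 by rewrite divr_gt0.
apply: (bounded2_convergent r2 r2 (bounded2_half r0 r0 (M := M) _)) => i j.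
by rewrite -mulrA -exprD addnC.
Qed.

(** One domination criterion for shifts, for selecting every N-th power of x, and for derivations,
    whose factors i + 1 and j + 1 are absorbed by 2^(i + j). *)
Lemma convergent_dom a b N k l : (0 < N)%N ->
  (forall i j, normc (b i j) <= normc (a (N * i + k)%N (j + l)%N) * 2 ^+ (i + j)) ->
  convergent (a : ps R) -> convergent (b : ps R).
Proof.
move=> N0 H /convergent_coef[r [M [/andP[r0 r1] Ha]]].
have rk0 : 0 < r ^+ (k + l) by rewrite exprn_gt0.
apply/convergent_coef; exists (r ^+ N / 2), (M / r ^+ (k + l)); split.
  rewrite divr_gt0 ?exprn_gt0 //= ler_pdivrMr // mul1r.
  by apply: (@le_trans _ _ 1); rewrite ?exprn_ile1 ?ler1n // ltW.
move=> i j; rewrite ler_pdivlMr //.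
apply: le_trans (Ha (N * i + k)%N (j + l)%N).
have -> : r ^+ (N * i + k + (j + l)) = r ^+ (N * i + j) * r ^+ (k + l).
  by rewrite -exprD; congr (_ ^+ _); lia.
rewrite mulrA ler_wpM2r ?(ltW rk0) //.
have p0 : 0 < r ^+ N / 2 by rewrite divr_gt0 ?exprn_gt0.
apply: le_trans (ler_wpM2r (exprn_ge0 _ (ltW p0)) (H i j)) _.
rewrite -mulrA ler_wpM2l ?normc_ge0 // -exprMn mulrC divfK ?pnatr_eq0 // -exprM.
by apply: ler_wiXn2l; rewrite ?(ltW r0) // mulnDr leq_add2l leq_pmull.
Qed.

Lemma norm2_ext r s n a b :
  (forall i j, (i < n)%N -> (j < n)%N -> a i j = b i j) -> norm2 r s n a = norm2 r s n b.
Proof.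
move=> H; rewrite !norm2E; apply: eq_bigr => i _; apply: eq_bigr => j _.
by rewrite H.
Qed.

Definition cst2 : C -> F2 := @fpsC (fps C) \o @fpsC C.
HB.instance Definition _ := GRing.RMorphism.on cst2.

Lemma cst2M c a i j : (cst2 c * a) i j = c * a i j.
Proof. by rewrite /cst2 /= !fpsCM. Qed.

Lemma cst2E c i j : cst2 c i j = if (i == 0%N) && (j == 0%N) then c else 0.
Proof. by rewrite /cst2 /= /fpsC; case: i => [|i] //; case: j. Qed.

Lemma norm2_cst r s n c : norm2 r s n (cst2 c) <= normc c.
Proof.
case: n => [|n]; first by rewrite norm2E big_ord0 normc_ge0.
have n0 : normc 0 = 0 := seminorm0 (@normc_seminorm R).
rewrite norm2E big_ord_recl [X in _ + X]big1 => [|i _]; last first.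
  by rewrite big1 // => j _; rewrite (_ : cst2 c _ _ = 0) ?n0 ?mul0r // cst2E lift0.
rewrite addr0 big_ord_recl [X in _ + X]big1 => [|j _]; first by rewrite addr0 cst2E !mulr1.
by rewrite (_ : cst2 c _ _ = 0) ?n0 ?mul0r // cst2E lift0.
Qed.

Definition fsub P Q (HP : mdeg 1 P) (HQ : mdeg 1 Q) : {rmorphism F2 -> F2} :=
  sub1 (sub1 cst2 HQ) HP.

(** The coefficients with i, j < n involve terms of degree up to i + j, hence the cut-off n + n on
    the right. *)
Lemma norm2_fsub P Q (HP : mdeg 1 P) (HQ : mdeg 1 Q) r rho n a : 0 <= r -> (0 < n)%N ->
  norm2 r r n P <= rho -> norm2 r r n Q <= rho ->
  norm2 r r n (fsub HP HQ a) <= norm2 rho rho (n + n) a.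
Proof.
move=> r0 n0 Pr Qr; have N := norm2_seminorm r0 r0 n0.
have rho0 : 0 <= rho by apply: le_trans Pr; apply: seminorm_ge0.
rewrite (@norm2_ext r r n _ (sub1_upto (sub1 cst2 HQ) P (n + n) a)); last first.
  by move=> i j ni nj; apply: sub1E; lia.
apply: le_trans (seminorm_sum N _ _ _) _; apply: ler_sum => k _.
apply: le_trans (seminormM N _ _) _.
apply: ler_pM; try exact: (seminorm_ge0 N); last first.
  apply: le_trans (seminormX N _ _) _.
  by apply: lerXn2r; rewrite ?nnegrE // (seminorm_ge0 N).
rewrite (@norm2_ext r r n _ (sub1_upto cst2 Q (n + n) (a k))); last first.
  by move=> i j ni nj; apply: sub1E; lia.
apply: le_trans (seminorm_sum N _ _ _) _; apply: ler_sum => l _.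
apply: le_trans (seminormM N _ _) _.
apply: ler_pM; rewrite ?(seminorm_ge0 N) ?norm2_cst //.
apply: le_trans (seminormX N _ _) _.
by apply: lerXn2r; rewrite ?nnegrE // (seminorm_ge0 N).
Qed.

(** Every monomial of P has degree at least 1 and so gains at least one factor t. *)
Lemma norm2_shrink r t n P : 0 <= r -> 0 <= t <= 1 -> mdeg 1 P ->
  norm2 (t * r) (t * r) n P <= t * norm2 r r n P.
Proof.
move=> r0 /andP[t0 t1] P1; rewrite !norm2E mulr_sumr; apply: ler_sum => i _.
rewrite mulr_sumr; apply: ler_sum => j _; rewrite -!mulrA -!exprD exprMn.
have [ij|ij] := posnP (j + i)%N.
  rewrite P1; last by lia.
  by rewrite (seminorm0 (@normc_seminorm R)) !mul0r mulr0.
rewrite [leRHS]mulrCA ler_wpM2l ?normc_ge0 // ler_wpM2r ?exprn_ge0 //.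
by rewrite -[leRHS]expr1; apply: ler_wiXn2l.
Qed.

Lemma convergent_small P rho : convergent (P : ps R) -> mdeg 1 P -> 0 < rho ->
  exists r0, 0 < r0 /\ forall r, 0 <= r <= r0 -> bounded2 r r rho P.
Proof.
move=> /convergent_bounded[r [M [r0 H]]] P1 rho0.
have M0 : 0 <= M.
  by apply: le_trans (H 1%N isT); apply: seminorm_ge0; apply: norm2_seminorm; rewrite ?ltW.
pose t := Num.min 1 (rho / (M + 1)).
have t0 : 0 < t by rewrite lt_min ltr01 divr_gt0 // ltr_wpDl.
exists (t * r); split=> [|r' r'r]; first by rewrite mulr_gt0.
apply: (bounded2_le r'r r'r) => n n0.
apply: le_trans (norm2_shrink _ (ltW r0) _ P1) _; first by rewrite ltW // ge_min lexx.
apply: (@le_trans _ _ (t * (M + 1))).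
  rewrite ler_wpM2l ?(ltW t0) //; apply: le_trans (H n n0) _.
  by rewrite lerDl.
by rewrite -ler_pdivlMr ?ge_min ?lexx ?orbT // ltr_wpDl.
Qed.

Lemma convergent_fsub P Q (HP : mdeg 1 P) (HQ : mdeg 1 Q) a :
  convergent (P : ps R) -> convergent (Q : ps R) -> convergent (a : ps R) ->
  convergent (fsub HP HQ a : ps R).
Proof.
move=> cP cQ /convergent_bounded[rho [M [rho0 Ha]]].
have [r [r0 HrP]] := convergent_small cP HP rho0.
have [s [s0 HsQ]] := convergent_small cQ HQ rho0.
have m0 : 0 < Num.min r s by rewrite lt_min r0.
apply: (bounded2_convergent m0 m0 (M := M)) => n n0.
apply: le_trans (norm2_fsub HP HQ a (ltW m0) n0 _ _) (Ha _ _); last by lia.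
  by apply: HrP => //; rewrite ltW //= ge_min lexx.
by apply: HsQ => //; rewrite ltW //= ge_min lexx orbT.
Qed.

End Convergence.

(** * The ring of germs *)

Fact fps_at0_additive (A : comNzRingType) : {morph (fun a : fps A => a 0%N) : a b / a - b}.
Proof. by []. Qed.
Fact fps_at0_multiplicative (A : comNzRingType) : monoid_morphism (fun a : fps A => a 0%N).
Proof. by split=> // a b; apply: fpsM0. Qed.
Definition fps_at0 (A : comNzRingType) (a : fps A) : A := a 0%N.
HB.instance Definition _ (A : comNzRingType) :=
  GRing.isZmodMorphism.Build (fps A) A (@fps_at0 A) (@fps_at0_additive A).
HB.instance Definition _ (A : comNzRingType) :=
  GRing.isMonoidMorphism.Build (fps A) A (@fps_at0 A) (@fps_at0_multiplicative A).

Notation "a ~[ i , j ]" := (gval a i%N j%N)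
  (at level 2, left associativity, format "a ~[ i ,  j ]") : ring_scope.

Section Germs.
Variable R : realType.
Local Notation C := (R[i]).
Local Notation F2 := (fps (fps C)).
Local Notation O := (germ R).
Local Notation normc := (@complex.ComplexField.Normc.normc R).
Implicit Types a b P Q : O.

Lemma germ_eqP a b : (forall i j, a~[i, j] = b~[i, j]) -> a = b.
Proof. by move=> H; apply: val_inj; apply: funext => i; apply: funext => j; apply: H. Qed.

Lemma germ_conv a : convergent (gval a : ps R).
Proof. exact/asboolP/(germP a). Qed.

Definition mkgerm (a : F2) (ca : convergent (a : ps R)) : O := Germ (asboolT ca).

Lemma gD a b i j : (a + b)~[i, j] = a~[i, j] + b~[i, j]. Proof. by []. Qed.
Lemma gN a i j : (- a)~[i, j] = - a~[i, j]. Proof. by []. Qed.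
Lemma g0 i j : (0 : O)~[i, j] = 0. Proof. by []. Qed.
Lemma g1 i j : (1 : O)~[i, j] = ((i == 0) && (j == 0))%N%:R.
Proof. by case: i => [|i] //; case: j. Qed.
Lemma gM a b i j : (a * b)~[i, j] =
  \sum_(k < i.+1) \sum_(l < j.+1) a~[k, l] * b~[i - k, j - l].
Proof. exact: (fpsM2 (gval a) (gval b)). Qed.
Lemma gM00 a b : (a * b)~[0, 0] = a~[0, 0] * b~[0, 0].
Proof. by rewrite gM !big_ord1. Qed.
Lemma g_sum I r (p : pred I) (F : I -> O) i j :
  (\sum_(k <- r | p k) F k)~[i, j] = \sum_(k <- r | p k) (F k)~[i, j].
Proof. by elim/big_rec2: _ => // k y1 y2 _ <-. Qed.

Fact gC_conv (c : C) : cst2 c \in @convp R.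
Proof.
apply/asboolP/convergent_bounded; exists 1, (normc c).
by split=> // n _; apply: norm2_cst.
Qed.
Definition gC (c : C) : O := Germ (gC_conv c).
Fact gC_additive : {morph gC : c d / c - d}.
Proof. by move=> c d; apply: val_inj; rewrite /= rmorphB. Qed.
Fact gC_multiplicative : monoid_morphism gC.
Proof. by split=> [|c d]; apply: val_inj; rewrite /= ?rmorph1 ?rmorphM. Qed.
HB.instance Definition _ := GRing.isZmodMorphism.Build C O gC gC_additive.
HB.instance Definition _ := GRing.isMonoidMorphism.Build C O gC gC_multiplicative.

Lemma gCM c a i j : (gC c * a)~[i, j] = c * a~[i, j].
Proof. exact: (cst2M c (gval a)). Qed.
Lemma gCE c i j : (gC c)~[i, j] = if (i == 0%N) && (j == 0%N) then c else 0.
Proof. exact: cst2E. Qed.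

Lemma gnat_conv (a : F2) : (forall i j, exists n : bool, a i j = n%:R) -> a \in @convp R.
Proof.
move=> H; apply/asboolP/convergent_coef; exists 1, 1; split=> [|i j].
  by rewrite ltr01 lexx.
rewrite expr1n mulr1; have [[] ->] := H i j.
  by rewrite complex.ComplexField.Normc.normc1.
by rewrite (seminorm0 (@normc_seminorm R)).
Qed.

Fact gX_conv : (fpsX : F2) \in @convp R.
Proof.
by apply: gnat_conv => i j; exists ((i == 1%N) && (j == 0%N)); case: i => [|[|i]] //; case: j.
Qed.
Definition gX : O := Germ gX_conv.
Fact gY_conv : (fpsC fpsX : F2) \in @convp R.
Proof.
by apply: gnat_conv => i j; exists ((i == 0%N) && (j == 1%N)); case: i => [|i] //.
Qed.
Definition gY : O := Germ gY_conv.

Lemma gvalX a n : gval (a ^+ n) = gval a ^+ n.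
Proof. by elim: n => // n IH; rewrite !exprS -IH. Qed.

Lemma gXnM n a i j : (gX ^+ n * a)~[i, j] = if (n <= i)%N then a~[i - n, j] else 0.
Proof.
have -> : gval (gX ^+ n * a) = fpsX ^+ n * gval a by rewrite -[fpsX]/(gval gX) -gvalX.
by rewrite fpsXnM; case: ifP.
Qed.
Lemma gYnM n a i j : (gY ^+ n * a)~[i, j] = if (n <= j)%N then a~[i, j - n] else 0.
Proof.
have -> : gval (gY ^+ n * a) = fpsC (fpsX ^+ n) * gval a.
  by rewrite rmorphXn /= -[fpsC fpsX]/(gval gY) -gvalX.
by rewrite fpsCM fpsXnM.
Qed.
Lemma gXE i j : gX~[i, j] = ((i == 1) && (j == 0))%N%:R.
Proof. by case: i => [|[|i]] //; case: j. Qed.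
Lemma gYE i j : gY~[i, j] = ((i == 0) && (j == 1))%N%:R.
Proof. by case: i => [|i] //. Qed.

Definition gmon (c : C) k l : O := gC c * (gX ^+ k * gY ^+ l).

Arguments gval : simpl never.

Lemma gmonE c k l i j : (gmon c k l)~[i, j] = if (i == k) && (j == l) then c else 0.
Proof.
rewrite gCM gXnM; case: leqP => ki; last by rewrite (ltn_eqF ki) mulr0.
rewrite -[gY ^+ l]mulr1 gYnM; case: leqP => lj; last by rewrite (ltn_eqF lj) andbF mulr0.
rewrite g1 !subn_eq0 !eqn_leq ki lj !andbT.
by case: (_ && _); rewrite ?mulr1 ?mulr0.
Qed.

Definition gtrunc n a : O := \sum_(k < n) \sum_(l < n) gmon a~[k, l] k l.

Lemma gtruncE n a i j : (gtrunc n a)~[i, j] = if (i < n)%N && (j < n)%N then a~[i, j] else 0.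
Proof.
rewrite g_sum; case: ifPn => [/andP[ni nj]|nij].
  rewrite (bigD1 (Ordinal ni)) //= g_sum (bigD1 (Ordinal nj)) //=. rewrite gmonE !eqxx /=.
  rewrite !big1 ?addr0 // => [k ki|l lj].
    rewrite g_sum big1 // => l _; rewrite gmonE ifN // negb_and.
    by rewrite eq_sym; move: ki; rewrite -val_eqE /= => ->.
  rewrite gmonE ifN // negb_and orbC.
  by rewrite eq_sym; move: lj; rewrite -val_eqE /= => ->.
rewrite big1 // => k _; rewrite g_sum big1 // => l _; rewrite gmonE ifN //.
apply: contra nij => /andP[/eqP -> /eqP ->]; by rewrite !ltn_ord.
Qed.

Lemma gtrunc_mdeg n a : mdeg n (a - gtrunc n a).
Proof.
move=> i j ij; rewrite gD gN gtruncE ifT ?subrr //.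
by apply/andP; split; lia.
Qed.

Section HomExt.
Variables phi chi : O -> O.
Hypothesis phiD : forall a b, phi (a + b) = phi a + phi b.
Hypothesis chiD : forall a b, chi (a + b) = chi a + chi b.
Hypothesis mon : forall c k l, phi (gmon c k l) = chi (gmon c k l).
Hypothesis phi_cont : forall n, exists m, forall a, mdeg m a -> mdeg n (phi a).
Hypothesis chi_cont : forall n, exists m, forall a, mdeg m a -> mdeg n (chi a).

(** Truncations are finite sums of monomials, and continuity for the powers of the maximal ideal
    carries the agreement over to the whole germ. *)
Lemma germ_cont_ext a : phi a = chi a.
Proof.
have add0 (f : O -> O) : (forall a b, f (a + b) = f a + f b) -> f 0 = 0 :> O.
  by move=> fD; have /eqP := fD 0 0; rewrite addr0 addrC -subr_eq subrr => /eqP.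
apply: germ_eqP => i j; have [n1 h1] := phi_cont (i + j).+1.
have [n2 h2] := chi_cont (i + j).+1; set n := maxn n1 n2.
have m1 : mdeg n1 (a - gtrunc n a).
  by apply: (@mdeg_le _ _ n); [apply: leq_maxl|apply: gtrunc_mdeg].
have m2 : mdeg n2 (a - gtrunc n a).
  by apply: (@mdeg_le _ _ n); [apply: leq_maxr|apply: gtrunc_mdeg].
rewrite -(subrK (gtrunc n a) a) phiD chiD !gD.
rewrite (h1 _ m1) // (h2 _ m2) // !add0r.
congr (gval _ i j); rewrite /gtrunc.
rewrite (big_morph phi phiD (add0 _ phiD)) (big_morph chi chiD (add0 _ chiD)).
apply: eq_bigr => k _.
rewrite (big_morph phi phiD (add0 _ phiD)) (big_morph chi chiD (add0 _ chiD)).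
by apply: eq_bigr => l _.
Qed.
End HomExt.

(** Continuity with a loss of one degree is what derivations satisfy. *)
Lemma germ_hom_ext (phi chi : O -> O) :
  (forall a b, phi (a + b) = phi a + phi b) -> (forall a b, chi (a + b) = chi a + chi b) ->
  (forall c k l, phi (gmon c k l) = chi (gmon c k l)) ->
  (forall n a, mdeg n.+1 a -> mdeg n (phi a)) ->
  (forall n a, mdeg n.+1 a -> mdeg n (chi a)) -> phi =1 chi.
Proof.
move=> phiD chiD mon pc cc a; apply: germ_cont_ext => // n; exists n.+1.
  exact: pc.
exact: cc.
Qed.

Definition mpart P : O := P - gC (P~[0, 0]).
Fact mpart_mdeg P : mdeg 1 (mpart P).
Proof. by move=> [|i] [|j] //= _; rewrite gD gN gCE subrr. Qed.
Lemma mpart_id P : P~[0, 0] = 0 -> mpart P = P.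
Proof. by move=> P0; rewrite /mpart P0 rmorph0 subr0. Qed.

(* Substitution x := P, y := Q; to have it total, the constant terms of P and Q are dropped. *)
Definition fsubg P Q : {rmorphism F2 -> F2} := fsub (@mpart_mdeg P) (@mpart_mdeg Q).
Fact sub_conv P Q a : fsubg P Q (gval a) \in @convp R.
Proof. by apply/asboolP/convergent_fsub; apply: germ_conv. Qed.
Definition sub P Q a : O := Germ (sub_conv P Q a).
Lemma gval_sub P Q a : gval (sub P Q a) = fsubg P Q (gval a). Proof. by []. Qed.
Fact sub_additive P Q : {morph sub P Q : a b / a - b}.
Proof. by move=> a b; apply: val_inj; exact: (rmorphB (fsubg P Q) (gval a) (gval b)). Qed.
Fact sub_multiplicative P Q : monoid_morphism (sub P Q).
Proof.
split=> [|a b]; apply: val_inj; first exact: (rmorph1 (fsubg P Q)).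
exact: (rmorphM (fsubg P Q) (gval a) (gval b)).
Qed.
HB.instance Definition _ P Q := GRing.isZmodMorphism.Build O O (sub P Q) (sub_additive P Q).
HB.instance Definition _ P Q :=
  GRing.isMonoidMorphism.Build O O (sub P Q) (sub_multiplicative P Q).

Lemma sub_C P Q c : sub P Q (gC c) = gC c.
Proof. by apply: val_inj; rewrite /= gval_sub /fsubg /fsub /= sub1_C /= sub1_C. Qed.
Lemma sub_X P Q : P~[0, 0] = 0 -> sub P Q gX = P.
Proof. by move=> /mpart_id P0; apply: val_inj; rewrite /= gval_sub /fsubg /fsub /= sub1_X P0. Qed.
Lemma sub_Y P Q : Q~[0, 0] = 0 -> sub P Q gY = Q.
Proof.
by move=> /mpart_id Q0; apply: val_inj; rewrite /= gval_sub /fsubg /fsub /= sub1_C /= sub1_X Q0.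
Qed.

Lemma sub_mdeg P Q n a : mdeg n a -> mdeg n (sub P Q a).
Proof.
move=> na; apply: sub1_mdeg => k; apply: sub1_mdeg => l i j ij.
suff : cst2 a~[k, l] i j = 0 by [].
by rewrite cst2E; case: ifP => // _; apply: na; lia.
Qed.

Lemma sub_coef P Q a n i j : P~[0, 0] = 0 -> Q~[0, 0] = 0 -> (i + j < n)%N ->
  (sub P Q a)~[i, j] = \sum_(k < n) \sum_(l < n) a~[k, l] * (P ^+ k * Q ^+ l)~[i, j].
Proof.
move=> P0 Q0 ij; rewrite -[in LHS](subrK (gtrunc n a) a) rmorphD gD.
rewrite (@sub_mdeg P Q n _ (@gtrunc_mdeg n a)) // add0r /gtrunc rmorph_sum g_sum.
apply: eq_bigr => k _; rewrite rmorph_sum g_sum; apply: eq_bigr => l _.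
by rewrite /gmon !rmorphM /= sub_C !rmorphXn /= sub_X // sub_Y // gCM.
Qed.

Lemma sub_00 P Q a : P~[0, 0] = 0 -> Q~[0, 0] = 0 -> (sub P Q a)~[0, 0] = a~[0, 0].
Proof.
by move=> P0 Q0; rewrite (@sub_coef _ _ _ 1) // !big_ord1 !expr0 mulr1 g1 mulr1.
Qed.

Lemma sub_ext (phi : {rmorphism O -> O}) P Q : P~[0, 0] = 0 -> Q~[0, 0] = 0 ->
  (forall c, phi (gC c) = gC c) -> phi gX = P -> phi gY = Q ->
  (forall n a, mdeg n a -> mdeg n (phi a)) -> phi =1 sub P Q.
Proof.
move=> P0 Q0 hC hX hY hc; apply: germ_hom_ext; try exact: rmorphD.
- by move=> c k l; rewrite /gmon !rmorphM !rmorphXn /= hC hX hY sub_C sub_X // sub_Y.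
- by move=> n a /(mdeg_le (leqnSn n)) /hc.
- by move=> n a /(mdeg_le (leqnSn n)); apply: sub_mdeg.
Qed.

Lemma sub_comp A B P Q a : A~[0, 0] = 0 -> B~[0, 0] = 0 -> P~[0, 0] = 0 -> Q~[0, 0] = 0 ->
  sub A B (sub P Q a) = sub (sub A B P) (sub A B Q) a.
Proof.
move=> A0 B0 P0 Q0.
apply: (@sub_ext (sub A B \o sub P Q)); rewrite ?sub_00 //=.
- by move=> c; rewrite !sub_C.
- by rewrite sub_X.
- by rewrite sub_Y.
- by move=> n b nb; do 2!apply: sub_mdeg.
Qed.

Lemma sub_id a : sub gX gY a = a.
Proof. by rewrite -(@sub_ext idfun). Qed.

End Germs.

Opaque sub.
Arguments gval : simpl never.

(** * Restrictions, shifts, derivations and inverses of germs *)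

Section GermOps.
Variable R : realType.
Local Notation C := (R[i]).
Local Notation F2 := (fps (fps C)).
Local Notation O := (germ R).
Local Notation normc := (@complex.ComplexField.Normc.normc R).
Implicit Types a b P Q : O.

Lemma germ_mdegD n a b : mdeg n a -> mdeg n b -> mdeg n (a + b).
Proof. exact: (@mdegD _ n (gval a) (gval b)). Qed.
Lemma germ_mdegMl n a b : mdeg n a -> mdeg n (a * b).
Proof. by rewrite mulrC; apply: (@mdegMr _ n (gval b) (gval a)). Qed.

(* Restrictions to the axes y = 0 and x = 0. *)
Definition rx a : fps C := fps_map (@fps_at0 C) (gval a).
Definition ry a : fps C := gval a 0%N.
Lemma rxE a i : rx a i = a~[i, 0]. Proof. by []. Qed.
Lemma ryE a j : ry a j = a~[0, j]. Proof. by []. Qed.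
Fact rx_additive : {morph rx : a b / a - b}. Proof. by []. Qed.
Fact rx_multiplicative : monoid_morphism rx.
Proof.
split=> [|a b]; first exact: (rmorph1 (fps_map (@fps_at0 C))).
by move: (rmorphM (fps_map (@fps_at0 C)) (gval a) (gval b)).
Qed.
HB.instance Definition _ := GRing.isZmodMorphism.Build O (fps C) rx rx_additive.
HB.instance Definition _ := GRing.isMonoidMorphism.Build O (fps C) rx rx_multiplicative.
Fact ry_additive : {morph ry : a b / a - b}. Proof. by []. Qed.
Fact ry_multiplicative : monoid_morphism ry.
Proof. by split=> // a b; exact: (fpsM0 (gval a) (gval b)). Qed.
HB.instance Definition _ := GRing.isZmodMorphism.Build O (fps C) ry ry_additive.
HB.instance Definition _ := GRing.isMonoidMorphism.Build O (fps C) ry ry_multiplicative.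

Lemma germ_dom (b : F2) a N k l : (0 < N)%N ->
  (forall i j, normc (b i j) <= normc (a~[N * i + k, j + l]) * 2 ^+ (i + j)) ->
  convergent (b : ps R).
Proof. by move=> N0 H; apply: (convergent_dom N0 H); apply: germ_conv. Qed.

Lemma exp2_ge1 n : 1 <= 2 ^+ n :> R.
Proof. by rewrite exprn_ege1 // ler1n. Qed.

Lemma germ_sel (b : F2) a N k l : (0 < N)%N ->
  (forall i j, b i j = a~[N * i + k, j + l] \/ b i j = 0) ->
  convergent (b : ps R).
Proof.
move=> N0 H; apply: (@germ_dom _ a N k l) => // i j.
have [->|->] := H i j; first by rewrite ler_peMr ?normc_ge0 ?exp2_ge1.
by rewrite (seminorm0 (@normc_seminorm R)) mulr_ge0 ?normc_ge0 ?exprn_ge0.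
Qed.

Fact r0_conv a : convergent ((fun i j => if j == 0%N then a~[i, 0] else 0) : ps R).
Proof.
apply: (@germ_sel _ a 1 0 0) => // i [|j]; [left|by right].
by rewrite mul1n !addn0.
Qed.
Definition r0 a : O := mkgerm (r0_conv a).

Fact shx_conv a : convergent ((fun i j => a~[i.+1, j]) : ps R).
Proof. by apply: (@germ_sel _ a 1 1 0) => // i j; left; rewrite mul1n addn1 addn0. Qed.
Definition shx a : O := mkgerm (shx_conv a).
Fact shy_conv d a : convergent ((fun i j => a~[i, j + d]) : ps R).
Proof. by apply: (@germ_sel _ a 1 0 d) => // i j; left; rewrite mul1n addn0. Qed.
Definition shy d a : O := mkgerm (shy_conv d a).
Fact px_conv N k a : (0 < N)%N -> convergent ((fun i j => a~[N * i + k, j]) : ps R).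
Proof. by move=> N0; apply: (@germ_sel _ a N k 0) => // i j; left; rewrite addn0. Qed.

Lemma normc_nat n (z : C) : normc (n.+1%:R * z) <= normc z * 2 ^+ n.
Proof.
rewrite complex.ComplexField.Normc.normcM mulrC ler_wpM2l ?normc_ge0 //.
apply: (@le_trans _ _ n.+1%:R).
  elim: n.+1 => [|m IH]; first by rewrite (seminorm0 (@normc_seminorm R)).
  rewrite -[in leLHS]addn1 -[leRHS]natr1 natrD; apply: le_trans (le_normcD _ _) _.
  by rewrite complex.ComplexField.Normc.normc1 lerD2r.
by rewrite -natrX ler_nat ltn_expl.
Qed.

Fact dx_conv a : convergent (psdx (gval a : ps R)).
Proof.
apply: (@germ_dom _ a 1 1 0) => // i j; rewrite mul1n addn1 addn0 /psdx.
apply: le_trans (normc_nat _ _) _; rewrite ler_wpM2l ?normc_ge0 //.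
by rewrite ler_weXn2l ?leq_addr // ler1n.
Qed.
Definition dx a : O := mkgerm (dx_conv a).
Fact dy_conv a : convergent (psdy (gval a : ps R)).
Proof.
apply: (@germ_dom _ a 1 0 1) => // i j; rewrite mul1n addn1 addn0 /psdy.
apply: le_trans (normc_nat _ _) _; rewrite ler_wpM2l ?normc_ge0 //.
by rewrite ler_weXn2l ?leq_addl // ler1n.
Qed.
Definition dy a : O := mkgerm (dy_conv a).

Lemma dxE a i j : (dx a)~[i, j] = i.+1%:R * a~[i.+1, j]. Proof. by []. Qed.
Lemma dyE a i j : (dy a)~[i, j] = j.+1%:R * a~[i, j.+1]. Proof. by []. Qed.
Lemma r0E a i j : (r0 a)~[i, j] = if j == 0%N then a~[i, 0] else 0. Proof. by []. Qed.
Lemma shxE a i j : (shx a)~[i, j] = a~[i.+1, j]. Proof. by []. Qed.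
Lemma shyE d a i j : (shy d a)~[i, j] = a~[i, j + d]. Proof. by []. Qed.

Lemma natr_fpsM n (b : fps C) i : (n%:R * b) i = n%:R * b i.
Proof. by rewrite -[n%:R in LHS](rmorph_nat (@fpsC C)) fpsCM. Qed.

Lemma dx_deriv a : gval (dx a) = fps_deriv (gval a).
Proof.
apply: funext => i; apply: funext => j; rewrite /fps_deriv natr_fpsM //.
Qed.
Lemma dxD a b : dx (a + b) = dx a + dx b.
Proof. by apply: val_inj; rewrite [LHS]dx_deriv (fps_derivD (gval a) (gval b)) -!dx_deriv. Qed.
Lemma dyD a b : dy (a + b) = dy a + dy b.
Proof. by apply: germ_eqP => i j; rewrite gD !dyE gD mulrDr. Qed.
Lemma dxM a b : dx (a * b) = dx a * b + a * dx b.
Proof. by apply: val_inj; rewrite [LHS]dx_deriv (fps_derivM (gval a) (gval b)) -!dx_deriv. Qed.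
Lemma dyM a b : dy (a * b) = dy a * b + a * dy b.
Proof.
apply: germ_eqP => i j; rewrite gD.
have -> : (dy (a * b))~[i, j] = (fps_deriv (\sum_(k < i.+1) gval a k * gval b (i - k)%N)) j.
  by rewrite /fps_deriv fps_sum; congr (_ * _); rewrite gM.
rewrite (big_morph _ (@fps_derivD C) (_ : fps_deriv 0 = 0)); last first.
  by apply: funext => k; rewrite /fps_deriv mulr0.
rewrite (eq_bigr (fun k : 'I_i.+1 => gval (dy a) k * gval b (i - k)%N
                             + gval a k * gval (dy b) (i - k)%N)); last first.
  by move=> k _; rewrite fps_derivM.
by rewrite big_split [LHS]fpsD !fps_sum !gM; congr (_ + _); apply: eq_bigr => k _; rewrite fpsM.
Qed.
Lemma dxC c : dx (gC c) = 0.
Proof. by apply: germ_eqP => i j; rewrite dxE gCE mulr0. Qed.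
Lemma dyC c : dy (gC c) = 0.
Proof. by apply: germ_eqP => i j; rewrite dyE gCE andbF mulr0. Qed.
Lemma dxX : dx (gX R) = 1.
Proof.
by apply: germ_eqP => -[|i] j; rewrite dxE gXE g1 ?mul1r ?mulr0.
Qed.
Lemma dxY : dx (gY R) = 0.
Proof. by apply: germ_eqP => i j; rewrite dxE gYE mulr0. Qed.
Lemma dyX : dy (gX R) = 0.
Proof. by apply: germ_eqP => i j; rewrite dyE gXE andbF mulr0. Qed.
Lemma dyY : dy (gY R) = 1.
Proof.
by apply: germ_eqP => i [|j]; rewrite dyE gYE g1 ?mul1r ?andbT // andbF mulr0.
Qed.

Lemma dx_mdeg n a : mdeg n.+1 a -> mdeg n (dx a).
Proof. by move=> H i j ij; rewrite dxE H ?mulr0 //; lia. Qed.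
Lemma dy_mdeg n a : mdeg n.+1 a -> mdeg n (dy a).
Proof. by move=> H i j ij; rewrite dyE H ?mulr0 //; lia. Qed.

(** A derivation along s is determined by its values on constants, x and y. This gives the chain
    rules [dx_sub] and [dy_sub] without computing with coefficients. *)
Lemma derivation_ext (s : {rmorphism O -> O}) (D E : O -> O) :
  (forall n a, mdeg n a -> mdeg n (s a)) ->
  (forall a b, D (a + b) = D a + D b) -> (forall a b, E (a + b) = E a + E b) ->
  (forall a b, D (a * b) = D a * s b + s a * D b) ->
  (forall a b, E (a * b) = E a * s b + s a * E b) ->
  (forall c, D (gC c) = E (gC c)) -> D (gX R) = E (gX R) -> D (gY R) = E (gY R) ->
  (forall n a, mdeg n.+1 a -> mdeg n (D a)) ->
  (forall n a, mdeg n.+1 a -> mdeg n (E a)) -> D =1 E.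
Proof.
move=> sc DD ED DM EM DC DX DY Dc Ec; apply: germ_hom_ext => // c k l.
have pw z : D z = E z -> forall n, D (z ^+ n) = E (z ^+ n).
  move=> zz; elim=> [|n IH]; first by rewrite expr0 -(rmorph1 (@gC R)) DC.
  by rewrite exprS DM EM zz IH.
by rewrite /gmon DM EM DC DM EM !pw.
Qed.

Lemma dx_sub P Q a : P~[0, 0] = 0 -> Q~[0, 0] = 0 ->
  dx (sub P Q a) = sub P Q (dx a) * dx P + sub P Q (dy a) * dx Q.
Proof.
move=> P0 Q0; apply: (derivation_ext (s := sub P Q) (D := fun a => dx (sub P Q a))
  (E := fun a => sub P Q (dx a) * dx P + sub P Q (dy a) * dx Q))
  => [n b|b c|b c|b c|b c|c|||n b nb|n b nb].
- exact: sub_mdeg.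
- by rewrite rmorphD dxD.
- by rewrite dxD dyD !rmorphD /=; ring.
- by rewrite rmorphM dxM.
- by rewrite dxM dyM !rmorphD !rmorphM /=; ring.
- by rewrite sub_C dxC dyC rmorph0; ring.
- by rewrite sub_X // dxX dyX rmorph0 rmorph1; ring.
- by rewrite sub_Y // dxY dyY rmorph0 rmorph1; ring.
- by apply: dx_mdeg; apply: sub_mdeg.
- by apply: germ_mdegD; apply: germ_mdegMl; apply: sub_mdeg; [apply: dx_mdeg|apply: dy_mdeg].
Qed.

Lemma dy_sub P Q a : P~[0, 0] = 0 -> Q~[0, 0] = 0 ->
  dy (sub P Q a) = sub P Q (dx a) * dy P + sub P Q (dy a) * dy Q.
Proof.
move=> P0 Q0; apply: (derivation_ext (s := sub P Q) (D := fun a => dy (sub P Q a))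
  (E := fun a => sub P Q (dx a) * dy P + sub P Q (dy a) * dy Q))
  => [n b|b c|b c|b c|b c|c|||n b nb|n b nb].
- exact: sub_mdeg.
- by rewrite rmorphD dyD.
- by rewrite dxD dyD !rmorphD /=; ring.
- by rewrite rmorphM dyM.
- by rewrite dxM dyM !rmorphD !rmorphM /=; ring.
- by rewrite sub_C dyC dxC rmorph0; ring.
- by rewrite sub_X // dxX dyX rmorph0 rmorph1; ring.
- by rewrite sub_Y // dxY dyY rmorph0 rmorph1; ring.
- by apply: dy_mdeg; apply: sub_mdeg.
- by apply: germ_mdegD; apply: germ_mdegMl; apply: sub_mdeg; [apply: dx_mdeg|apply: dy_mdeg].
Qed.

Fact geo_conv : convergent ((fun i j => (j == 0%N)%:R) : ps R).
Proof.
by apply/asboolP/gnat_conv => i j; exists (j == 0%N).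
Qed.
Definition geo : O := mkgerm geo_conv.

Lemma geo_inv : (1 - gX R) * geo = 1.
Proof.
apply: germ_eqP => i j; rewrite mulrBl mul1r gD gN -[gX R]expr1 gXnM g1.
by case: i => [|i]; rewrite ?subr0 //= subrr.
Qed.

(** Convergence of the inverse comes from substitution: a / a(0, 0) = 1 - u with u in the maximal
    ideal, and u is put for x in 1 / (1 - x). *)
Lemma germ_inv a : a~[0, 0] != 0 -> exists b, a * b = 1.
Proof.
move=> a0; pose u := 1 - gC (a~[0, 0])^-1 * a.
have u0 : u~[0, 0] = 0 by rewrite gD gN g1 gCM mulVf // subrr.
exists (gC (a~[0, 0])^-1 * sub u 0 geo).
have := congr1 (sub u 0) geo_inv; rewrite rmorphM rmorphB !rmorph1 /= sub_X // => <-.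
by rewrite mulrCA mulrA; congr (_ * _); rewrite /u; ring.
Qed.

(* Germs in C{x}. *)
Definition xonly a : Prop := forall i j, (0 < j)%N -> a~[i, j] = 0.

Lemma sub_X0 a : sub (gX R) 0 a = r0 a.
Proof.
apply: germ_hom_ext => [b c|b c|c k l|n b nb|n b nb]; first exact: rmorphD.
- by apply: germ_eqP => i j; rewrite gD !r0E; case: ifP; rewrite ?gD ?addr0.
- rewrite /gmon !rmorphM !rmorphXn /= sub_C sub_X ?gXE // sub_Y ?g0 //.
  apply: germ_eqP => i j; rewrite r0E gCM gXnM -/(gmon c k l) gmonE.
  case: l => [|l]; last by rewrite exprS mul0r g0 andbF !if_same mulr0.
  rewrite expr0 g1 subn_eq0; case: j => [|j]; last by rewrite andbF if_same mulr0.
  by rewrite !andbT [i == k]eqn_leq; case: (k <= i)%N; case: (i <= k)%N; rewrite /= ?mulr1 ?mulr0.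
- by apply: sub_mdeg; apply: mdeg_le nb.
- by move=> i j ij; rewrite r0E; case: eqP => // j0; apply: nb; lia.
Qed.

Lemma xonly_r0 a : xonly a -> r0 a = a.
Proof. by move=> xa; apply: germ_eqP => i [|j]; rewrite r0E //= xa. Qed.

Lemma r0_xonly a : xonly (r0 a). Proof. by move=> i [|j]. Qed.

Lemma xonly_rx a b : xonly a -> xonly b -> rx a = rx b -> a = b.
Proof.
move=> xa xb ab; apply: germ_eqP => i [|j]; last by rewrite xa ?xb.
by rewrite -!rxE ab.
Qed.

Lemma sub_xonly P Q a : P~[0, 0] = 0 -> Q~[0, 0] = 0 -> xonly a -> sub P Q a = sub P 0 a.
Proof.
move=> P0 Q0 xa; rewrite -{1}(xonly_r0 xa) -sub_X0 sub_comp ?gXE ?g0 //.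
by rewrite sub_X // rmorph0.
Qed.


End GermOps.

(** * Weierstrass division *)

Section Weierstrass.
Variable R : realType.
Local Notation C := (R[i]).
Local Notation F2 := (fps (fps C)).
Local Notation O := (germ R).
Local Notation normc := (@complex.ComplexField.Normc.normc R).
Local Notation X := (gX R).
Local Notation Y := (gY R).
Implicit Types a b P Q : O.

Lemma shx_mulX a : (forall j, a~[0, j] = 0) -> a = X * shx a.
Proof.
move=> H; apply: germ_eqP => i j; rewrite -[X]expr1 gXnM shxE.
by case: i => [|i] //=; rewrite subn1.
Qed.

Lemma gX1M a i j : (X * a)~[i.+1, j] = a~[i, j].
Proof. by rewrite -[X]expr1 gXnM subn1. Qed.
Lemma gX0M a j : (X * a)~[0, j] = 0.
Proof. by rewrite -[X]expr1 gXnM. Qed.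

Lemma bounded2X r s : 0 <= r -> 0 <= s -> bounded2 r s r (gval X).
Proof.
move=> r0 s0 n n0; have N0 : normc 0 = 0 := seminorm0 (@normc_seminorm R).
have t0 i j : (i, j) <> (1%N, 0%N) -> normc X~[i, j] * s ^+ j * r ^+ i = 0.
  move=> ij; rewrite (_ : X~[i, j] = 0) ?N0 ?mul0r // gXE.
  by case: eqP => // i1; case: eqP => // j0; case: ij; rewrite i1 j0.
rewrite norm2E; case: n n0 => // -[|n] _.
  by rewrite !big_ord1 t0.
rewrite big_ord_recl big1 ?add0r => [|j _]; last by rewrite t0.
rewrite big_ord_recl [X in _ + X]big1 ?addr0 => [|i _]; last first.
  by rewrite big1 // => j _; rewrite t0.
rewrite big_ord_recl [X in _ + X]big1 ?addr0 => [|j _]; last by rewrite t0.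
rewrite (_ : X~[_, _] = 1); last by rewrite gXE.
by rewrite complex.ComplexField.Normc.normc1 !mul1r.
Qed.

Lemma bounded2_shy r s M d a : 0 <= r -> 0 < s ->
  bounded2 r s M (gval a) -> bounded2 r s (M / s ^+ d) (gval (shy d a)).
Proof.
move=> r0 s0 H n n0; rewrite ler_pdivlMr ?exprn_gt0 //.
apply: le_trans (H (n + d)%N _); last by rewrite addn_gt0 n0.
have t0 i j : 0 <= normc a~[i, j] * s ^+ j * r ^+ i.
  by rewrite !mulr_ge0 ?normc_ge0 ?exprn_ge0 // ltW.
rewrite !norm2E mulr_suml [leRHS]big_split_ord /= -[leLHS]addr0 lerD //; last first.
  by apply: sumr_ge0 => i _; apply: sumr_ge0 => j _.
apply: ler_sum => i _; rewrite mulr_suml.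
rewrite -(big_mkord predT (fun j => normc a~[i, j] * s ^+ j * r ^+ i)).
rewrite (big_cat_nat (n := d)) ?leq_addl //= -[leLHS]add0r lerD ?sumr_ge0 //.
rewrite -[X in \sum_(X <= _ < _) _]add0n big_addn addnK big_mkord; apply: ler_sum => j _.
by rewrite shyE exprD le_eqVlt; apply/orP; left; apply/eqP; ring.
Qed.

(* The map q |-> h - x shy d (q w) contracts the weighted l^1 norm with radii (r, s) once r is
   small compared to s^d; its iterates agree with the fixed point up to growing powers of x. *)
Lemma weierstrass_fixpoint d (h w : O) : exists q, q = h - X * shy d (q * w).
Proof.
have [s [Mh [Mw [s0 Hh Hw]]]] := convergent2 (germ_conv h) (germ_conv w).
have s0' := ltW s0; have sd0 : 0 < s ^+ d by rewrite exprn_gt0.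
have Mw0 : 0 <= Mw.
  by apply: le_trans (Hw 1%N isT); apply: seminorm_ge0; apply: norm2_seminorm.
have Mh0 : 0 <= Mh.
  by apply: le_trans (Hh 1%N isT); apply: seminorm_ge0; apply: norm2_seminorm.
pose L := Mw / s ^+ d; have L0 : 0 <= L by rewrite divr_ge0 // ltW.
(* This gives r L <= 1/2, so that the bound 2 Mh on an iterate reproduces itself as Mh + (2 Mh) /
   2. *)
pose r := Num.min s (2 * (L + 1))^-1.
have L1 : 0 < 2 * (L + 1) by rewrite mulr_gt0 // ltr_wpDl.
have r0 : 0 < r by rewrite lt_min s0 invr_gt0.
have r0' := ltW r0; have rs : 0 <= r <= s by rewrite r0' ge_min lexx.
have rL : r * L <= 2^-1.
  apply: (@le_trans _ _ (r * (L + 1))); first by rewrite ler_wpM2l // lerDl.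
  apply: (@le_trans _ _ ((2 * (L + 1))^-1 * (L + 1))).
    by rewrite ler_wpM2r ?ge_min ?lexx ?orbT // addr_ge0.
  by rewrite invfM mulrAC -mulrA mulfV ?mulr1 // lt0r_neq0 // ltr_wpDl.
have ss : 0 <= s <= s by rewrite s0' lexx.
have [T TE] : exists T : O -> O, forall a, T a = h - X * shy d (a * w) by eexists.
have [q [q0 qT]] : exists q : nat -> O, q 0%N = 0 /\ forall n, q n.+1 = T (q n).
  by exists (fun n => iter n T 0).
have qB n : bounded2 r s (2 * Mh) (gval (q n)).
  elim: n => [|n IH].
    by rewrite q0 => m m0; rewrite (seminorm0 (norm2_seminorm r0' s0' m0)) mulr_ge0.
  have B : bounded2 r s (r * (2 * Mh * Mw / s ^+ d)) (gval (X * shy d (q n * w))).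
    apply: (bounded2M r0' s0' (bounded2X r0' s0')); apply: bounded2_shy => //.
    by apply: (bounded2M r0' s0' IH); apply: bounded2_le Hw.
  rewrite qT TE => m m0.
  apply: le_trans (bounded2D r0' s0' (bounded2_le rs ss Hh) (bounded2N r0' s0' B) m0) _.
  rewrite [2 * Mh]mulr_natl mulr2n lerD2l -/(L) -mulrA -[_ / _]/L.
  rewrite (_ : r * _ = 2 * Mh * (r * L)); last by rewrite /L; ring.
  apply: le_trans (ler_wpM2l _ rL) _; first by rewrite mulr_ge0.
  by rewrite mulrAC divff ?mul1r // pnatr_eq0.
have T_x n a b : (forall i j, (i < n)%N -> a~[i, j] = b~[i, j]) ->
    forall i j, (i < n.+1)%N -> (T a)~[i, j] = (T b)~[i, j].
  move=> ab i j ij.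
  have E : (X * shy d (a * w))~[i, j] = (X * shy d (b * w))~[i, j].
    case: i ij => [|i] ij; first by rewrite !gX0M.
    rewrite !gX1M !shyE !gM; apply: eq_bigr => k _; apply: eq_bigr => l _.
    by rewrite ab //; apply: leq_trans (ltn_ord k) _; rewrite -ltnS.
  by rewrite !TE gD gN E -gN -gD.
have qS n m : (n <= m)%N -> forall i j, (i < n)%N -> (q m)~[i, j] = (q n)~[i, j].
  elim: n m => [|n IH] m nm i j ij; first by rewrite ltn0 in ij.
  case: m nm => [|m] nm; first by rewrite ltn0 in nm.
  by rewrite !qT; apply: (T_x n) => // k l; apply: IH.
(* The coefficients of x^i are constant from the iterate i + 1 on; the limit collects these stable
   values and inherits the common bound. *)
have qc : convergent ((fun i j => (q i.+1)~[i, j]) : ps R).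
  apply: (bounded2_convergent r0 s0 (M := 2 * Mh)) => n n0.
  rewrite (@norm2_ext _ _ _ n _ (gval (q n))); first exact: qB.
  by move=> i j ni nj; rewrite (qS i.+1 n).
exists (mkgerm qc); apply: germ_eqP => i j.
transitivity ((T (q i))~[i, j]); first by rewrite -qT.
by rewrite -TE; apply: (T_x i) => // k l ki; apply: (qS k.+1 i).
Qed.

Definition yreg a n : Prop := is_ord (ry a) (Some n).

(** Multiplied by the inverse U of [shy d F], the divisor becomes y^d + x w. That g - q (y^d + x w)
    has y-degree below d is the fixed-point equation q = shy d (g - x q w). *)
Lemma weierstrass_division F d g : yreg F d ->
  exists q r, g = q * F + r /\ forall i j, (d <= j)%N -> r~[i, j] = 0.
Proof.
move=> [Fd Fj]; have V0 : (shy d F)~[0, 0] != 0 by apply/eqP.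
have [U VU] := germ_inv V0.
have ryF : ry F = fpsX ^+ d * ry (shy d F).
  apply: funext => j; rewrite fpsXnM; case: leqP => [dj|/Fj //].
  by rewrite !ryE shyE subnK.
have [w Ew] : exists w, F * U = Y ^+ d + X * w.
  exists (shx (F * U - Y ^+ d)); rewrite -shx_mulX; first by rewrite addrC subrK.
  move=> j; rewrite -ryE rmorphB rmorphM /= ryF -mulrA -rmorphM VU rmorph1 mulr1.
  rewrite fpsD fpsN fpsXn ryE -[Y ^+ d]mulr1 gYnM g1 /=; case: leqP => [dj|jd].
    by rewrite subn_eq0 eqn_leq dj andbT subrr.
  by rewrite (ltn_eqF jd) subrr.
have [q Eq] := weierstrass_fixpoint d (shy d g) w.
have {}Eq : q = shy d (g - X * (q * w)).
  rewrite {1}Eq; apply: germ_eqP => i j; rewrite gD gN !shyE gD gN.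
  by congr (_ - _); case: i => [|i]; rewrite ?gX0M ?gX1M // shyE.
exists (q * U), (g - q * U * F); split=> [|i j dj]; first by rewrite addrC subrK.
have -> : g - q * U * F = (g - X * (q * w)) - Y ^+ d * q.
  by rewrite -mulrA [U * F]mulrC Ew; ring.
by rewrite gD gN gYnM dj {2}Eq shyE subnK // subrr.
Qed.

End Weierstrass.

(** * Puiseux's theorem *)

Section Puiseux.
Variable R : realType.
Local Notation C := (R[i]).
Local Notation O := (germ R).
Local Notation X := (gX R).
Local Notation Y := (gY R).
Implicit Types a b P Q : O.

Lemma xdivP n a : (forall i j, (i < n)%N -> a~[i, j] = 0) ->
  exists b, a = X ^+ n * b /\ forall i j, b~[i, j] = a~[i + n, j].
Proof.
move=> H; exists (mkgerm (px_conv n a (ltn0Sn 0))); split=> [|i j]; last first.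
  by rewrite -[in RHS](mul1n i).
apply: germ_eqP => i j; rewrite gXnM; case: leqP => [ni|/H //].
by rewrite -[in LHS](subnK ni) -[in LHS](mul1n (i - n)%N).
Qed.

Lemma germ_unit_cancel a b : a~[0, 0] != 0 -> a * b = 0 -> b = 0.
Proof.
by move=> /germ_inv[u au] ab; rewrite -[b]mul1r -au mulrAC ab mul0r.
Qed.

Lemma gXn00 n : (0 < n)%N -> (X ^+ n)~[0, 0] = 0.
Proof. by move=> n0; rewrite -[X ^+ n]mulr1 gXnM leqNgt n0. Qed.

Lemma gX00 : X~[0, 0] = 0. Proof. by rewrite gXE. Qed.
Lemma gY00 : Y~[0, 0] = 0. Proof. by rewrite gYE. Qed.
Lemma gD00 a b : a~[0, 0] = 0 -> b~[0, 0] = 0 -> (a + b)~[0, 0] = 0.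
Proof. by move=> a0 b0; rewrite gD a0 b0 addr0. Qed.
Lemma gM00l a b : a~[0, 0] = 0 -> (a * b)~[0, 0] = 0.
Proof. by move=> a0; rewrite gM00 a0 mul0r. Qed.
Lemma xonlyP a : xonly a <-> sub X 0 a = a.
Proof.
by rewrite sub_X0; split=> [/xonly_r0 //|<-]; apply: r0_xonly.
Qed.
Lemma xonlyD a b : xonly a -> xonly b -> xonly (a + b).
Proof. by move=> /xonlyP xa /xonlyP xb; apply/xonlyP; rewrite rmorphD /= xa xb. Qed.
Lemma xonlyM a b : xonly a -> xonly b -> xonly (a * b).
Proof. by move=> /xonlyP xa /xonlyP xb; apply/xonlyP; rewrite rmorphM /= xa xb. Qed.
Lemma xonlyXn n : xonly (X ^+ n).
Proof. by apply/xonlyP; rewrite rmorphXn /= sub_X ?gX00. Qed.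
Lemma xonlyC (c : C) : xonly (gC c).
Proof. by apply/xonlyP; rewrite sub_C. Qed.
Lemma xonly_sub P Q a : P~[0, 0] = 0 -> Q~[0, 0] = 0 -> xonly P -> xonly a -> xonly (sub P Q a).
Proof.
move=> P0 Q0 /xonlyP xP xa; rewrite sub_xonly //; apply/xonlyP.
by rewrite sub_comp ?gX00 ?g0 // xP rmorph0.
Qed.
Lemma sub_xonly_id Q a : Q~[0, 0] = 0 -> xonly a -> sub X Q a = a.
Proof. by move=> Q0 xa; rewrite sub_xonly ?gX00 //; apply/xonlyP. Qed.

Lemma ry_sub0 a : ry (sub 0 Y a) = ry a.
Proof.
apply: funext => j; rewrite !ryE (@sub_coef _ _ _ _ j.+1) ?g0 ?gY00 //.
rewrite big_ord_recl [X in _ + X]big1 ?addr0 => [|k _]; last first.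
  by rewrite big1 // => l _; rewrite expr0n /= mul0r g0 mulr0.
rewrite big_ord_recr big1 /= ?add0r => [|l _].
  by rewrite expr0 mul1r -[Y ^+ j]mulr1 gYnM leqnn subnn g1 mulr1.
rewrite expr0 mul1r -[Y ^+ l]mulr1 gYnM g1 /= subn_eq0.
by have lj := ltn_ord l; rewrite (ltnW lj) leqNgt lj mulr0.
Qed.

Lemma ry_sub P Q a : P~[0, 0] = 0 -> Q~[0, 0] = 0 ->
  ry (sub P Q a) = ry (sub (sub 0 Y P) (sub 0 Y Q) a).
Proof. by move=> P0 Q0; rewrite -ry_sub0 sub_comp ?g0 ?gY00. Qed.

Lemma sub0_xonly a : a~[0, 0] = 0 -> xonly a -> sub 0 Y a = 0.
Proof.
move=> a0 xa; rewrite sub_xonly ?g0 ?gY00 // -[a]xonly_r0 // -sub_X0 sub_comp ?gX00 ?g0 //.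
rewrite sub_X ?g0 // rmorph0; apply: germ_eqP => i j.
rewrite (@sub_coef _ _ _ _ (i + j).+1) ?g0 //; apply: big1 => k _; apply: big1 => l _.
case: k l => [[|k] hk] [[|l] hl]; rewrite /= ?a0 ?mul0r //.
- by rewrite [0 ^+ l.+1]expr0n mulr0 g0 mulr0.
- by rewrite [0 ^+ k.+1]expr0n mul0r g0 mulr0.
- by rewrite [0 ^+ k.+1]expr0n mul0r g0 mulr0.
Qed.

(** The implicit function theorem by division: write y = q Q + r with r in C{x} and put y := r,
    which leaves q(x, r) Q(x, r) = 0. Comparing the coefficients of y shows that q is a unit. *)
Lemma root_regular1 Q : yreg Q 1 ->
  exists Z, [/\ xonly Z, Z~[0, 0] = 0 & sub X Z Q = 0].
Proof.
move=> rQ; have [Q1 Q0] := rQ; have {}Q0 : Q~[0, 0] = 0 by apply: Q0.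
have [q [r [E xr]]] := weierstrass_division Y rQ.
have r00 : r~[0, 0] = 0.
  by have := congr1 (fun a => a~[0, 0]) E; rewrite gD gM00 Q0 mulr0 add0r gY00.
have q00 : q~[0, 0] != 0.
  apply/eqP => q0; have := congr1 (fun a => a~[0, 1]) E.
  rewrite gD xr // addr0 gM big_ord1 !big_ord_recl big_ord0 q0 Q0.
  by rewrite mul0r mulr0 !addr0 gYE => /eqP; rewrite oner_eq0.
exists r; split=> //; have := congr1 (sub X r) E.
rewrite rmorphD rmorphM /= sub_Y // (sub_xonly_id r00 xr) => /eqP.
rewrite -subr_eq subrr eq_sym => /eqP.
by apply: germ_unit_cancel; rewrite sub_00 ?gX00.
Qed.

Lemma iter_dyE k a i j : (iter k (@dy R) a)~[i, j] = ((j + k) ^_ k)%N%:R * a~[i, j + k].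
Proof.
elim: k j => [|k IH] j; first by rewrite ffactn0 mul1r addn0.
by rewrite iterS dyE IH mulrA -natrM addSnnS ffactnSr addnS -addSn addnK mulnC.
Qed.

Lemma iter_dy_translate k a Z : xonly Z -> Z~[0, 0] = 0 ->
  iter k (@dy R) (sub X (Y + Z) a) = sub X (Y + Z) (iter k (@dy R) a).
Proof.
move=> xZ Z0; elim: k => // k IH; rewrite !iterS IH dy_sub ?gX00 ?gD00 ?gY00 //.
rewrite dyX mulr0 add0r dyD dyY (_ : dy Z = 0) ?addr0 ?mulr1 //.
by apply: germ_eqP => i j; rewrite dyE xZ ?mulr0.
Qed.

(* Translating by the root of the (n-1)-st derivative kills the coefficient of y^(n-1). *)
Lemma tschirnhaus Q n : (0 < n)%N -> yreg Q n ->
  exists Z, [/\ xonly Z, Z~[0, 0] = 0, yreg (sub X (Y + Z) Q) n &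
    forall i, (sub X (Y + Z) Q)~[i, n.-1] = 0].
Proof.
case: n => // n _ rQ.
have ff k : ((k + n) ^_ n)%N%:R != 0 :> C.
  by rewrite pnatr_eq0 -lt0n ffact_gt0 leq_addl.
have rD : yreg (iter n (@dy R) Q) 1.
  have [Qn Qj] := rQ; split=> [|[|//] _]; rewrite ryE iter_dyE.
    by apply/eqP; rewrite mulf_neq0 ?ff //; apply/eqP.
  by rewrite add0n -ryE Qj ?mulr0.
have [Z [xZ Z0 EZ]] := root_regular1 rD; exists Z; split=> //.
  rewrite /yreg ry_sub ?gX00 ?gD00 ?gY00 // sub_X ?g0 // rmorphD /= sub_Y ?gY00 //.
  by rewrite sub0_xonly // addr0 ry_sub0.
move=> i; have := congr1 (fun a => a~[i, 0]) EZ.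
have -> : sub X Z (iter n (@dy R) Q) = sub X 0 (sub X (Y + Z) (iter n (@dy R) Q)).
  rewrite sub_comp ?gX00 ?g0 ?gD00 ?gY00 // sub_X ?gX00 // rmorphD /= sub_Y ?g0 //.
  by rewrite add0r (@sub_xonly_id 0 Z) ?g0.
rewrite -iter_dy_translate // sub_X0 r0E /= iter_dyE add0n => /eqP.
by rewrite mulf_eq0 (negPf (ff 0%N)) => /eqP.
Qed.

End Puiseux.

(** * Newton's algorithm *)

Section Newton.
Variable R : realType.
Local Notation C := (R[i]).
Local Notation O := (germ R).
Local Notation X := (gX R).
Local Notation Y := (gY R).
Implicit Types a b P Q : O.

Lemma zetaY_coef (zeta : C) l j : ((gC zeta + Y) ^+ l)~[0, j] = (('X + zeta%:P) ^+ l)`_j.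
Proof.
suff H (p q : O) (u v : {poly C}) : (forall j, p~[0, j] = u`_j) -> (forall j, q~[0, j] = v`_j) ->
    forall j, (p * q)~[0, j] = (u * v)`_j.
  elim: l j => [|l IH] j; first by rewrite !expr0 g1 coef1.
  rewrite !exprS; apply: H => // k; rewrite gD gCE gYE coefD coefX coefC addrC /=.
  by case: k.
move=> pu qv k; rewrite gM big_ord1 coefM; apply: eq_bigr => m _.
by rewrite pu qv.
Qed.

(** The monomial x^k y^l becomes x^(q k + p l) (zeta + y)^l. Only the monomials on the edge q k + p
    l = p n reach x^(p n), and they assemble the residual polynomial, translated by zeta. *)
Lemma newton_coef Q p q n (zeta : C) i j : (0 < p)%N -> (0 < q)%N ->
  (forall k l, Q~[k, l] <> 0 -> (p * n <= q * k + p * l)%N) -> (i <= p * n)%N ->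
  (sub (X ^+ q) (X ^+ p * (gC zeta + Y)) Q)~[i, j] =
    if i == (p * n)%N then
      (\sum_(l < n.+1) (\sum_(k < (p * n).+1 | (q * k + p * l == p * n)%N) Q~[k, l])
         *: ('X + zeta%:P) ^+ l)`_j
    else 0.
Proof.
move=> p0 q0 HQ ipn; set m := (p * n + n + i + j).+1.
rewrite (@sub_coef _ _ _ _ m) ?gXn00 ?gM00l ?gXn00 //; last by rewrite /m; lia.
pose c k l := Q~[k, l] * (if (q * k + p * l == i)%N then (('X + zeta%:P) ^+ l)`_j else 0).
rewrite (eq_bigr (fun k : 'I_m => \sum_(l < m) c k l)); last first.
  move=> k _; apply: eq_bigr => l _; rewrite exprMn mulrA -!exprM -exprD gXnM /c.
  have [->|/eqP Q0] := eqVneq Q~[k, l] 0; first by rewrite !mul0r.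
  have := HQ _ _ Q0 => le; congr (_ * _); case: leqP => h.
    have e : (q * k + p * l)%N = i by lia.
    by rewrite e eqxx subnn zetaY_coef.
  by rewrite (gtn_eqF h).
have [ei|ni] := eqVneq i (p * n)%N; last first.
  apply: big1 => k _; apply: big1 => l _; rewrite /c; case: eqP => [e|]; rewrite ?mulr0 //.
  have [->|/eqP /HQ] := eqVneq Q~[k, l] 0; first by rewrite mul0r.
  by rewrite e; lia.
rewrite exchange_big /= coef_sum.
have c0 k l : (p * n < k)%N || (n < l)%N -> c k l = 0.
  move=> h; rewrite /c; case: eqP; rewrite ?mulr0 // => e.
  by exfalso; rewrite ei in e; case/orP: h => h; nia.
have wide K m1 m2 : (m1 <= m2)%N -> (forall k, (m1 <= k)%N -> K k = 0) ->
    \sum_(k < m2) K k = \sum_(k < m1) K k :> C.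
  move=> mm K0; rewrite -!(big_mkord predT K) (big_cat_nat (n := m1)) //=.
  by rewrite [X in _ + X]big_nat_cond [X in _ + X]big1 ?addr0 // => k /andP[/andP[/K0]].
rewrite (wide (fun l => \sum_(k < m) c k l) n.+1); first last.
- by move=> l nl; apply: big1 => k _; apply: c0; rewrite nl orbT.
- by rewrite /m; lia.
apply: eq_bigr => l _; rewrite (wide (fun k => c k l) (p * n).+1); first last.
- by move=> k nk; apply: c0; rewrite nk.
- by rewrite /m; lia.
rewrite coefZ mulr_suml [RHS]big_mkcond /=; apply: eq_bigr => k _.
by rewrite /c ei; case: ifP; rewrite ?mulr0.
Qed.

(** If a root zeta had multiplicity n, G would be a constant times (T - zeta)^n. Its coefficient of
    degree n - 1 vanishes only for zeta = 0, which leaves a monomial and contradicts the last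
    hypothesis. *)
Lemma poly_translate_order (G : {poly C}) n : (0 < n)%N -> size G = n.+1 -> G`_n.-1 = 0 ->
  (exists2 l, (l < n)%N & G`_l != 0) ->
  exists zeta m, [/\ (0 < m < n)%N, (G \Po ('X + zeta%:P))`_m != 0 &
                     forall j, (j < m)%N -> (G \Po ('X + zeta%:P))`_j = 0].
Proof.
move=> n0 sG Gn1 [l ln Gl].
have [zeta rz] : exists zeta, root G zeta.
  by apply/closed_rootP; rewrite sG eqSS -lt0n.
set H := G \Po ('X + zeta%:P); exists zeta.
have GH : G = H \Po ('X - zeta%:P).
  rewrite /H -comp_polyA comp_polyD comp_polyX comp_polyC subrK comp_polyXr //.
have H0 : H`_0 = 0.
  rewrite -horner_coef0 horner_comp hornerD hornerX hornerC add0r.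
  by apply/eqP.
have sH : size H = n.+1.
  by rewrite size_comp_poly2 ?sG // size_XaddC.
have [[j /andP[jn Hj]]|none] := pselect (exists j, (j < n)%N && (H`_j != 0)).
  have ex : exists j, H`_j != 0 by exists j.
  exists (ex_minn ex); case: ex_minnP => m Hm min; split=> //.
    rewrite (leq_ltn_trans (min _ Hj)) // andbT lt0n.
    by apply: contraNneq Hm => ->; rewrite H0.
  by move=> k km; apply/eqP; apply: contraLR km => /min; rewrite -leqNgt.
have Hj j : (j < n)%N -> H`_j = 0.
  by move=> jn; apply/eqP/negP => h; apply: none; exists j; rewrite jn; apply/negP.
have HE : H = H`_n *: 'X^n.
  apply/polyP => j; rewrite coefZ coefXn; have [/Hj ->|nj|->] := ltngtP j n.
  - by rewrite mulr0.
  - by rewrite mulr0 nth_default // sH.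
  - by rewrite mulr1.
have Hn : H`_n != 0 by rewrite -[n]/(n.+1.-1) -sH -lead_coefE lead_coef_eq0 -size_poly_eq0 sH.
have GE : G = H`_n *: ('X - zeta%:P) ^+ n.
  by rewrite GH {1}HE comp_polyZ comp_Xn_poly.
have z0 : zeta = 0.
  move/eqP: Gn1; rewrite GE coefZ mulf_eq0 (negPf Hn) /=.
  have -> : (('X - zeta%:P) ^+ n)`_n.-1 = - (zeta *+ n).
    rewrite exprDn coef_sum; case: (n) n0 => // n' _ /=.
    rewrite big_ord_recl big_ord_recl big1 => [|k _]; last first.
      rewrite /= -polyCN -polyC_exp -mulr_natr -polyC_natr -mulrA -polyCM coefMC coefXn.
      by rewrite /bump /= gtn_eqF ?mul0r //; have := ltn_ord k; lia.
    rewrite subn0 expr0 mulr1 bin0 mulr1n coefXn ltn_eqF // add0r addr0.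
    rewrite subSS subn0 expr1 bin1 coefMn -polyCN coefMC coefXn eqxx mul1r.
    by rewrite mulNrn.
  by rewrite oppr_eq0 mulrn_eq0 eqn0Ngt n0 => /eqP.
move: Gl; rewrite GE z0 subr0 coefZ coefXn (ltn_eqF ln) mulr0 eqxx //.
Qed.

(* Newton polygon: p / q is the least value of k / (n - l) over the monomials x^k y^l of Q with
   l < n, found by minimising the integer k (n! / (n - l)). As the coefficient of y^(n-1) is 0,
   no root zeta of the residual polynomial has multiplicity n. *)
Lemma newton_step Q n : (0 < n)%N -> yreg Q n -> (forall i, Q~[i, n.-1] = 0) ->
  (exists k l, (l < n)%N /\ Q~[k, l] <> 0) ->
  exists p q zeta G m, [/\ (0 < p)%N, (0 < q)%N, (0 < m < n)%N, yreg G m &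
    sub (X ^+ q) (X ^+ p * (gC zeta + Y)) Q = X ^+ (p * n) * G].
Proof.
move=> n0 [Qn Qj] Qn1 [k1 [l1 [ln1 Q1]]].
pose w l := (n`! %/ (n - l))%N.
have wE l : (l < n)%N -> (w l * (n - l) = n`!)%N.
  by move=> ln; apply: divnK; apply: dvdn_fact; lia.
pose good v := `[< exists k l, [/\ (l < n)%N, Q~[k, l] <> 0 & v = (k * w l)%N] >].
have ex : exists v, good v by exists (k1 * w l1)%N; apply/asboolP; exists k1, l1.
case: (ex_minnP ex) => v /asboolP[p [l0 [ln0 Q0 ->]]] min.
pose q := (n - l0)%N; have q0 : (0 < q)%N by rewrite subn_gt0.
have p0 : (0 < p)%N.
  by case: p Q0 {min} => // Q0; case: Q0; rewrite -ryE; apply: Qj.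
have HQ k l : Q~[k, l] <> 0 -> (p * n <= q * k + p * l)%N.
  move=> Qkl; have [nl|ln] := leqP n l; first by nia.
  have /min le : good (k * w l)%N by apply/asboolP; exists k, l.
  have wq := wE _ ln0; have wl := wE _ ln; rewrite -/q in wq.
  have f0 : (0 < n`!)%N by apply: fact_gt0.
  suff : (p * (n - l) <= q * k)%N by rewrite mulnBr; lia.
  rewrite -(leq_pmul2r f0) -{1}wq -wl.
  rewrite (_ : p * (n - l) * (w l0 * q) = (p * w l0) * ((n - l) * q))%N; last by ring.
  rewrite (_ : q * k * (w l * (n - l)) = (k * w l) * ((n - l) * q))%N; last by ring.
  by rewrite leq_mul2r le orbT.
pose G0 := \poly_(l < n.+1) \sum_(k < (p * n).+1 | (q * k + p * l == p * n)%N) Q~[k, l].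
have G0n : G0`_n = Q~[0, n].
  rewrite coef_poly ltnSn (bigD1 ord0) /= ?muln0 ?eqxx // big1 ?addr0 // => k.
  by rewrite -val_eqE /= => /andP[/eqP e k0]; exfalso; move/eqP: k0; apply; nia.
have G0s : size G0 = n.+1.
  by apply: size_poly_eq; move: G0n; rewrite coef_poly ltnSn => ->; apply/eqP.
have G0n1 : G0`_n.-1 = 0.
  by rewrite coef_poly; case: ifP => // _; apply: big1.
have [] := @poly_translate_order G0 n n0 G0s G0n1.
  exists l0 => //; rewrite coef_poly ltnW ?ltnS //.
  have pn : (p < (p * n).+1)%N by rewrite ltnS leq_pmulr.
  rewrite (bigD1 (Ordinal pn)) /=; last by rewrite /q mulnC -mulnDr subnK // ltnW.
  rewrite big1 ?addr0 => [|k]; first exact/eqP.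
  rewrite -val_eqE /= => /andP[/eqP e kp]; exfalso; move/eqP: kp; apply.
  have : (q * k + p * l0 = q * p + p * l0)%N by rewrite e /q [(_ * p)%N]mulnC -mulnDr subnK // ltnW.
  by move/addIn/eqP; rewrite eqn_pmul2l // => /eqP.
move=> zeta [m [mn Hm Hj]].
have G0E : \sum_(l < n.+1) (\sum_(k < (p * n).+1 | (q * k + p * l == p * n)%N) Q~[k, l])
         *: ('X + zeta%:P) ^+ l = G0 \Po ('X + zeta%:P).
  rewrite comp_polyE G0s; apply: eq_bigr => l _.
  by rewrite coef_poly ltn_ord.
have NC := newton_coef zeta _ p0 q0 HQ.
have [i j ij|G [EG cG]] := @xdivP _ (p * n)%N (sub (X ^+ q) (X ^+ p * (gC zeta + Y)) Q).
  by rewrite NC ?ltn_eqF // ltnW.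
exists p, q, zeta, G, m; split=> //.
have ryG j : ry G j = (G0 \Po ('X + zeta%:P))`_j.
  by rewrite ryE cG add0n NC // eqxx G0E.
by split=> [|j jm]; rewrite ryG; [apply/eqP|apply: Hj].
Qed.

(** Induction on the order in y: after the Tschirnhaus translation, a Newton step replaces n by the
    multiplicity m < n of a root of the residual polynomial. *)
Lemma puiseux_root Q n : (0 < n)%N -> yreg Q n ->
  exists N Z, [/\ (0 < N)%N, xonly Z, Z~[0, 0] = 0 & sub (X ^+ N) Z Q = 0].
Proof.
elim/ltn_ind: n Q => n IH Q n0 rQ.
have [T [xT T0 rQ1 Q1n]] := tschirnhaus n0 rQ.
set Q1 := sub X (Y + T) Q in rQ1 Q1n.
suff [N [Z [N0 xZ Z0 E]]] : exists N Z, [/\ (0 < N)%N, xonly Z, Z~[0, 0] = 0 &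
    sub (X ^+ N) Z Q1 = 0].
  exists N, (Z + sub (X ^+ N) Z T); split=> //.
  - by apply: xonlyD => //; apply: xonly_sub => //; [apply: gXn00|apply: xonlyXn].
  - by rewrite gD00 ?sub_00 ?gXn00.
  move: E; rewrite /Q1 sub_comp ?gXn00 ?gX00 ?gD00 ?gY00 //.
  by rewrite sub_X ?gXn00 // rmorphD /= sub_Y.
have [ex|none] := pselect (exists k l, (l < n)%N /\ Q1~[k, l] <> 0); last first.
  (* Here y^n divides [Q1], so y = 0 is a root. *)
  exists 1%N, 0; split=> //; rewrite expr1 sub_X0; apply: germ_eqP => i j.
  rewrite r0E g0; case: eqP => // _; apply/eqP/negP => /negP h.
  by apply: none; exists i, 0%N; split=> //; apply/eqP.
have [p [q [zeta [G [m [p0 q0 /andP[m0 mn] rG E]]]]]] := newton_step n0 rQ1 Q1n ex.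
have [M [Z [M0 xZ Z0 EZ]]] := IH m mn G m0 rG.
have XM0 := @gXn00 R M M0.
(* The root x = t^M, y = Z of G is inserted into the substitution x^q, x^p (zeta + y) of the Newton
   step. *)
exists (M * q)%N, (X ^+ (M * p) * (gC zeta + Z)); split.
- by rewrite muln_gt0 M0.
- by apply: xonlyM; [apply: xonlyXn|apply: xonlyD => //; apply: xonlyC].
- by rewrite gM00l ?gXn00 ?muln_gt0 ?M0.
have := congr1 (sub (X ^+ M) Z) E; rewrite [in RHS]rmorphM /= EZ mulr0.
rewrite sub_comp ?gM00l ?gXn00 // rmorphM rmorphD !rmorphXn /= sub_X // sub_Y // sub_C.
by rewrite !exprM.
Qed.

End Newton.

(** * Codimension of subspaces *)

Section Codim.
Variable R : realType.
Local Notation C := (R[i]).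
Local Notation O := (germ R).
Implicit Types (a b : O) (I J : O -> Prop) (s t : seq O) (c : nat -> C).

Definition lc c s : O := \sum_(k < size s) gC (c k) * s`_k.

Definition subspace I : Prop :=
  [/\ I 0, forall a b, I a -> I b -> I (a + b) & forall z a, I a -> I (gC z * a)].

Definition indep I s : Prop := forall c, I (lc c s) -> forall k, (k < size s)%N -> c k = 0.

Definition spans I s : Prop := forall a, exists c, I (a - lc c s).

(** Codimension is set up for arbitrary C-subspaces, since the filtration in [inter_power_sub]
    consists of subspaces that are in general not ideals. *)
Definition edimR I (d : option nat) : Prop :=
  match d with
  | Some n => (exists s, indep I s /\ size s = n) /\ forall s, indep I s -> (size s <= n)%N
  | None => forall n, exists s, indep I s /\ size s = n
  end.

Definition edim I : option nat := xget None (edimR I).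

Lemma subspace_sum I n (F : 'I_n -> O) : subspace I -> (forall k, I (F k)) -> I (\sum_k F k).
Proof. by move=> [I0 ID _] IF; elim/big_ind: _. Qed.

Lemma lc_cat c s t : lc c (s ++ t) = lc c s + lc (fun k => c (size s + k)%N) t.
Proof.
rewrite /lc size_cat big_split_ord /=; congr (_ + _); apply: eq_bigr => k _.
  by rewrite nth_cat ltn_ord.
by rewrite nth_cat ltnNge leq_addr /= addKn.
Qed.

Lemma lc_eq c c' s : (forall k, (k < size s)%N -> c k = c' k) -> lc c s = lc c' s.
Proof. by move=> cc; apply: eq_bigr => k _; rewrite cc. Qed.

Lemma lc_0 c s : (forall k, (k < size s)%N -> c k = 0) -> lc c s = 0.
Proof. by move=> c0; rewrite /lc big1 // => k _; rewrite c0 // rmorph0 mul0r. Qed.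

Lemma lc_map (m : O -> O) c s :
  (forall a b, m (a + b) = m a + m b) -> (forall z a, m (gC z * a) = gC z * m a) ->
  m (lc c s) = lc c (map m s).
Proof.
move=> mD mZ; have m0 : m 0 = 0 by have := mZ 0 0; rewrite rmorph0 !mul0r.
rewrite /lc (big_morph m mD m0) size_map; apply: eq_bigr => k _.
by rewrite mZ (nth_map 0).
Qed.

Lemma indep_take I s n : indep I s -> (n <= size s)%N -> indep I (take n s).
Proof.
move=> si ns c Ic k; rewrite size_takel // => kn.
pose c' k := if (k < n)%N then c k else 0.
have -> : c k = c' k by rewrite /c' kn.
apply: si; last exact: leq_trans ns.
rewrite -[s](cat_take_drop n) lc_cat [X in _ + X]lc_0 ?addr0 => [|j _]; last first.
  by rewrite /c' size_takel // ltnNge leq_addr.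
rewrite (_ : lc c' _ = lc c (take n s)) //; apply: lc_eq => j.
by rewrite size_takel // /c' => ->.
Qed.

(** If t were longer than s, the matrix expressing t through s modulo I would have a nonzero left
    kernel vector, which is a relation among the members of t. *)
Lemma indep_spans_size I s t : subspace I -> spans I s -> indep I t -> (size t <= size s)%N.
Proof.
move=> sI sp ind; rewrite leqNgt; apply/negP => lt.
have [f fP] : exists f : nat -> nat -> C, forall k, I (t`_k - lc (f k) s).
  by have [f fP] := choice (fun k => sp t`_k); exists f.
pose M : 'M[C]_(size t, size s) := \matrix_(k, j) f k j.
have /rowV0Pn[v /sub_kermxP vM v0] : kermx M != 0.
  rewrite kermx_eq0 /row_free neq_ltn; apply/orP; left.
  exact: leq_ltn_trans (rank_leq_col M) lt.
pose c k := if insub k is Some i then v 0 i else 0.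
have cE (i : 'I_(size t)) : c i = v 0 i by rewrite /c valK.
have Ic : I (lc c t).
  have -> : lc c t = \sum_(k < size t) gC (c k) * (t`_k - lc (f k) s).
    rewrite (eq_bigr (fun k : 'I_(size t) => gC (c k) * t`_k - gC (c k) * lc (f k) s)).
      rewrite sumrB -[LHS]subr0; congr (_ - _).
      rewrite (eq_bigr (fun k : 'I_(size t) => \sum_(j < size s) gC (c k * f k j) * s`_j)).
        rewrite exchange_big /= big1 // => j _; rewrite -mulr_suml -rmorph_sum /=.
        have : (v *m M) 0 j = 0 by rewrite vM mxE.
        rewrite mxE => E; rewrite (_ : \sum_(k < _) _ = 0) ?rmorph0 ?mul0r // -[RHS]E.
        by apply: eq_bigr => k _; rewrite mxE cE.
      by move=> k _; rewrite mulr_sumr; apply: eq_bigr => j _; rewrite rmorphM mulrA.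
    by move=> k _; rewrite mulrBr.
  have [_ _ IZ] := sI.
  by apply: subspace_sum => // k; apply: IZ.
move/eqP: v0; apply; apply/rowP => i; rewrite mxE -cE.
exact: (ind _ Ic i (ltn_ord i)).
Qed.

Lemma maximal_spans I s : subspace I -> indep I s ->
  (forall t, indep I t -> (size t <= size s)%N) -> spans I s.
Proof.
move=> sI ind mx a; apply: contrapT => none.
suff /mx : indep I (a :: s) by rewrite /= ltnn.
move=> c; rewrite -cat1s lc_cat /= {1}/lc big_ord1 /= => Ic.
have c0 : c 0%N = 0.
  apply/eqP; apply: contraT => c0; exfalso; apply: none.
  exists (fun k => - (c 0%N)^-1 * c (1 + k)%N); have [_ _ IZ] := sI.
  have := IZ (c 0%N)^-1 _ Ic; rewrite mulrDr mulrA -rmorphM mulVf // rmorph1 mul1r.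
  congr (I (_ + _)); rewrite /lc mulr_sumr -sumrN; apply: eq_bigr => k _.
  by rewrite mulrA -rmorphM mulNr rmorphN mulNr opprK.
move: Ic; rewrite c0 rmorph0 mul0r add0r => /ind H [|k] //= ks.
exact: H.
Qed.

Lemma edimR_basis I s n : subspace I -> indep I s -> spans I s -> size s = n -> edimR I (Some n).
Proof.
move=> sI ind sp <-; split=> [|t]; first by exists s.
exact: indep_spans_size.
Qed.

Lemma basis_edimR I n : subspace I -> edimR I (Some n) ->
  exists s, [/\ indep I s, spans I s & size s = n].
Proof.
move=> sI [[s [ind sn]] mx]; exists s; split=> //.
by apply: maximal_spans => // t; rewrite sn; apply: mx.
Qed.

Lemma edimR_ex I : exists d, edimR I d.
Proof.
have [all|/existsNP[n nn]] := pselect (forall n, exists s, indep I s /\ size s = n).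
  by exists None.
have ex : exists n, `[< ~ exists s, indep I s /\ size s = n >] by exists n; apply/asboolP.
case: (ex_minnP ex) => -[|m] /asboolP nm min; first by case: nm; exists [::].
have [s [ind sm]] : exists s, indep I s /\ size s = m.
  apply: contrapT => h; have /min : `[< ~ exists s, indep I s /\ size s = m >] by apply/asboolP.
  by rewrite ltnn.
exists (Some m); split=> [|t it]; first by exists s.
rewrite leqNgt; apply/negP => mt; apply: nm; exists (take m.+1 t); split.
  exact: indep_take.
by rewrite size_takel.
Qed.

Lemma edimR_uniq I d e : edimR I d -> edimR I e -> d = e.
Proof.
case: d e => [m|] [n|] //=.
- move=> [[s [si sm]] mx] [[t [ti tn]] nx]; congr Some; apply/eqP; rewrite eqn_leq.
  by rewrite -{1}sm -{2}tn nx ?mx.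
- by move=> [_ mx] /(_ m.+1)[t [ti tm]]; have := mx t ti; rewrite tm ltnn.
- by move=> /(_ n.+1)[t [ti tm]] [_ mx]; have := mx t ti; rewrite tm ltnn.
Qed.

Lemma edimP I : edimR I (edim I).
Proof. by have [d dP] := edimR_ex I; apply: (xgetI _ dP). Qed.

Lemma edim_eq I d : edimR I d -> edim I = d.
Proof. exact/edimR_uniq/edimP. Qed.

Lemma edim_ext I J : (forall a, I a <-> J a) -> edim I = edim J.
Proof. by move=> IJ; congr edim; apply: funext => a; apply: propext. Qed.

(* Exactness of 0 -> O / m^-1(I) -> O / I -> O / (I + m(O)) -> 0. *)
Lemma edim_exact I (m : O -> O) : subspace I ->
  (forall a b, m (a + b) = m a + m b) -> (forall z a, m (gC z * a) = gC z * m a) ->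
  edim I = eadd (edim (fun a => I (m a))) (edim (fun a => exists i u, I i /\ a = i + m u)).
Proof.
move=> sI mD mZ; have [I0 ID IZ] := sI.
have mB a b : m (a - b) = m a - m b.
  by rewrite mD -mulN1r -(rmorph1 (@gC R)) -rmorphN mZ rmorphN rmorph1 mulN1r.
have m0 : m 0 = 0 by have := mB 0 0; rewrite !subrr.
set J1 := fun a => I (m a); set J2 := fun a => exists i u, I i /\ a = i + m u.
have sJ1 : subspace J1.
  by split=> [|a b|z a]; rewrite /J1 ?m0 ?mD ?mZ //; [apply: ID|apply: IZ].
have sJ2 : subspace J2.
  split; first by exists 0, 0; split=> //; rewrite m0 addr0.
    move=> _ _ [i [u [Ii ->]]] [j [v [Ij ->]]]; exists (i + j), (u + v).
    by split; [apply: ID|rewrite mD addrACA].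
  move=> z _ [i [u [Ii ->]]]; exists (gC z * i), (gC z * u).
  by split; [apply: IZ|rewrite mZ mulrDr].
have IJ2 a : I a -> J2 a by exists a, 0; split=> //; rewrite m0 addr0.
have ind1 s : indep J1 s -> indep I (map m s).
  move=> ind c Ic k; rewrite size_map; apply: ind.
  by rewrite /J1 lc_map.
have ind2 s : indep J2 s -> indep I s.
  by move=> ind c Ic k ks; apply: ind ks; apply: IJ2.
apply: edim_eq; case: (edim J1) (edimP J1) => [n1|] d1; last first.
  by move=> n; have [s [/ind1 si sn]] := d1 n; exists (map m s); rewrite size_map.
case: (edim J2) (edimP J2) => [n2|] d2; last first.
  by move=> n; have [s [/ind2 si sn]] := d2 n; exists s.
have [s1 [i1 p1 z1]] := basis_edimR sJ1 d1; have [s2 [i2 p2 z2]] := basis_edimR sJ2 d2.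
apply: (@edimR_basis _ (map m s1 ++ s2)) => //; last by rewrite size_cat size_map z1 z2.
- move=> c; rewrite lc_cat -lc_map // size_map => Ic.
  have c2 k : (k < size s2)%N -> c (size s1 + k)%N = 0.
    move=> ks; apply: (i2 (fun k => c (size s1 + k)%N)) ks.
    exists (m (lc c s1) + lc (fun k => c (size s1 + k)%N) s2), (- lc c s1); split=> //.
    by rewrite -[- lc c s1]sub0r mB m0 sub0r addrAC subrr add0r.
  rewrite [X in _ + X]lc_0 ?addr0 // in Ic; have c1 := i1 c Ic.
  move=> k; rewrite size_cat size_map => ks.
  have [/c1 //|ks1] := ltnP k (size s1).
  by rewrite -(subnKC ks1) c2 //; lia.
- move=> a; have [c2 [i [u [Ii E]]]] := p2 a; have [c1 E1] := p1 u.
  exists (fun k => if (k < size s1)%N then c1 k else c2 (k - size s1)%N).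
  rewrite lc_cat (@lc_eq _ c1) => [|k]; last by rewrite size_map => ->.
  rewrite (@lc_eq _ c2 s2) => [|k _]; last by rewrite size_map ltnNge leq_addr addKn.
  rewrite -lc_map // (_ : a - _ = i + (m u - m (lc c1 s1))).
    by rewrite -mB; apply: ID.
  by rewrite opprD addrCA E; ring.
Qed.

(** As phi is onto, the last term of the exact sequence for J and phi is 0. *)
Lemma edim_transport I J (phi psi : O -> O) : 
  (forall a b, phi (a + b) = phi a + phi b) -> (forall z a, phi (gC z * a) = gC z * phi a) ->
  (forall a, phi (psi a) = a) -> subspace J -> (forall a, I a <-> J (phi a)) -> edim I = edim J.
Proof.
move=> pD pZ K sJ IJ.
rewrite (edim_exact sJ pD pZ) -(edim_ext IJ) [X in eadd _ X](_ : _ = Some 0%N).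
  by case: (edim I) => //= n; rewrite addn0.
have [J0 _ _] := sJ; apply: edim_eq; split=> [|[|a t] ind] //; first by exists [::].
pose c k : C := (k == 0%N)%:R; suff /eqP : c 0%N = 0 by rewrite oner_eq0.
apply: (ind c) => //; exists 0, (psi (lc c (a :: t))).
by rewrite K add0r.
Qed.

End Codim.

(** * Intersection multiplicities *)

Section EnatArith.

Lemma eaddC : commutative eadd.
Proof. by case=> [m|] [n|] //=; rewrite addnC. Qed.
Lemma eaddA : associative eadd.
Proof. by case=> [m|] [n|] [p|] //=; rewrite addnA. Qed.
Lemma eadd0 : left_id (Some 0%N) eadd.
Proof. by case. Qed.
HB.instance Definition _ := Monoid.isComLaw.Build (option nat) (Some 0%N) eadd eaddA eaddC eadd0.

Lemma esumE (s : seq (option nat)) : esum s = \big[eadd/Some 0%N]_(d <- s) d.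
Proof. by elim: s => [|d s IH]; rewrite ?big_nil ?big_cons -?IH. Qed.

Definition emul n (d : option nat) : option nat := iter n (eadd d) (Some 0%N).

Lemma emul_Some n d : emul n (Some d) = Some (n * d)%N.
Proof. by elim: n => // n IH; rewrite /emul iterS -/(emul n _) IH /= mulSn. Qed.
Lemma emul_None n : (0 < n)%N -> emul n None = None.
Proof. by case: n. Qed.

End EnatArith.

Section Intersection.
Variable R : realType.
Local Notation C := (R[i]).
Local Notation O := (germ R).
Local Notation X := (gX R).
Local Notation Y := (gY R).
Implicit Types (a b p q : O) (I J : O -> Prop).

Definition ideal2 p q a : Prop := exists u v, a = u * p + v * q.

Lemma ideal2_subspace p q : subspace (ideal2 p q).
Proof.
split; first by exists 0, 0; ring.
  by move=> _ _ [u [v ->]] [u' [v' ->]]; exists (u + u'), (v + v'); ring.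
by move=> z _ [u [v ->]]; exists (gC z * u), (gC z * v); ring.
Qed.

(* Intersection multiplicity; [None] stands for infinity. *)
Definition inter p q : option nat := edim (ideal2 p q).

Lemma in_ideal2P p q a : in_ideal2 (gval p) (gval q) (gval a) <-> ideal2 p q a.
Proof.
have E (u v : O) : psadd (psmul (gval u) (gval p)) (psmul (gval v) (gval q))
    = gval (u * p + v * q).
  by apply: funext => i; apply: funext => j; rewrite /psadd gD !gM.
split=> [[u [v [cu [cv e]]]]|[u [v ->]]].
  exists (mkgerm cu), (mkgerm cv); apply: germ_eqP => i j.
  by rewrite e -[u]/(gval (mkgerm cu)) -[v]/(gval (mkgerm cv)) E.
by exists (gval u), (gval v); split; [|split]; [exact: germ_conv|exact: germ_conv|].
Qed.

Lemma indep_modP p q (s : seq O) :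
  indep_mod (gval p) (gval q) [seq (gval a : ps R) | a <- s] <-> indep (ideal2 p q) s.
Proof.
have E (c : nat -> C) : (fun i j => \sum_(k < size [seq (gval a : ps R) | a <- s])
    c k * (nth (ps0 R) [seq (gval a : ps R) | a <- s] k) i j) = gval (lc c s).
  apply: funext => i; apply: funext => j; rewrite /lc g_sum size_map.
  by apply: eq_bigr => k _; rewrite gCM (nth_map 0).
split=> [[_ H] c Ic k ks|H].
  have ks' : (k < size [seq (gval a : ps R) | a <- s])%N by rewrite size_map.
  apply: (H (fun k => c k) _ (Ordinal ks')).
  by rewrite (E c); apply/in_ideal2P.
split=> [a /mapP[b _ ->]|c Ic k]; first exact: germ_conv.
pose c' j := if insub j is Some i then c i else 0.
have cE (i : 'I_(size [seq (gval a : ps R) | a <- s])) : c' i = c i by rewrite /c' valK.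
rewrite -cE; apply: (H c'); last first.
  by rewrite -[X in (_ < X)%N](size_map (fun a : O => gval a : ps R)).
apply/in_ideal2P; rewrite -E; move: Ic; congr in_ideal2.
by apply: funext => i; apply: funext => j; apply: eq_bigr => l _; rewrite cE.
Qed.

Lemma codim_inter p q : codim (gval p) (gval q) = inter p q.
Proof.
have lift s : indep_mod (gval p) (gval q) s ->
    exists2 t : seq O, indep (ideal2 p q) t & size t = size s.
  move=> H; have [t ts] : exists t : seq O, s = [seq (gval a : ps R) | a <- t].
    have [+ _] := H; elim: s {H} => [|a s IH] cs; first by exists [::].
    have [t ->] := IH (fun z zs => cs z (mem_behead (s := a :: s) zs)).
    by exists (mkgerm (cs a (mem_head _ _)) :: t).
  by exists t; [apply/indep_modP; rewrite -ts|rewrite ts size_map].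
have low t : indep (ideal2 p q) t ->
    indep_mod (gval p) (gval q) [seq (gval a : ps R) | a <- t] by move/indep_modP.
have E d : is_codim (gval p) (gval q) d <-> edimR (ideal2 p q) d.
  case: d => [n|] /=; split.
  - move=> [[s [/lift[t it <-] sn]] mx]; split=> [|u /low/mx]; last by rewrite size_map.
    by exists t.
  - move=> [[s [/low si sn]] mx]; split=> [|u /lift[t /mx it <-]] //.
    by exists [seq (gval a : ps R) | a <- s]; rewrite size_map.
  - by move=> H n; have [s [/lift[t it <-] sn]] := H n; exists t.
  - move=> H n; have [s [/low si sn]] := H n.
    by exists [seq (gval a : ps R) | a <- s]; rewrite size_map.
by congr xget; apply: funext => d; apply: propext.
Qed.

Lemma inter_ext p q p' q' : ideal2 p q p' -> ideal2 p q q' ->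
  ideal2 p' q' p -> ideal2 p' q' q -> inter p q = inter p' q'.
Proof.
move=> [u1 [v1 E1]] [u2 [v2 E2]] [u3 [v3 E3]] [u4 [v4 E4]].
apply: edim_ext => a; split=> -[u [v ->]].
  by rewrite {1}E3 {1}E4; exists (u * u3 + v * u4), (u * v3 + v * v4); ring.
by rewrite E1 E2; exists (u * u1 + v * u2), (u * v1 + v * v2); ring.
Qed.

Lemma ideal2r p q v : ideal2 p q (v * q). Proof. by exists 0, v; ring. Qed.
Lemma ideal2ll p q : ideal2 p q p. Proof. by exists 1, 0; ring. Qed.
Lemma ideal2rr p q : ideal2 p q q. Proof. by exists 0, 1; ring. Qed.

Lemma interC p q : inter p q = inter q p.
Proof. by apply: inter_ext; first [exact: ideal2ll|exact: ideal2rr]. Qed.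

Lemma edim_all I : (forall a, I a) -> edim I = Some 0%N.
Proof.
move=> H; apply: edim_eq; split=> [|[|a t] ind] //; first by exists [::].
have /eqP : (1 : C) = 0 by apply: (ind (fun=> 1)) (0%N) _.
by rewrite oner_eq0.
Qed.

Lemma inter_unit p q : q~[0, 0] != 0 -> inter p q = Some 0%N.
Proof.
move=> /germ_inv[u qu]; apply: edim_all => a; exists 0, (a * u).
by rewrite mul0r add0r -mulrA [u * q]mulrC qu mulr1.
Qed.

Lemma inter_mulunit a u q : u~[0, 0] != 0 -> inter a (u * q) = inter a q.
Proof.
move=> /germ_inv[v uv]; apply: inter_ext; try exact: ideal2ll; try exact: ideal2r.
exists 0, v; rewrite mul0r add0r mulrA [v * u]mulrC uv mul1r //.
Qed.

(* [c] behaves like a prime element not dividing [a]. *)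
Lemma inter_mul a b c : (forall p v, a * p = c * v -> exists w, p = c * w) ->
  (forall p v, c * p = c * v -> p = v) ->
  inter a (c * b) = eadd (inter a b) (inter a c).
Proof.
move=> prime can; rewrite /inter (edim_exact (m := fun u => c * u)); last first.
- by move=> z u; ring.
- by move=> u v; ring.
- exact: ideal2_subspace.
congr eadd; apply: edim_ext => u; split.
- move=> [p [v E]]; have [w Ew] : exists w, p = c * w.
    by apply: (prime _ (u - v * b)); rewrite mulrBr E; ring.
  by exists w, v; apply: can; rewrite E Ew; ring.
- by move=> [p [v ->]]; exists (c * p), v; ring.
- by move=> [_ [v [[p [w ->]] ->]]]; exists p, (w * b + v); ring.
- move=> [p [v ->]]; exists (p * a), v; split; last by ring.
  by exists p, 0; ring.
Qed.

Lemma inter_hom (phi psi : {rmorphism O -> O}) p q :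
  (forall c, phi (gC c) = gC c) -> (forall a, phi (psi a) = a) -> (forall a, psi (phi a) = a) ->
  inter (phi p) (phi q) = inter p q.
Proof.
move=> pC K K'; apply/esym; apply: (@edim_transport _ _ _ phi psi) => //.
- exact: rmorphD.
- by move=> z a; rewrite rmorphM pC.
- exact: ideal2_subspace.
move=> a; split=> [[u [v ->]]|[u [v E]]].
  by exists (phi u), (phi v); rewrite rmorphD !rmorphM.
exists (psi u), (psi v); rewrite -(K' a) E rmorphD !rmorphM /=.
by rewrite !K'.
Qed.

End Intersection.

(** * Splitting into linear factors, and Halphen's formula *)

Section Halphen.
Variable R : realType.
Local Notation C := (R[i]).
Local Notation O := (germ R).
Local Notation X := (gX R).
Local Notation Y := (gY R).
Implicit Types (a b p q Q Z : O).

(** Weierstrass division by y - Z leaves a remainder in C{x}, which the substitution y := Z does not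
    change. *)
Lemma root_factor Z a : xonly Z -> Z~[0, 0] = 0 -> sub X Z a = 0 -> exists b, a = (Y - Z) * b.
Proof.
move=> xZ Z0 aZ; have r1 : yreg (Y - Z) 1.
  split=> [|[|//] _]; rewrite ryE gD gN gYE; last by rewrite Z0 subr0.
  by rewrite xZ // subr0; apply/eqP; rewrite oner_eq0.
have [q [r [E xr]]] := weierstrass_division a r1.
exists q; rewrite E mulrC -[RHS]addr0; congr (_ + _).
have := congr1 (sub X Z) E; rewrite aZ rmorphD rmorphM rmorphB /= sub_Y //.
rewrite (sub_xonly_id Z0 xZ) subrr mulr0 add0r sub_xonly_id //.
Qed.

Lemma sub_YZ P Z : P~[0, 0] = 0 -> Z~[0, 0] = 0 -> xonly Z -> sub P Y (Y - Z) = Y - sub P 0 Z.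
Proof. by move=> P0 Z0 xZ; rewrite rmorphB /= sub_Y ?gY00 // sub_xonly ?gY00. Qed.

Lemma ry_subX P a : P~[0, 0] = 0 -> sub 0 Y P = 0 -> ry (sub P Y a) = ry a.
Proof. by move=> P0 sP; rewrite ry_sub ?gY00 // sP sub_Y ?gY00 // ry_sub0. Qed.

Lemma sub0Xn N : (0 < N)%N -> sub 0 Y (X ^+ N) = 0.
Proof. by move=> N0; rewrite rmorphXn /= sub_X ?g0 // expr0n gtn_eqF. Qed.

Lemma yreg_subX N a n : (0 < N)%N -> yreg a n -> yreg (sub (X ^+ N) Y a) n.
Proof. by move=> N0; rewrite /yreg ry_subX ?gXn00 ?sub0Xn. Qed.

Definition xseries Z : Prop := xonly Z /\ Z~[0, 0] = 0.

Lemma xseries_sub M Z : xseries Z -> (0 < M)%N -> xseries (sub (X ^+ M) 0 Z).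
Proof.
move=> [xZ Z0] M0; split; last by rewrite sub_00 ?gXn00 ?g0.
by apply: xonly_sub; rewrite ?gXn00 ?g0 //; apply: xonlyXn.
Qed.

Lemma ord_fpsX : ord (fpsX : fps C) = Some 1%N.
Proof.
apply: ord_eq; split=> [|[|//] _]; last by rewrite /fpsX.
by apply/eqP; rewrite /fpsX oner_eq0.
Qed.

(** The cofactor of y - Z may need a further ramification x := x^M, along which the root Z already
    found is pulled back. All roots thus end up over the same N. *)
Lemma puiseux_factor Q n : yreg Q n ->
  exists N (Zs : seq O) U, [/\ (0 < N)%N, size Zs = n, {in Zs, forall Z, xseries Z},
    U~[0, 0] != 0 & sub (X ^+ N) Y Q = U * \prod_(Z <- Zs) (Y - Z)].
Proof.
elim: n Q => [|n IH] Q rQ.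
  exists 1%N, [::], Q; split=> //; first by have [/eqP] := rQ.
  by rewrite expr1 sub_id big_nil mulr1.
have [N [Z [N0 xZ Z0 E]]] := puiseux_root (ltn0Sn n) rQ.
have [b Eb] : exists b, sub (X ^+ N) Y Q = (Y - Z) * b.
  apply: root_factor => //; rewrite sub_comp ?gXn00 ?gX00 ?gY00 //.
  by rewrite rmorphXn /= sub_X ?gX00 // sub_Y.
have rb : yreg b n.
  have := ord_eq (yreg_subX N0 rQ); rewrite Eb rmorphM ordM /=.
  have -> : ry (Y - Z) = fpsX.
    by apply: funext => -[|[|j]]; rewrite ryE gD gN gYE ?Z0 ?xZ // subr0.
  rewrite ord_fpsX /yreg; have := ordP (ry b).
  by case: (ord (ry b)) => // m + /= -[<-].
have [M [Zs [U [M0 sZ bZ U0 EU]]]] := IH b rb.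
exists (M * N)%N, (sub (X ^+ M) 0 Z :: Zs), U; split; rewrite ?muln_gt0 ?M0 //=.
- by rewrite sZ.
- by move=> W; rewrite inE => /orP[/eqP ->|/bZ //]; apply: xseries_sub.
have [XM XN] := (@gXn00 R M M0, @gXn00 R N N0); have YY := @gY00 R.
have := congr1 (sub (X ^+ M) Y) Eb; rewrite (sub_comp _ XM YY XN YY).
rewrite rmorphXn /= (sub_X Y XM) (sub_Y (X ^+ M) YY) -exprM => ->.
by rewrite rmorphM /= (sub_YZ XM Z0 xZ) EU big_cons mulrCA mulrA.
Qed.

Lemma sub_xonly_img Z a : xseries Z -> xonly (sub X Z a).
Proof.
move=> [xZ Z0]; apply/xonlyP; rewrite sub_comp ?gX00 ?g0 //.
by rewrite sub_X ?gX00 // (sub_xonly_id (g0 R 0 0) xZ).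
Qed.

Lemma xonly_eq0 a : xonly a -> rx a = 0 -> a = 0.
Proof. by move=> xa ra; apply: xonly_rx => //; rewrite ra rmorph0. Qed.

Lemma xonly_mulf_eq0 a b : xonly a -> xonly b -> a * b = 0 -> a = 0 \/ b = 0.
Proof.
move=> xa xb ab; have : rx a * rx b = 0 by rewrite -rmorphM ab rmorph0.
by case/fps_mulf_eq0 => h; [left|right]; apply: xonly_eq0.
Qed.

(** The change of coordinates y := y + Z turns y - Z into y, which cancels coefficient by
    coefficient. *)
Lemma YZ_cancel Z p q : xseries Z -> (Y - Z) * p = (Y - Z) * q -> p = q.
Proof.
move=> [xZ Z0] /eqP; rewrite -subr_eq0 -mulrBr => /eqP E; apply/eqP; rewrite -subr_eq0.
have Yp : (Y + Z)~[0, 0] = 0 by rewrite gD00 ?gY00.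
have Ym : (Y - Z)~[0, 0] = 0 by rewrite gD00 ?gY00 // gN Z0 oppr0.
have K a : sub X (Y - Z) (sub X (Y + Z) a) = a.
  rewrite (sub_comp _ (gX00 R) Ym (gX00 R) Yp) (sub_X _ (gX00 R)) rmorphD /=.
  by rewrite (sub_Y _ Ym) (sub_xonly_id Ym xZ) subrK sub_id.
have := congr1 (sub X (Y + Z)) E; rewrite rmorphM rmorphB /= (sub_Y _ Yp).
rewrite (sub_xonly_id Yp xZ) addrK rmorph0 => h.
have {}h : sub X (Y + Z) (p - q) = 0.
  apply: germ_eqP => i j; have := congr1 (fun a => a~[i, j.+1]) h.
  by rewrite -{1}[Y]expr1 gYnM subn1.
have := congr1 (sub X (Y - Z)) h; rewrite rmorph0 rmorphB /= rmorphB /= !K => ->.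
by [].
Qed.

Lemma lc_X c n i : rx (lc c [seq X ^+ k | k <- iota 0 n]) i = if (i < n)%N then c i else 0.
Proof.
rewrite rxE /lc g_sum size_map size_iota.
rewrite (eq_bigr (fun k : 'I_n => if i == k then c k else 0)) => [|k _]; last first.
  rewrite gCM (nth_map 0%N) ?size_iota // nth_iota // add0n.
  rewrite -[X ^+ k]mulr1 -(expr0 Y) -[X ^+ k * _]mul1r -(rmorph1 (@gC R)) -/(gmon _ _ _).
  by rewrite gmonE andbT; case: eqP; rewrite ?mulr1 ?mulr0.
have [ilt|ni] := ltnP i n; last by rewrite big1 // => k _; rewrite gtn_eqF // (leq_trans _ ni).
rewrite (bigD1 (Ordinal ilt)) //= eqxx big1 ?addr0 // => k.
by rewrite -val_eqE eq_sym /= => /negPf ->.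
Qed.

Lemma xonly_lc_X c n : xonly (lc c [seq X ^+ k | k <- iota 0 n]).
Proof.
apply/xonlyP; rewrite /lc rmorph_sum size_map size_iota; apply: eq_bigr => k _.
rewrite rmorphM /= sub_C (nth_map 0%N) ?size_iota // nth_iota //.
by rewrite rmorphXn /= sub_X ?gX00.
Qed.

(** The substitution y := Z kills the whole ideal but fixes the powers of x, which therefore stay
    independent modulo the ideal. *)
Lemma inter_common_root Z a q : xseries Z -> sub X Z a = 0 -> sub X Z q = 0 ->
  inter a q = None.
Proof.
move=> sZ a0 q0; apply: edim_eq => n; exists [seq X ^+ k | k <- iota 0 n].
split; last by rewrite size_map size_iota.
move=> c [u [v E]] k; rewrite size_map size_iota => kn; have [xZ Z0] := sZ.
have := congr1 (sub X Z) E; rewrite rmorphD !rmorphM /= a0 q0 !mulr0 addr0.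
rewrite (sub_xonly_id Z0 (@xonly_lc_X c n)) => /(congr1 (fun a => rx a k)).
by rewrite lc_X kn rmorph0.
Qed.

(** Modulo y - Z the ring is C{x}, where a becomes x^n times a unit; so 1, x, ..., x^(n-1) is a
    basis of the quotient. *)
Lemma inter_root Z a : xseries Z -> inter a (Y - Z) = ord (rx (sub X Z a)).
Proof.
move=> sZ; have [xZ Z0] := sZ.
have Zr : sub X Z (Y - Z) = 0 by rewrite rmorphB /= sub_Y // (sub_xonly_id Z0 xZ) subrr.
have := ordP (rx (sub X Z a)); case: ord => [n|] /=; last first.
  by move=> /(xonly_eq0 (sub_xonly_img _ sZ)) a0; apply: inter_common_root Zr.
move=> [an ai]; set r := sub X Z a in an ai.
have xr : xonly r by apply: sub_xonly_img.
have [w [Ew cw]] : exists w, r = X ^+ n * w /\ forall i j, w~[i, j] = r~[i + n, j].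
  apply: xdivP => i [|j] ilt; last exact: xr.
  exact: ai.
have xw : xonly w by move=> i j j0; rewrite cw xr.
have [w' [ww' xw']] : exists w', w * w' = 1 /\ xonly w'.
  have [w' ww'] : exists w', w * w' = 1 by apply: germ_inv; rewrite cw; apply/eqP.
  exists (sub X 0 w'); split; last by rewrite sub_X0; apply: r0_xonly.
  have := congr1 (sub X 0) ww'; rewrite rmorphM rmorph1 /= => <-.
  by rewrite (sub_xonly_id (g0 R 0 0) xw).
apply: edim_eq; apply: (@edimR_basis _ _ [seq X ^+ k | k <- iota 0 n]).
- exact: ideal2_subspace.
- move=> c [u [v E]] k; rewrite size_map size_iota => kn.
  have := congr1 (sub X Z) E; rewrite rmorphD !rmorphM /= Zr mulr0 addr0 -/r Ew.
  rewrite (sub_xonly_id Z0 (@xonly_lc_X c n)) => /(congr1 (fun a => rx a k)).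
  by rewrite lc_X kn mulrCA rxE gXnM leqNgt kn.
- move=> b; exists (fun i => rx (sub X Z b) i).
  set s := [seq _ | _ <- _]; set b' := b - _.
  have xb : sub X Z b' = sub X Z b - lc (fun i => rx (sub X Z b) i) s.
    by rewrite /b' rmorphB /= (sub_xonly_id Z0 (@xonly_lc_X _ n)).
  have [e [Ee ce]] : exists e, sub X Z b' = X ^+ n * e /\
      forall i j, e~[i, j] = (sub X Z b')~[i + n, j].
    apply: xdivP => i [|j] ilt; last exact: (sub_xonly_img b' sZ).
    by rewrite xb gD gN -[(lc _ s)~[_, _]]rxE lc_X ilt subrr.
  have xe : xonly e by move=> i j j0; rewrite ce (sub_xonly_img b' sZ).
  (* On y = Z one has a = x^n w, with inverse w' of w, and b' = x^n e. So b' and w' e a agree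
     there. *)
  have [|e0 Ee0] := @root_factor Z (b' - w' * e * a) xZ Z0.
    rewrite rmorphB !rmorphM /= -/r Ew Ee (sub_xonly_id Z0 xw') (sub_xonly_id Z0 xe).
    rewrite (_ : w' * e * _ = X ^+ n * e * (w * w')); last by ring.
    by rewrite ww' mulr1 subrr.
  exists (w' * e), e0; rewrite [e0 * _]mulrC -Ee0; ring.
- by rewrite size_map size_iota.
Qed.

Lemma inter_prod (Zs : seq O) a : {in Zs, forall Z, xseries Z} ->
  inter a (\prod_(Z <- Zs) (Y - Z)) = \big[eadd/Some 0%N]_(Z <- Zs) ord (rx (sub X Z a)).
Proof.
elim: Zs => [|Z Zs IH] xs.
  by rewrite !big_nil inter_unit // g1 oner_eq0.
have sZ : xseries Z by apply: xs; rewrite mem_head.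
have [xZ Z0] := sZ.
have Zr : sub X Z (Y - Z) = 0 by rewrite rmorphB /= sub_Y // (sub_xonly_id Z0 xZ) subrr.
rewrite [RHS]big_cons [X in inter _ X]big_cons.
have [o E] : exists o, ord (rx (sub X Z a)) = o by eexists.
(* If a vanishes on y = Z, then y - Z divides a and [inter_mul] does not apply; both sides are
   infinite. *)
rewrite [X in eadd X _]E; case: o E => [m|] E; last first.
  apply: (inter_common_root sZ); first by apply/xonly_eq0/ord_None/E; apply: sub_xonly_img.
  by rewrite rmorphM /= Zr mul0r.
rewrite inter_mul; last by move=> p v; apply: YZ_cancel sZ.
  rewrite eaddC (inter_root a sZ) [X in eadd X _]E; congr eadd; apply: IH => W WZ.
  by apply: xs; rewrite inE WZ orbT.
move=> p v /(congr1 (sub X Z)); rewrite !rmorphM /= Zr mul0r.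
case/(xonly_mulf_eq0 (sub_xonly_img _ sZ) (sub_xonly_img _ sZ)) => h.
  by have := E; rewrite h rmorph0 ord_0.
exact: root_factor.
Qed.

Section PowerSubstitution.
Variable N : nat.
Hypothesis N0 : (0 < N)%N.
Local Notation s := (sub (X ^+ N) Y).

Definition px k a : O := mkgerm (px_conv k a N0).

Lemma pxE k a i j : (px k a)~[i, j] = a~[N * i + k, j]. Proof. by []. Qed.

Lemma pxD k a b : px k (a + b) = px k a + px k b.
Proof. by apply: germ_eqP => i j; rewrite gD !pxE gD. Qed.

Lemma px_mul k u b : (k < N)%N -> px k (s u * b) = u * px k b.
Proof.
move=> kN; apply: (@germ_cont_ext _ (fun u => px k (s u * b)) (fun u => u * px k b)).
- by move=> u1 u2; rewrite rmorphD mulrDl pxD.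
- by move=> u1 u2; rewrite mulrDl.
- move=> c m l; apply: germ_eqP => i j.
  rewrite /gmon !rmorphM !rmorphXn /= sub_C (sub_X _ (gXn00 R N0)) (sub_Y _ (gY00 R)).
  rewrite pxE -!mulrA !gCM -exprM !gXnM !gYnM pxE.
  have -> : (N * m <= N * i + k)%N = (m <= i)%N.
    by apply/idP/idP => h; nia.
  case: leqP => // mi; case: leqP => // lj.
  by congr (_ * gval b _ _); rewrite mulnBr -addnBAC // leq_mul2l mi orbT.
- move=> n; exists (N * n + k)%N => u0 mu i j ij; rewrite pxE.
  have ms : mdeg (N * n + k) (s u0 * b) by apply: germ_mdegMl; apply: sub_mdeg.
  by apply: ms; nia.
- by move=> n; exists n => u0 mu; apply: germ_mdegMl.
Qed.

Lemma px_X j k u : (j < N)%N -> (k < N)%N -> px k (X ^+ j * s u) = if j == k then u else 0.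
Proof.
move=> jN kN; rewrite mulrC px_mul //.
have -> : px k (X ^+ j) = if j == k then 1 else 0.
  apply: germ_eqP => i l; rewrite pxE -[X ^+ j]mulr1 gXnM g1.
  case: (eqVneq j k) => [<-|jk].
    rewrite leq_addl addnK g1; congr (_ && _)%:R.
    by rewrite muln_eq0 (gtn_eqF N0).
  rewrite g0; case: leqP => // h.
  rewrite subn_eq0 [(_ <= j)%N](_ : _ = false) //.
  apply/negP => h'; move/eqP: jk; apply.
  by case: i h h' => [|i]; rewrite ?muln0 ?mulnS; lia.
by case: eqP; rewrite ?mulr1 ?mulr0.
Qed.

Lemma px_sum a : a = \sum_(k < N) X ^+ k * s (px k a).
Proof.
have inj a' b' : (forall k, (k < N)%N -> px k a' = px k b') -> a' = b'.
  move=> H; apply: germ_eqP => i j.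
  have := congr1 (fun c => c~[i %/ N, j]) (H _ (ltn_pmod i N0)).
  by rewrite !pxE mulnC -divn_eq.
apply: inj => k kN; rewrite (big_morph (px k) (pxD k) (_ : px k 0 = 0)); last first.
  by apply: germ_eqP => i j.
rewrite (bigD1 (Ordinal kN)) //= px_X // eqxx big1 ?addr0 // => l.
by rewrite -val_eqE /= => /negPf lk; rewrite px_X // lk.
Qed.

(* O is free over its image under x := x^N, with basis 1, x, ..., x^(N-1); [px k] is the
   k-th coordinate. *)
Lemma inter_power_sub p q : inter (s p) (s q) = emul N (inter p q).
Proof.
pose I := ideal2 p q; have [I0 ID IZ] := ideal2_subspace p q.
(* A filtration from the ideal of s p and s q, at j = 0, to the whole ring, at j = N. Each of its N
   steps contributes one copy of the quotient by I. *)
pose J j a := forall k, (j <= k < N)%N -> I (px k a).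
have J0 a : ideal2 (s p) (s q) a <-> J 0%N a.
  split=> [[u [v ->]] k /andP[_ kN]|H].
    rewrite pxD ![_ * s _]mulrC !px_mul // ![_ * px k _]mulrC.
    by exists (px k u), (px k v).
  have [JI0 JID _] := ideal2_subspace (s p) (s q).
  rewrite (px_sum a); elim/big_ind: _ => // k _.
  have [|u [v ->]] := H k; first by rewrite leq0n ltn_ord.
  by exists (X ^+ k * s u), (X ^+ k * s v); rewrite rmorphD !rmorphM; ring.
have pZ k z a : px k (gC z * a) = gC z * px k a.
  by apply: germ_eqP => i j; rewrite pxE !gCM pxE.
have p0 k : px k 0 = 0 by apply: germ_eqP => i j.
have JS j : subspace (J j).
  split=> [k _|a b Ja Jb k jk|z a Ja k jk]; first by rewrite p0.
    by rewrite pxD; apply: ID; [apply: Ja|apply: Jb].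
  by rewrite pZ; apply: IZ; apply: Ja.
have step j : (j < N)%N -> edim (J j) = eadd (inter p q) (edim (J j.+1)).
  move=> jN; rewrite (edim_exact (m := fun u => X ^+ j * s u) (JS j)); last first.
  - by move=> z a; rewrite rmorphM /= sub_C; ring.
  - by move=> a b; rewrite rmorphD mulrDr.
  congr eadd; apply: edim_ext => a; split.
  - by move=> /(_ j); rewrite leqnn jN px_X // eqxx => /(_ isT).
  - move=> Ia k /andP[jk kN]; rewrite px_X //.
    by case: eqP.
  - move=> [i [u [Ji ->]]] k /andP[jk kN]; rewrite pxD px_X // (ltn_eqF jk) addr0.
    by apply: Ji; rewrite ltnW.
  - move=> Ja; exists (a - X ^+ j * s (px j a)), (px j a); split; last by rewrite subrK.
    move=> k /andP[jk kN]; rewrite -mulrN -rmorphN pxD px_X //.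
    case: (ltngtP j k) jk => // [jk _|<- _]; last by rewrite subrr.
    by rewrite addr0; apply: Ja; rewrite jk.
rewrite /inter (edim_ext J0) -/(inter p q).
have down j : (j <= N)%N -> edim (J (N - j)%N) = emul j (inter p q).
  elim: j => [|j IH] jN.
    by rewrite subn0; apply: edim_all => a k; case: leqP => // h; rewrite ltnNge h.
  rewrite step; last by rewrite ltn_subrL.
  by rewrite -subSn // subSS IH // ltnW.
by rewrite -(down N) // subnn.
Qed.

End PowerSubstitution.

(* The value at a of the branch x = t^N, y = Z(t). *)
Definition bval N Z a : option nat := ord (rx (sub (X ^+ N) Z a)).

Lemma bvalE N Z a : bval N Z a = ord (rx (sub (X ^+ N) Z a)). Proof. by []. Qed.

Lemma bvalM N Z a b : bval N Z (a * b) = eadd (bval N Z a) (bval N Z b).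
Proof. by rewrite /bval !rmorphM ordM. Qed.

(** Roots are listed with multiplicity and conjugate roots are not identified, hence the factor N.
    Vanishing of Q and Halphen's formula are the only properties used later. *)
Definition branches Q N (Zs : seq O) : Prop := [/\ (0 < N)%N, {in Zs, forall Z, xseries Z},
  {in Zs, forall Z, sub (X ^+ N) Z Q = 0} &
  forall a, emul N (inter a Q) = \big[eadd/Some 0%N]_(Z <- Zs) bval N Z a].

(* Halphen's formula: N i(a, Q) is the sum of the values of a at the branches of Q. *)
Lemma halphen Q n : yreg Q n -> exists N Zs, branches Q N Zs /\ size Zs = n.
Proof.
move=> /puiseux_factor[N [Zs [U [N0 sZ xs U0 E]]]]; exists N, Zs; split=> //.
have comp Z a : xseries Z -> sub X Z (sub (X ^+ N) Y a) = sub (X ^+ N) Z a.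
  move=> [xZ Z0]; rewrite (sub_comp _ (gX00 R) Z0 (gXn00 R N0) (gY00 R)).
  by rewrite rmorphXn /= (sub_X _ (gX00 R)) (sub_Y _ Z0).
split=> // [Z ZZ|a].
  have sZ' := xs Z ZZ; have [xZ Z0] := sZ'.
  rewrite -comp // E rmorphM rmorph_prod (big_rem Z) //=.
  by rewrite rmorphB /= sub_Y // (sub_xonly_id Z0 xZ) subrr mul0r mulr0.
rewrite -(inter_power_sub N0) E.
rewrite (inter_mulunit _ _ U0).
rewrite (inter_prod _ xs).
by apply: eq_big_seq => Z /xs sZ'; rewrite comp.
Qed.

End Halphen.
Opaque inter bval.

(** * Coordinates *)

Section Coordinates.
Variable R : realType.
Local Notation C := (R[i]).
Local Notation O := (germ R).
Local Notation X := (gX R).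
Local Notation Y := (gY R).
Implicit Types (a b f g h p q Q Z : O).

Lemma gX_cancel n a : X ^+ n * a = 0 -> a = 0.
Proof.
move=> E; apply: germ_eqP => i j; have := congr1 (fun b => b~[i + n, j]) E.
by rewrite gXnM leq_addl addnK.
Qed.

Lemma germ_neq0 a : a <> 0 -> exists k i, [/\ (a~[k, i] <> 0),
  forall k' i', (k' < k)%N -> a~[k', i'] = 0 & forall i', (i' < i)%N -> a~[k, i'] = 0].
Proof.
move=> a0.
have [k [i ki]] : exists k i, a~[k, i] <> 0.
  apply: contrapT => none; apply: a0; apply: germ_eqP => k i.
  by apply: contrapT => ki; apply: none; exists k, i.
have exk : exists k, `[< exists i, a~[k, i] <> 0 >] by exists k; apply/asboolP; exists i.
case: (ex_minnP exk) => k0 /asboolP[i1 ki1] mink.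
have exi : exists i, a~[k0, i] != 0 by exists i1; apply/eqP.
case: (ex_minnP exi) => i0 /eqP ki0 mini; exists k0, i0; split=> // [k' i' lt|i' lt].
  apply: contrapT => h; have /mink : `[< exists i, a~[k', i] <> 0 >] by apply/asboolP; exists i'.
  by rewrite leqNgt lt.
by apply: contrapT => /eqP /mini; rewrite leqNgt lt.
Qed.

(* A germ of least order in y among those vanishing on the branch divides, by Weierstrass
   division, every germ vanishing there. *)
Lemma common_branch f g n N Z : (0 < N)%N -> xseries Z -> yreg f n ->
  sub (X ^+ N) Z f = 0 -> sub (X ^+ N) Z g = 0 ->
  exists d u v, [/\ f = d * u, g = d * v & d~[0, 0] = 0].
Proof.
move=> N0 [xZ Z0] rf f0 g0'; have XN := gXn00 R N0.
have ex : exists m, `[< exists W, yreg W m /\ sub (X ^+ N) Z W = 0 >].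
  by exists n; apply/asboolP; exists f.
case: (ex_minnP ex) => m /asboolP[W [rW W0]] min.
have dvd F : sub (X ^+ N) Z F = 0 -> exists q, F = W * q.
  move=> F0; have [q [r [E dr]]] := weierstrass_division F rW.
  have r0 : sub (X ^+ N) Z r = 0.
    by have := congr1 (sub (X ^+ N) Z) E; rewrite F0 rmorphD rmorphM /= W0 mulr0 add0r.
  suff {}E0 : r = 0 by exists q; rewrite E E0 addr0 mulrC.
  apply: contrapT => /germ_neq0[k [i [ki klow ilow]]].
  have [r' [Er cr]] := xdivP klow.
  have im : (i < m)%N by rewrite ltnNge; apply/negP => /dr h; apply: ki.
  have /min : `[< exists W, yreg W i /\ sub (X ^+ N) Z W = 0 >].
    apply/asboolP; exists r'; split.
      by split=> [|i' lt]; rewrite ryE cr // ilow.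
    apply: (@gX_cancel (N * k)).
    by move: r0; rewrite Er rmorphM rmorphXn /= (sub_X _ XN) -exprM.
  by rewrite leqNgt im.
have [[u Eu] [v Ev]] := (dvd f f0, dvd g g0').
exists W, u, v; split=> //.
by rewrite -(sub_00 W XN Z0) W0.
Qed.

Definition coprimeg f g : Prop := forall d u v, f = d * u -> g = d * v -> d~[0, 0] != 0.

Section Shear.
Variable k : nat.
Hypothesis k0 : (0 < k)%N.

Definition shear : {rmorphism O -> O} := sub (X + Y ^+ k) Y.
Definition unshear : {rmorphism O -> O} := sub (X - Y ^+ k) Y.

Lemma gYn00 : (Y ^+ k)~[0, 0] = 0.
Proof. by rewrite -[Y ^+ k]mulr1 gYnM leqNgt k0. Qed.

Lemma shear00 : (X + Y ^+ k)~[0, 0] = 0. Proof. by rewrite gD00 ?gX00 // gYn00. Qed.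
Lemma unshear00 : (X - Y ^+ k)~[0, 0] = 0.
Proof. by rewrite gD00 ?gX00 // gN gYn00 oppr0. Qed.

Lemma shear_C c : shear (gC c) = gC c. Proof. exact: sub_C. Qed.
Lemma shearK a : unshear (shear a) = a.
Proof.
rewrite /shear /unshear /= (sub_comp _ unshear00 (gY00 R) shear00 (gY00 R)).
rewrite rmorphD rmorphXn /= (sub_X _ unshear00) (sub_Y _ (gY00 R)) subrK; exact: sub_id.
Qed.
Lemma unshearK a : shear (unshear a) = a.
Proof.
rewrite /shear /unshear /= (sub_comp _ shear00 (gY00 R) unshear00 (gY00 R)).
rewrite rmorphB rmorphXn /= (sub_X _ shear00) (sub_Y _ (gY00 R)) addrK; exact: sub_id.
Qed.

Lemma dx_shear a : dx (shear a) = shear (dx a).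
Proof.
rewrite /shear /= (dx_sub _ shear00 (gY00 R)) dxY mulr0 addr0 dxD dxX.
have -> : dx (Y ^+ k) = 0.
  elim: (k) => [|n IH]; first by rewrite expr0 -(rmorph1 (@gC R)) dxC.
  by rewrite exprS dxM IH dxY mul0r mulr0 addr0.
by rewrite addr0 mulr1.
Qed.

Definition shear_w : O := dy (X + Y ^+ k).
Lemma dy_shearE a : dy (shear a) = shear (dy a) + shear_w * shear (dx a).
Proof. by rewrite /shear /= (dy_sub _ shear00 (gY00 R)) dyY mulr1 addrC [shear_w * _]mulrC. Qed.

Lemma inter_addmul p q w : inter p (q + w * p) = inter p q.
Proof.
apply: inter_ext; [exact: ideal2ll| |exact: ideal2ll|exact: ideal2rr || idtac].
  by exists (- w), 1; ring.
by exists w, 1; ring.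
Qed.

Definition mu h : option nat := inter (dx h) (dy h).
Definition pairA f g : O := dx f * g - dx g * f.
Definition pairB f g : O := dy f * g - dy g * f.

Lemma inter_shear p q : inter (shear p) (shear q) = inter p q.
Proof. exact: (inter_hom p q shear_C unshearK shearK). Qed.

(** Up to the coordinate change, the shear keeps the x-derivative and alters the y-derivative by a
    multiple of it, so the ideal is the same. The pair (A, B) behaves alike. *)
Lemma mu_shear h : mu (shear h) = mu h.
Proof. by rewrite /mu dx_shear dy_shearE inter_addmul inter_shear. Qed.

Lemma mupair_shear f g : inter (pairA (shear f) (shear g)) (pairB (shear f) (shear g))
  = inter (pairA f g) (pairB f g).
Proof.
have -> : pairA (shear f) (shear g) = shear (pairA f g).
  by rewrite /pairA !dx_shear rmorphB !rmorphM.
have -> : pairB (shear f) (shear g) = shear (pairB f g) + shear_w * shear (pairA f g).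
  rewrite /pairB /pairA !dy_shearE !rmorphB !rmorphM /=; ring.
by rewrite inter_addmul inter_shear.
Qed.

Lemma coprimeg_shear f g : coprimeg f g -> coprimeg (shear f) (shear g).
Proof.
move=> cfg d u v Ef Eg.
have := cfg (unshear d) (unshear u) (unshear v); rewrite -!rmorphM -Ef -Eg !shearK.
by move=> /(_ erefl erefl); rewrite /unshear /= (sub_00 _ unshear00 (gY00 R)).
Qed.

Lemma shear_00 a : (shear a)~[0, 0] = a~[0, 0].
Proof. exact: (sub_00 a shear00 (gY00 R)). Qed.

(** On x = 0 the monomial x^i' y^j' becomes y^(k i' + j'). As j < k, every monomial of a after the
    lexicographically first one yields a higher power. *)
Lemma yreg_shear a i j : a~[i, j] <> 0 -> (forall i' j', (i' < i)%N -> a~[i', j'] = 0) ->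
  (forall j', (j' < j)%N -> a~[i, j'] = 0) -> (j < k)%N -> yreg (shear a) (k * i + j)%N.
Proof.
move=> aij low1 low2 jk.
have coef n : ry (shear a) n = \sum_(i' < n.+1) \sum_(j' < n.+1)
    a~[i', j'] * (k * i' + j' == n)%N%:R.
  rewrite /shear /= (ry_sub _ shear00 (gY00 R)) rmorphD rmorphXn /= (sub_X _ (g0 R 0 0)) add0r.
  rewrite (sub_Y _ (gY00 R)) ryE (@sub_coef _ _ _ _ n.+1 _ _ gYn00 (gY00 R)) //.
  apply: eq_bigr => i' _; apply: eq_bigr => j' _; congr (_ * _).
  rewrite -exprM -exprD -[Y ^+ _]mulr1 gYnM g1 /= subn_eq0 eqn_leq.
  by case: leqP.
have zero i' j' n : (n <= k * i + j)%N -> (i', j') <> (i, j) ->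
    (k * i' + j' == n)%N -> a~[i', j'] = 0.
  move=> nle ne /eqP e; have [lt|gt|ei] := ltngtP i' i; first exact: low1.
    by exfalso; nia.
  rewrite ei in e ne *; have [lt|gt|ej] := ltngtP j' j; first exact: low2.
    by exfalso; lia.
  by case: ne; rewrite ej.
split=> [|n nlt]; last first.
  rewrite coef big1 // => i' _; rewrite big1 // => j' _.
  have [e|ne] := eqVneq (k * i' + j')%N n; last by rewrite mulr0.
  have -> : a~[i', j'] = 0; last by rewrite mul0r.
  apply: (zero i' j' n (ltnW nlt)); last by rewrite e.
  by move=> -[ei ej]; move: nlt; rewrite -e ei ej ltnn.
set n := (k * i + j)%N; rewrite coef.
have ilt : (i < n.+1)%N by rewrite /n; nia.
have jlt : (j < n.+1)%N by rewrite /n; lia.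
rewrite (bigD1 (Ordinal ilt)) //= (bigD1 (Ordinal jlt)) //= eqxx mulr1 !big1 ?addr0 //.
- move=> i' ne; rewrite big1 // => j' _.
  have [e|_] := eqVneq (k * i' + j')%N n; last by rewrite mulr0.
  have -> : a~[i', j'] = 0; last by rewrite mul0r.
  apply: (zero i' j' n (leqnn n)); last by rewrite e.
  by move=> -[ei _]; move/eqP: ne; apply; apply: val_inj.
- move=> j' ne; have [e|_] := eqVneq (k * i + j')%N n; last by rewrite mulr0.
  have -> : a~[i, j'] = 0; last by rewrite mul0r.
  apply: (zero i j' n (leqnn n)); last by rewrite e.
  by move=> -[ej]; move/eqP: ne; apply; apply: val_inj.
Qed.

End Shear.

Lemma ord_independent (F G : fps C) m n (a b : C) : is_ord F (Some m) -> is_ord G (Some n) ->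
  m <> n -> (forall i, a * F i + b * G i = 0) -> a = 0 /\ b = 0.
Proof.
move=> [Fm Fl] [Gn Gl] mn H.
have a0 : b * G m = 0 -> a = 0.
  move=> bG; have /eqP := H m; rewrite bG addr0 mulf_eq0 => /orP[/eqP //|/eqP].
  by move/Fm.
have b0 : a * F n = 0 -> b = 0.
  move=> aF; have /eqP := H n; rewrite aF add0r mulf_eq0 => /orP[/eqP //|/eqP].
  by move/Gn.
have [lt|gt|//] := ltngtP m n.
  have az : a = 0 by apply: a0; rewrite Gl ?mulr0.
  by split=> //; apply: b0; rewrite az mul0r.
have bz : b = 0 by apply: b0; rewrite Fl ?mulr0.
by split=> //; apply: a0; rewrite bz mul0r.
Qed.

(* No member of the pencil vanishes on the axis x = 0. *)
Definition xtransversal f g : Prop := forall al be : C, (al, be) != (0, 0) ->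
  exists n, yreg (gC al * f + gC be * g) n.

(* For k large, the order of f(y^k, y) is read off the lexicographically first monomial of f.
   Subtracting a multiple of f from g makes the first monomials of f and g different. *)
Lemma shear_xtransversal f g : f~[0, 0] = 0 -> g~[0, 0] = 0 -> coprimeg f g ->
  exists2 k, (0 < k)%N & xtransversal (shear k f) (shear k g).
Proof.
move=> f00 g00 cfg.
have fN0 : f <> 0.
  move=> fz; have := cfg g 0 1; rewrite mulr0 mulr1 => /(_ fz erefl).
  by rewrite g00 eqxx.
have [i [j [fij fi fj]]] := germ_neq0 fN0.
have dvdf c : g - gC c * f <> 0.
  move=> /eqP; rewrite subr_eq0 => /eqP E; have := cfg f 1 (gC c).
  by rewrite mulr1 mulrC E => /(_ erefl erefl); rewrite f00 eqxx.
have [c [i' [j' [gij gi gj ne]]]] : exists c i' j', [/\ (g - gC c * f)~[i', j'] <> 0,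
    forall k' l', (k' < i')%N -> (g - gC c * f)~[k', l'] = 0,
    forall l', (l' < j')%N -> (g - gC c * f)~[i', l'] = 0 & (i', j') <> (i, j)].
  have [i1 [j1 [h1 h2 h3]]] := germ_neq0 (@dvdf 0).
  have [[ei ej]|ne] := pselect ((i1, j1) = (i, j)); last by exists 0, i1, j1.
  pose c := g~[i, j] / f~[i, j]; have [i2 [j2 [l1 l2 l3]]] := germ_neq0 (@dvdf c).
  exists c, i2, j2; split=> // -[ei2 ej2]; apply: l1.
  by rewrite gD gN gCM ei2 ej2 /c divfK ?subrr //; apply/eqP.
pose k := (maxn j j').+1; exists k => // al be ab.
have jk : (j < k)%N by rewrite ltnS leq_maxl.
have jk' : (j' < k)%N by rewrite ltnS leq_maxr.
have rf := yreg_shear (ltn0Sn _) fij fi fj jk.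
have rg := yreg_shear (ltn0Sn _) gij gi gj jk'.
set n1 := (k * i + j)%N in rf; set n2 := (k * i' + j')%N in rg.
(* Since j and j' are below k, the pairs are recovered from the orders as quotient and remainder
   modulo k. *)
have n12 : n1 <> n2.
  move=> e; apply: ne; have k0 : (0 < k)%N by [].
  have e1 : (n1 %/ k = i)%N by rewrite /n1 mulnC divnMDl // divn_small ?addn0.
  have e2 : (n2 %/ k = i')%N by rewrite /n2 mulnC divnMDl // divn_small ?addn0.
  have e3 : (n1 %% k = j)%N by rewrite /n1 mulnC modnMDl modn_small.
  have e4 : (n2 %% k = j')%N by rewrite /n2 mulnC modnMDl modn_small.
  by rewrite -e1 -e2 -e3 -e4 e.
have [[n|] hn] := is_ord_ex (ry (gC al * shear k f + gC be * shear k g)); first by exists n.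
exfalso; move: hn => /=.
set f' := shear k f in rf *; set g' := shear k (g - gC c * f) in rg *.
have E : gC al * f' + gC be * shear k g = gC (al + be * c) * f' + gC be * g'.
  by rewrite /g' /f' rmorphB rmorphM shear_C rmorphD rmorphM /=; ring.
rewrite E => H; have {}H n : (al + be * c) * ry f' n + be * ry g' n = 0.
  by have := congr1 (fun s => s n) H; rewrite ryE gD !gCM.
have [a0 b0] := ord_independent rf rg n12 H.
by move: ab a0; rewrite b0 mul0r addr0 => /eqP ab al0; apply: ab; rewrite al0.
Qed.

End Coordinates.

(** * Orders along a branch *)

Section Enat.
Implicit Types (a b d : option nat).

Lemma emulD n a b : emul n (eadd a b) = eadd (emul n a) (emul n b).
Proof.
by elim: n => // n IH; rewrite /emul !iterS -!/(emul _ _) IH Monoid.mulmACA.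
Qed.

Lemma emul_inj n a b : (0 < n)%N -> emul n a = emul n b -> a = b.
Proof.
move=> n0; case: a b => [a|] [b|]; rewrite ?emul_Some ?emul_None //.
by case=> /eqP; rewrite eqn_pmul2l // => /eqP ->.
Qed.

Lemma eadd_inj m a b : eadd a (Some m) = eadd b (Some m) -> a = b.
Proof. by case: a b => [a|] [b|] //= [] /addIn ->. Qed.

Lemma esum_const (I : Type) (r : seq I) m :
  \big[eadd/Some 0%N]_(i <- r) Some m = Some (size r * m)%N.
Proof. by elim: r => [|i r IH]; rewrite ?big_nil ?big_cons ?IH. Qed.

Lemma esum_Some (I : Type) (r : seq I) (F : I -> nat) :
  \big[eadd/Some 0%N]_(i <- r) Some (F i) = Some (\sum_(i <- r) F i)%N.
Proof. by elim: r => [|i r IH]; rewrite ?big_nil ?big_cons ?IH. Qed.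

Lemma emul_sum (I : Type) (r : seq I) (F : I -> option nat) n :
  emul n (\big[eadd/Some 0%N]_(i <- r) F i) = \big[eadd/Some 0%N]_(i <- r) emul n (F i).
Proof.
by elim: r => [|i r IH]; rewrite ?big_nil ?big_cons ?emulD ?IH // emul_Some muln0.
Qed.

Definition ele a b : bool :=
  match a, b with _, None => true | None, Some _ => false | Some m, Some n => (m <= n)%N end.

Lemma ele_add a b a' b' : ele a b -> ele a' b' -> ele (eadd a a') (eadd b b').
Proof. by case: a b a' b' => [?|] [?|] [?|] [?|] //=; apply: leq_add. Qed.
Lemma ele_sum (I : eqType) (r : seq I) (F G : I -> option nat) :
  {in r, forall i, ele (F i) (G i)} ->
  ele (\big[eadd/Some 0%N]_(i <- r) F i) (\big[eadd/Some 0%N]_(i <- r) G i).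
Proof.
elim: r => [|i r IH] H; rewrite ?big_nil ?big_cons //.
apply: ele_add; first by apply: H; rewrite mem_head.
by apply: IH => j jr; apply: H; rewrite inE jr orbT.
Qed.
Lemma ele_emul n a b : (0 < n)%N -> ele (emul n a) (emul n b) = ele a b.
Proof.
by move=> n0; case: a b => [a|] [b|]; rewrite ?emul_Some ?emul_None //= leq_pmul2l.
Qed.
Lemma ele_addr m a b : ele (eadd a (Some m)) (eadd b (Some m)) = ele a b.
Proof. by case: a b => [a|] [b|] //=; rewrite leq_add2r. Qed.

End Enat.

(** * Wronskians and orders in a pencil of power series *)

Section Wronskian.
Variable R : realType.
Local Notation C := (R[i]).
Implicit Types (F G H K : fps C).

Lemma fpsM_lead F G m n : (forall i, (i < m)%N -> F i = 0) -> (forall i, (i < n)%N -> G i = 0) ->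
  (F * G) (m + n)%N = F m * G n /\ forall i, (i < m + n)%N -> (F * G) i = 0.
Proof.
move=> Fm Gn; split=> [|i imn].
  have mlt : (m < (m + n).+1)%N by rewrite ltnS leq_addr.
  rewrite fpsM (bigD1 (Ordinal mlt)) //= addKn big1 ?addr0 // => k ne.
  have [km|mk|km] := ltngtP k m; first by rewrite Fm ?mul0r.
    by rewrite Gn ?mulr0 //; have := ltn_ord k; lia.
  by move/eqP: ne; case; apply: val_inj.
rewrite fpsM big1 // => k _; have [km|mk] := ltnP k m; first by rewrite Fm ?mul0r.
by rewrite Gn ?mulr0 //; have := ltn_ord k; lia.
Qed.

Lemma ord_deriv F : F 0%N = 0 -> eadd (ord (fps_deriv F)) (Some 1%N) = ord F.
Proof.
move=> F0; have := ordP F; case: (ord F) => [[|n]|] /=; first by case.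
  move=> [Fn Fi]; rewrite (@ord_eq _ _ (Some n)) /= ?addn1 //; split=> [|i ilt].
    rewrite /fps_deriv; apply/eqP; rewrite mulf_neq0 ?pnatr_eq0 //; exact/eqP.
  by rewrite /fps_deriv Fi ?mulr0.
move=> ->; rewrite (_ : fps_deriv 0 = 0) ?ord_0 //.
by apply: funext => i; rewrite /fps_deriv mulr0.
Qed.

Definition wronskian F G := fps_deriv F * G - fps_deriv G * F.

(* The pencil: [None] is the point [1 : 0], [Some t] the point [t : 1]. *)
Definition fpencil F G (c : option C) : fps C :=
  if c is Some t then fpsC t * F + G else F.

(** Both products start in the same degree. Their leading terms combine to ord H - ord K times the
    leading coefficients, which is nonzero because ord H > ord K. *)
Lemma ord_wronskian H K d : (0 < d)%N -> is_ord K (Some d) ->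
  (forall i, (i <= d)%N -> H i = 0) ->
  eadd (ord (wronskian H K)) (Some 1%N) = eadd (Some d) (ord H).
Proof.
case: d => // d _ [Kd Ki] Hi; have := ordP H; case: (ord H) => [e|] /=; last first.
  move=> ->; rewrite /wronskian (_ : fps_deriv 0 = 0); last first.
    by apply: funext => i; rewrite /fps_deriv mulr0.
  by rewrite mul0r mulr0 subrr ord_0.
move=> [He Hl]; case: e He Hl => [|e] He Hl; first by case: He; apply: Hi.
have de : (d < e)%N by rewrite ltnNge; apply/negP => ed; apply: He; apply: Hi; rewrite ltnS.
have H'l i : (i < e)%N -> fps_deriv H i = 0 by move=> ie; rewrite /fps_deriv Hl ?mulr0.
have K'l i : (i < d)%N -> fps_deriv K i = 0 by move=> id; rewrite /fps_deriv Ki ?mulr0.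
have [p1 p2] := fpsM_lead H'l Ki; have [q1 q2] := fpsM_lead K'l Hl.
rewrite (@ord_eq _ _ (Some (e + d.+1)%N)) /=; first by congr Some; lia.
split=> [|i ilt]; last by rewrite /wronskian fpsD fpsN p2 // q2 ?subrr // addnS -addSn addnC.
rewrite /wronskian fpsD fpsN p1 (_ : (e + d.+1 = d + e.+1)%N) ?q1; last by lia.
rewrite /fps_deriv (_ : _ - _ = (e.+1%:R - d.+1%:R) * (H e.+1 * K d.+1)); last by ring.
apply/eqP; rewrite !mulf_neq0 //; try exact/eqP.
by rewrite subr_eq0 eqr_nat eqSS gtn_eqF.
Qed.

Lemma ord_comb H K d (a b : C) : is_ord K (Some d) -> (forall i, (i <= d)%N -> H i = 0) ->
  a != 0 -> ord (fpsC a * K + fpsC b * H) = Some d.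
Proof.
move=> [Kd Ki] Hi a0; apply: ord_eq; split=> [|i ilt]; rewrite fpsD !fpsCM.
  by rewrite Hi // mulr0 addr0; apply/eqP; rewrite mulf_neq0 //; apply/eqP.
by rewrite Ki // Hi ?mulr0 ?addr0 // ltnW.
Qed.

(* On a branch all members of the pencil have the same order, except one whose order is
   larger; the order of the Wronskian only sees these two numbers. *)
Lemma pencil_order F G : F 0%N = 0 -> G 0%N = 0 -> (F = 0 -> G = 0 -> False) ->
  exists (d : nat) (c : option C),
    [/\ forall c', c' != c -> ord (fpencil F G c') = Some d,
        ele (Some d.+1) (ord (fpencil F G c)) &
        eadd (ord (wronskian F G)) (Some 1%N) = eadd (Some d) (ord (fpencil F G c))].
Proof.
move=> F0 G0 FG.
have gt_ele H d : (forall i, (i <= d)%N -> H i = 0) -> ele (Some d.+1) (ord H).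
  move=> Hi; have := ordP H; case: (ord H) => //= e [He _]; rewrite ltnNge.
  by apply/negP => /Hi.
have dpos H d : H 0%N = 0 -> is_ord H (Some d) -> (0 < d)%N.
  by case: d => // H0 [Hd _].
(* The cases are whether F itself, the point [1 : 0], is the exceptional member or not. *)
have [[d [oG Fd]]|caseF] :=
  pselect (exists d, is_ord G (Some d) /\ forall i, (i <= d)%N -> F i = 0).
  exists d, None; split=> [[t|] //= _| |] /=; last 2 first.
  - exact: gt_ele.
  - exact: ord_wronskian (dpos _ _ G0 oG) oG Fd.
  by rewrite addrC -[G]mul1r -(rmorph1 (@fpsC C)); apply: ord_comb; rewrite ?oner_neq0.
have [d oF] : exists d, is_ord F (Some d).
  have [[d|] oF] := is_ord_ex F; first by exists d.
  have [[d|] oG] := is_ord_ex G; last by case: (FG oF oG).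
  by case: caseF; exists d; split=> // i _; rewrite oF.
have Gl i : (i < d)%N -> G i = 0.
  have := is_ord_ex G; case=> -[e|] oG ilt; last by rewrite oG.
  have [eltd|dlte] := ltnP e d.
    case: caseF; exists e; split=> // j je; have [_] := oF; apply.
    exact: leq_ltn_trans eltd.
  by have [_] := oG; apply; apply: leq_trans dlte.
(* The exceptional member is the one whose coefficient of degree d cancels; t = 0 if G already has
   larger order than F. *)
have [Fd Fl] := oF; pose t := - G d / F d; pose H := fpsC t * F + G.
have Hi i : (i <= d)%N -> H i = 0.
  rewrite leq_eqVlt => /orP[/eqP ->|ilt].
    by rewrite /H fpsD fpsCM /t divfK ?addNr //; apply/eqP.
  by rewrite /H fpsD fpsCM Fl ?mulr0 ?add0r ?Gl.
exists d, (Some t); split=> [[t'|] ne| |].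
- rewrite /=; have -> : fpsC t' * F + G = fpsC (t' - t) * F + fpsC 1 * H.
    by rewrite /H rmorphB rmorph1; ring.
  apply: ord_comb => //; rewrite subr_eq0; apply: contraNneq ne => -> //.
- exact: ord_eq.
- exact: gt_ele.
rewrite -[fpencil _ _ _]/H -(ord_wronskian (dpos _ _ F0 oF) oF Hi); congr eadd.
have -> : wronskian H F = fpsC (-1) * wronskian F G.
  rewrite /wronskian /H fps_derivD fps_derivM (_ : fps_deriv (fpsC t) = 0).
    by rewrite rmorphN rmorph1; ring.
  by apply: funext => i; rewrite /fps_deriv mulr0.
rewrite ordM (@ord_eq _ (fpsC (-1)) (Some 0%N)) ?eadd0 //; split=> //.
by apply/eqP; rewrite /fpsC /= oppr_eq0 oner_eq0.
Qed.

End Wronskian.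

(** * Milnor numbers *)

(** Here (x, z) is the velocity of a branch, and (u, v), (p, q) are the gradients of h and k. The
    hypothesis says that h is constant along the branch. *)
Lemma cross_identity (A : comNzRingType) (u v p q x z : A) : x * u + z * v = 0 ->
  v * (x * p + z * q) = - (x * (u * q - v * p)).
Proof.
move=> E; have -> : v * (x * p + z * q) = (x * u + z * v) * q - x * (u * q - v * p) by ring.
by rewrite E; ring.
Qed.

Lemma wronskian_identity (A : comNzRingType) (fx fy gx gy F G x z : A) :
  (x * fx + z * fy) * G - (x * gx + z * gy) * F =
  x * (fx * G - gx * F) + z * (fy * G - gy * F).
Proof. ring. Qed.

Lemma ordN (A : idomainType) (F : fps A) : ord (- F) = ord F.
Proof.
apply: ord_eq; have := ordP F; case: (ord F) => [n [Fn Fi]|->] /=; last exact: oppr0.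
split=> [|i /Fi]; rewrite fpsN; last by move=> ->; rewrite oppr0.
by move/eqP; rewrite oppr_eq0 => /eqP.
Qed.

Section Formulas.
Variable R : realType.
Local Notation C := (R[i]).
Local Notation O := (germ R).
Local Notation X := (gX R).
Local Notation Y := (gY R).
Implicit Types (a b f g h p q Q Z : O).

(** By Halphen's formula this is additivity of orders along the branches of Q; it holds also where
    the numbers are infinite. *)
Lemma inter_mulr a b Q n : yreg Q n -> inter (a * b) Q = eadd (inter a Q) (inter b Q).
Proof.
move=> /halphen[N [Zs [[N0 _ _ H] _]]]; apply: (emul_inj N0).
by rewrite emulD !H -big_split /=; apply: eq_bigr => Z _; rewrite bvalM.
Qed.

Section Branch.
Variables (N : nat) (Z : O).
Hypotheses (N0 : (0 < N)%N) (sZ : xseries Z).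

Definition bev : {rmorphism O -> fps C} := @rx R \o sub (X ^+ N) Z.

Lemma bval_ord a : bval N Z a = ord (bev a). Proof. exact: bvalE. Qed.

Lemma bev_0 a : bev a 0%N = a~[0, 0].
Proof. by have [_ Z0] := sZ; rewrite /bev /= rxE (sub_00 a (gXn00 R N0) Z0). Qed.

Lemma bev_C c : bev (gC c) = fpsC c.
Proof.
by rewrite /bev /= sub_C; apply: funext => i; rewrite rxE gCE andbT.
Qed.

Lemma bev_eq0 a : sub (X ^+ N) Z a = 0 -> bev a = 0.
Proof. by move=> E; rewrite /bev /= E rmorph0. Qed.

Lemma rx_dx a : fps_deriv (rx a) = rx (dx a).
Proof. by []. Qed.

Lemma ord_dXn : ord (rx (dx (X ^+ N))) = Some N.-1.
Proof.
apply: ord_eq; case: N N0 => // n _; split=> [|i ilt]; rewrite rxE dxE -[X ^+ _]mulr1 gXnM g1.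
  rewrite leqnn subnn mulr1; apply/eqP; by rewrite pnatr_eq0.
by rewrite ltnNge ilt mulr0.
Qed.

Lemma bev_deriv a :
  fps_deriv (bev a) = rx (dx (X ^+ N)) * bev (dx a) + rx (dx Z) * bev (dy a).
Proof.
have [_ Z0] := sZ.
by rewrite /bev /= rx_dx (dx_sub _ (gXn00 R N0) Z0) rmorphD !rmorphM /=; ring.
Qed.

Lemma bevE a : bev a = rx (sub (X ^+ N) Z a). Proof. by []. Qed.
Opaque bev.

(** On a branch of h_y the chain rule leaves dh/dt = N t^(N-1) h_x. The shift N is N - 1 from that
    factor and 1 from differentiating h. *)
Lemma bval_dy_root h : h~[0, 0] = 0 -> sub (X ^+ N) Z (dy h) = 0 ->
  eadd (bval N Z (dx h)) (Some N) = bval N Z h.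
Proof.
move=> h0 /bev_eq0 E; rewrite !bval_ord -[RHS]ord_deriv ?bev_0 // bev_deriv E mulr0 addr0.
rewrite ordM ord_dXn; case: (ord (bev (dx h))) => //= n; congr Some.
by move: N0; lia.
Qed.

Lemma bevMB a b p q : bev (a * b - p * q) = bev a * bev b - bev p * bev q.
Proof. by rewrite rmorphB; congr (_ - _); apply: rmorphM. Qed.

Lemma bval_jacobian h k : k~[0, 0] = 0 -> sub (X ^+ N) Z h = 0 ->
  eadd (bval N Z (dx h * dy k - dy h * dx k)) (Some N) =
  eadd (bval N Z (dy h)) (bval N Z k).
Proof.
move=> k0 /bev_eq0 E.
have -> : bval N Z k = eadd (ord (fps_deriv (bev k))) (Some 1%N).
  by rewrite ord_deriv ?bev_0.
rewrite [RHS]eaddA.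
transitivity (eadd (eadd (Some N.-1) (bval N Z (dx h * dy k - dy h * dx k))) (Some 1%N)).
  by case: (bval _ _ _) => //= n; congr Some; move: N0; lia.
congr (eadd _ (Some 1%N)); apply/esym.
rewrite bval_ord -ordM bev_deriv (@cross_identity _ (bev (dx h))).
  by rewrite -bevMB ordN ordM ord_dXn.
rewrite -bev_deriv E; apply: funext => i; exact: mulr0.
Qed.

Definition gpencil f g (c : option C) : O := if c is Some t then gC t * f + g else f.

Lemma bev_pencil f g c : bev (gpencil f g c) = fpencil (bev f) (bev g) c.
Proof. by case: c => [t|] //; rewrite /gpencil rmorphD rmorphM bev_C. Qed.

(** The Wronskian of f and g along a branch is x' A + y' B, with x' of order N - 1; on a branch of B
    only x' A remains. *)
Lemma bval_pencil f g : f~[0, 0] = 0 -> g~[0, 0] = 0 -> (bev f = 0 -> bev g = 0 -> False) ->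
  exists (d : nat) c, [/\ forall c', c' != c -> bval N Z (gpencil f g c') = Some d,
    ele (Some d) (bval N Z (gpencil f g c)) &
    sub (X ^+ N) Z (pairB f g) = 0 ->
      eadd (bval N Z (pairA f g)) (Some N) = eadd (Some d) (bval N Z (gpencil f g c))].
Proof.
move=> f0 g0' fg; have [||d [c [E1 E2 E3]]] := @pencil_order R (bev f) (bev g) _ _ fg.
- by rewrite bev_0.
- by rewrite bev_0.
exists d, c; split=> [c' cc'||/bev_eq0 B0]; rewrite ?bval_ord ?bev_pencil //.
- exact: E1.
- by move: E2; case: (ord _) => //= n /ltnW.
rewrite -E3.
have -> : wronskian (bev f) (bev g) = rx (dx (X ^+ N)) * bev (pairA f g).
  rewrite /wronskian !bev_deriv -[RHS]addr0 -[0 in RHS](mulr0 (rx (dx Z))) -B0.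
  rewrite /pairA /pairB !bevMB; exact: wronskian_identity.
rewrite ordM ord_dXn; case: (ord _) => //= n; congr Some.
by move: N0; lia.
Qed.

End Branch.

Lemma yreg_dy h e : yreg h e.+1 -> yreg (dy h) e.
Proof.
move=> [he hl]; split=> [|j je]; rewrite ryE dyE -ryE; last by rewrite hl ?mulr0.
by apply/eqP; rewrite mulf_neq0 ?pnatr_eq0 //; apply/eqP.
Qed.

(* Teissier's formula, with the line x = 0. *)
Lemma inter_dy h e : yreg h e.+1 -> inter h (dy h) = eadd (mu h) (Some e).
Proof.
move=> rh; have h0 : h~[0, 0] = 0 by have [_ hl] := rh; apply: hl.
have [N [Zs [[N0 xs rs H] sZ]]] := halphen (yreg_dy rh); apply: (emul_inj N0).
rewrite emulD /mu !H emul_Some mulnC -sZ -esum_const -big_split /=.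
apply: eq_big_seq => Z ZZ; rewrite bval_dy_root //; [exact: xs|exact: rs].
Qed.

(** Modulo h, the germ [pairB h k] is h_y k. *)
Lemma interBE h k e : yreg h e -> inter (pairB h k) h = eadd (inter (dy h) h) (inter k h).
Proof.
move=> rh; rewrite -(inter_mulr _ _ rh) interC [RHS]interC.
apply: inter_ext; try exact: ideal2ll.
  by exists (dy k), 1; rewrite /pairB; ring.
by exists (- dy k), 1; rewrite /pairB; ring.
Qed.

(** Summing [bval_jacobian] over the branches of h gives i(J, h) + e + 1 = i(h_y, h) + i(k, h),
    where J is the Jacobian; Teissier's formula turns i(h_y, h) into mu(h) + e. *)
Lemma inter_jacobian h k e : yreg h e.+1 -> k~[0, 0] = 0 ->
  eadd (inter (dx h * dy k - dy h * dx k) h) (Some 1%N) = eadd (mu h) (inter k h).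
Proof.
move=> rh k0.
suff E : eadd (inter (dx h * dy k - dy h * dx k) h) (Some e.+1) =
    eadd (inter (dy h) h) (inter k h).
  move: E; rewrite [inter (dy h) h]interC (inter_dy rh).
  case: (inter _ _) => [a|]; case: (mu h) => [b|]; case: (inter k h) => [c|] //= [E].
  by congr Some; lia.
have [N [Zs [[N0 xs rs H] sZ]]] := halphen rh; apply: (emul_inj N0).
rewrite emulD [RHS]emulD !H emul_Some mulnC -sZ -esum_const.
rewrite -[LHS]big_split -[RHS]big_split /=.
by apply: eq_big_seq => Z ZZ; apply: (bval_jacobian N0 (xs Z ZZ) k0 (rs Z ZZ)).
Qed.

Lemma inter_X h e : yreg h e -> inter X h = Some e.
Proof.
move=> rh; have [N [Zs [[N0 xs rs H] sZ]]] := halphen rh; apply: (emul_inj N0).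
rewrite H emul_Some mulnC -sZ -esum_const; apply: eq_big_seq => Z ZZ.
rewrite bvalE (sub_X _ (gXn00 R N0)); apply: ord_eq; split=> [|i ilt].
  by rewrite rxE -[X ^+ N]mulr1 gXnM leqnn subnn g1; apply/eqP; rewrite oner_eq0.
by rewrite rxE -[X ^+ N]mulr1 gXnM leqNgt ilt.
Qed.

Lemma inter_oppl a b : inter (- a) b = inter a b.
Proof.
apply: inter_ext; try exact: ideal2rr; first by exists (- 1), 0; ring.
by exists (- 1), 0; ring.
Qed.

Lemma yregM a b m n : yreg a m -> yreg b n -> yreg (a * b) (m + n).
Proof. by move=> ra rb; rewrite /yreg rmorphM; apply: (is_ordM ra rb). Qed.

(** Teissier's formula for f, g and fg, together with i(fg, (fg)_y) = i(f, f_y) + i(g, g_y) + 2 i(f,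
    g); the orders in y cancel up to 1. *)
Lemma mu_mul f g e1 e2 : yreg f e1.+1 -> yreg g e2.+1 ->
  eadd (mu (f * g)) (Some 1%N) = eadd (eadd (mu f) (mu g)) (eadd (inter f g) (inter f g)).
Proof.
move=> rf rg; have rfg : yreg (f * g) (e1 + e2.+1).+1 by rewrite -addSn; apply: yregM.
have := inter_dy rfg; rewrite (inter_mulr _ _ (yreg_dy rfg)).
have -> : inter f (dy (f * g)) = eadd (inter f (dy f)) (inter f g).
  rewrite ![inter f _]interC -(inter_mulr _ _ rf) interC [RHS]interC dyM.
  apply: inter_ext; try exact: ideal2ll.
    by exists (- dy g), 1; ring.
  by exists (dy g), 1; ring.
have -> : inter g (dy (f * g)) = eadd (inter g (dy g)) (inter f g).
  rewrite ![inter g _]interC -(inter_mulr _ _ rg) interC [RHS]interC dyM.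
  apply: inter_ext; try exact: ideal2ll.
    by exists (- dy f), 1; ring.
  by exists (dy f), 1; ring.
rewrite (inter_dy rf) (inter_dy rg).
case: (mu (f * g)) => [a|]; case: (mu f) => [b|]; case: (mu g) => [c|];
  case: (inter f g) => [d|] //= [E].
by congr Some; lia.
Qed.

End Formulas.

(** * The pencil *)

Lemma esum_finite (I : eqType) (r : seq I) (F : I -> option nat) :
  {in r, forall i, F i <> None} -> exists n, \big[eadd/Some 0%N]_(i <- r) F i = Some n.
Proof.
elim: r => [|i r IH] H; first by exists 0%N; rewrite big_nil.
have [|n En] := IH; first by move=> j jr; apply: H; rewrite inE jr orbT.
rewrite big_cons En; case E: (F i) => [m|]; first by exists (m + n)%N.
by case: (H i _ E); rewrite mem_head.
Qed.

(** One more than the sum of all moduli exceeds every modulus in s. *)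
Lemma exists_notin (R : realType) (s : seq R[i]) : exists t, t \notin s.
Proof.
exists (\sum_(x <- s) `|x| + 1); apply/negP => ts.
have S0 : 0 <= \sum_(x <- s) `|x| by apply: sumr_ge0.
have : `|\sum_(x <- s) `|x| + 1| <= \sum_(x <- s) `|x|.
  by rewrite [leRHS](big_rem _ ts) /= lerDl; apply: sumr_ge0.
by rewrite ger0_norm ?addr_ge0 // gerDl ler10.
Qed.

Section Core.
Variable R : realType.
Local Notation C := (R[i]).
Local Notation O := (germ R).
Local Notation X := (gX R).
Local Notation Y := (gY R).
Variables f g : O.
Hypotheses (f00 : f~[0, 0] = 0) (g00 : g~[0, 0] = 0).
Hypotheses (cfg : coprimeg f g) (tfg : xtransversal f g).
Local Notation h := (gpencil f g).
Local Notation A := (pairA f g).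
Local Notation B := (pairB f g).

Lemma pencil_yreg c : exists n, yreg (h c) n.+1.
Proof.
have h0 : (h c)~[0, 0] = 0.
  by case: c => [t|] //; rewrite /h gD gCM f00 g00 mulr0 addr0.
suff [n hn] : exists n, yreg (h c) n.
  by case: n hn => [[/= hn _]|n hn]; [case: hn|exists n].
case: c {h0} => [t|] /=.
  have := @tfg t 1; rewrite rmorph1 mul1r; apply.
  by apply/eqP => -[_ /eqP]; rewrite oner_eq0.
have := @tfg 1 0; rewrite rmorph1 mul1r rmorph0 mul0r addr0; apply.
by apply/eqP => -[/eqP]; rewrite oner_eq0.
Qed.

Lemma no_common_branch N Z : (0 < N)%N -> xseries Z -> bev N Z f = 0 -> bev N Z g = 0 -> False.
Proof.
move=> N0 sZ; have [xZ Z0] := sZ; have XN := gXn00 R N0.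
have xs a : bev N Z a = 0 -> sub (X ^+ N) Z a = 0.
  rewrite bevE; apply: xonly_eq0; apply/xonlyP; rewrite (sub_comp _ (gX00 R) (g0 R 0 0) XN Z0).
  by rewrite rmorphXn /= (sub_X _ (gX00 R)) (sub_xonly_id (g0 R 0 0) xZ).
move=> /xs f0 /xs g0; have [n rf] := pencil_yreg None.
have [d [u [v [Ef Eg d0]]]] := common_branch N0 sZ rf f0 g0.
by have := cfg Ef Eg; rewrite d0 eqxx.
Qed.

Lemma inter_finite : exists I, inter f g = Some I.
Proof.
have [n rf] := pencil_yreg None; have [N [Zs [[N0 xs rs H] _]]] := halphen rf.
rewrite interC; have [] := @esum_finite _ Zs (bval N ^~ g).
  move=> Z ZZ gN; apply: (no_common_branch N0 (xs Z ZZ)); last exact: ord_None.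
  by apply: bev_eq0; apply: rs.
by move=> k; rewrite -H; case: (inter g f) => [I|]; [exists I|rewrite emul_None].
Qed.

Lemma pencil_branches Q n : yreg Q n -> exists N (Zs : seq O) (d : O -> nat) (cz : O -> option C),
  [/\ branches Q N Zs, size Zs = n & {in Zs, forall Z,
    [/\ forall c, c != cz Z -> bval N Z (h c) = Some (d Z),
        ele (Some (d Z)) (bval N Z (h (cz Z))) &
        sub (X ^+ N) Z B = 0 ->
          eadd (bval N Z A) (Some N) = eadd (Some (d Z)) (bval N Z (h (cz Z)))]}].
Proof.
move=> /halphen[N [Zs [br sZ]]]; have [N0 xs rs H] := br.
pose P Z (dc : nat * option C) : Prop := Z \in Zs ->
    [/\ forall c, c != dc.2 -> bval N Z (h c) = Some dc.1,
        ele (Some dc.1) (bval N Z (h dc.2)) &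
        sub (X ^+ N) Z B = 0 ->
          eadd (bval N Z A) (Some N) = eadd (Some dc.1) (bval N Z (h dc.2))].
have exP Z : exists dc, P Z dc.
  have [ZZ|nZ] := boolP (Z \in Zs); last first.
    by exists (0%N, None) => ZZ; rewrite ZZ in nZ.
  have [d [c H']] := bval_pencil N0 (xs Z ZZ) f00 g00 (no_common_branch N0 (xs Z ZZ)).
  by exists (d, c).
have [dc dcP] := choice exP.
by exists N, Zs, (fun Z => (dc Z).1), (fun Z => (dc Z).2).
Qed.

(** Along each branch of Q only one member has an order above the common one, and Q has finitely
    many branches; summing gives a generic value that is also the least. *)
Lemma pencil_inter Q n : yreg Q n -> exists (L : seq (option C)) (D : nat),
  (forall c, c \notin L -> inter (h c) Q = Some D) /\
  forall c, ele (Some D) (inter (h c) Q).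
Proof.
move=> /pencil_branches[N [Zs [d [cz [[N0 xs rs H] sZ dP]]]]].
have gen c : c \notin map cz Zs -> emul N (inter (h c) Q) = Some (\sum_(Z <- Zs) d Z)%N.
  move=> cL; rewrite H -esum_Some; apply: eq_big_seq => Z ZZ.
  have [E _ _] := dP Z ZZ; apply: E; apply: contraNneq cL => ->.
  exact: map_f.
have low c : ele (Some (\sum_(Z <- Zs) d Z)%N) (emul N (inter (h c) Q)).
  rewrite H -esum_Some; apply: ele_sum => Z ZZ; have [E E' _] := dP Z ZZ.
  by have [->|/E ->] := eqVneq c (cz Z); rewrite //= leqnn.
have [t tL] := exists_notin (pmap id (map cz Zs)).
have {}tL : Some t \notin map cz Zs.
  by apply: contra tL => tL; rewrite mem_pmap map_id.
have := gen _ tL; case E: (inter (h (Some t)) Q) => [D|]; last by rewrite emul_None.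
rewrite emul_Some => -[ED]; exists (map cz Zs), D; split=> c.
  by move=> /gen; rewrite -ED -emul_Some => /(emul_inj N0).
by have := low c; rewrite -ED -emul_Some ele_emul.
Qed.

(** The Jacobian of f + (1/t) g or any other member with f or g is, up to a constant factor, that of
    f and g, so one and the same germ serves all members. *)
Lemma inter_pencil_jacobian c I : inter f g = Some I ->
  eadd (inter (dx f * dy g - dy f * dx g) (h c)) (Some 1%N) = eadd (mu (h c)) (Some I).
Proof.
move=> EI; have [n rh] := pencil_yreg c; case: c rh => [t|] rh.
  rewrite -inter_oppl; have := inter_jacobian rh f00.
  have -> : dx (h (Some t)) * dy f - dy (h (Some t)) * dx f = - (dx f * dy g - dy f * dx g).
    by rewrite /h dxD dyD dxM dyM dxC dyC; ring.
  move=> ->; congr eadd; rewrite -EI; apply: inter_ext; try exact: ideal2ll.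
    by exists (- gC t), 1; rewrite /h; ring.
  by exists (gC t), 1; rewrite /h; ring.
by rewrite (inter_jacobian rh g00) [inter g _]interC /= EI.
Qed.

Lemma ry_gpencil c : ry (h c) = fpencil (ry f) (ry g) c.
Proof.
case: c => [t|] //; rewrite /h /fpencil rmorphD rmorphM.
by congr (_ * _ + _); apply: funext => j; rewrite ryE gCE.
Qed.

(** This is [pencil_order] on the axis x = 0, where the Wronskian of the restrictions is the
    restriction of B. So B has order (e + 1) + (es + 1) - 1. *)
Lemma ord_pencil : exists (e : nat) (cs : option C) (es : nat),
  [/\ forall c, c != cs -> yreg (h c) e.+1, yreg (h cs) es.+1, (e <= es)%N & yreg B (e + es).+1].
Proof.
have ff : ry f = 0 -> ry g = 0 -> False.
  by move=> rf _; have [n [fn _]] := pencil_yreg None; case: fn; rewrite /h rf.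
have [e [cs [E1 E2 E3]]] := @pencil_order R (ry f) (ry g) f00 g00 ff.
have [es res] := pencil_yreg cs.
have oes := ord_eq res; rewrite ry_gpencil in oes.
case: e E1 E2 E3 => [|e] E1 E2 E3.
  (* A common order 0 is excluded because all members vanish at the origin. *)
  have [c cc] : exists c, c != cs by case: (cs) => [t|]; [exists None|exists (Some 0)].
  have [n rn] := pencil_yreg c; have := E1 c cc.
  by rewrite -ry_gpencil (ord_eq rn).
exists e, cs, es; split=> //.
- by move=> c /E1; rewrite -ry_gpencil => E; have := ordP (ry (h c)); rewrite E.
- by move: E2; rewrite oes /= => /ltnW; rewrite ltnS.
move: E3; rewrite oes (_ : wronskian _ _ = ry B).
  have := ordP (ry B); case: (ord (ry B)) => // m rB /= [Em].
  by rewrite (_ : (e + es).+1 = m) //; lia.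
by rewrite /wronskian /pairB rmorphB !rmorphM.
Qed.

(* Up to a constant, mu (h c) is the intersection number of h c with the Jacobian J, which is
   independent of c; its branches bound it below by its generic value. *)
Lemma semicontinuity : exists L : seq (option C), forall c0 c, c0 \notin L ->
  ele (mu (h c0)) (mu (h c)).
Proof.
have [I EI] := inter_finite; set J := dx f * dy g - dy f * dx g.
have HJ c := inter_pencil_jacobian c EI.
have [J0|JN0] := pselect (J = 0).
  (* In this case all Milnor numbers are infinite and the comparison is trivial. *)
  exists [::] => c0 c _; suff -> : mu (h c) = None by case: (mu _).
  have [n rh] := pencil_yreg c; have := HJ c; rewrite -/J J0.
  have [N [Zs [[N0 xs rs H] sZ]]] := halphen rh.
  have -> : inter 0 (h c) = None.
    apply: (emul_inj N0); rewrite H emul_None //; case: (Zs) sZ => // Z s _.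
    by rewrite big_cons bvalE !rmorph0 ord_0.
  by case: (mu _).
(* J may vanish on x = 0, so x^k is split off to make the rest regular in y. The factor x^k adds k
   times the order of the member in y, which is largest at [cs]. *)
have [k [j [Jkj low lowj]]] := germ_neq0 JN0; have [J' [EJ cJ]] := xdivP low.
have rJ' : yreg J' j by split=> [|j' lt]; rewrite ryE cJ // lowj.
have [L [D [gen all]]] := pencil_inter rJ'.
have [e [cs [es [r1 r2 ees _]]]] := ord_pencil.
have HX c n : yreg (h c) n -> inter J (h c) = eadd (Some (k * n)%N) (inter (h c) J').
  move=> rc; rewrite EJ (inter_mulr _ _ rc) [inter J' _]interC; congr eadd.
  elim: (k) => [|m IH]; first by rewrite expr0 interC inter_unit // g1 oner_eq0.
  by rewrite exprS (inter_mulr _ _ rc) IH (inter_X rc) mulSn.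
exists (cs :: L) => c0 c; rewrite inE negb_or => /andP[c0s c0L].
rewrite -(@ele_addr I) -[X in ele X _]HJ -[X in ele _ X]HJ ele_addr -/J.
rewrite [X in ele X _](HX _ _ (r1 _ c0s)) (gen _ c0L).
have [->|/r1 rc] := eqVneq c cs.
  rewrite [X in ele _ X](HX _ _ r2); apply: ele_add => //.
  by rewrite /= leq_mul2l ltnS ees orbT.
by rewrite [X in ele _ X](HX _ _ rc); apply: ele_add; [exact: leqnn|exact: all].
Qed.

Lemma inter_pencil_B c n I : yreg (h c) n.+1 -> inter f g = Some I ->
  inter (h c) B = eadd (mu (h c)) (Some (n + I)%N).
Proof.
move=> rh EI; have Eh := inter_dy rh.
suff -> : inter (h c) B = eadd (inter (h c) (dy (h c))) (Some I).
  by rewrite Eh; case: (mu _) => //= m; congr Some; rewrite addnA.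
rewrite interC [inter (h c) _]interC; case: c rh {Eh} => [t|] rh.
  rewrite -inter_oppl (_ : - B = pairB (h (Some t)) f); last first.
    by rewrite /pairB /h dyD dyM dyC; ring.
  rewrite (interBE f rh); congr eadd; rewrite -EI; apply: inter_ext; try exact: ideal2ll.
    by exists (- gC t), 1; rewrite /h; ring.
  by exists (gC t), 1; rewrite /h; ring.
by rewrite (interBE g rh) [inter g _]interC /= EI.
Qed.

(** [S0] only has to contain the relevant bifurcation points; any other t in it adds M to both
    sides. The term size S0 * M on the left replaces subtractions on the right. *)
Theorem pencil_formula : exists (M : nat) (S0 : seq C),
  [/\ uniq S0, 0 \notin S0,
      forall t, t != 0 -> t \notin S0 -> mu (h (Some t)) = Some M,
      forall c, ele (Some M) (mu (h c)) &
      eadd (inter A B) (Some (size S0 * M)%N) =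
        eadd (mu (f * g)) (\big[eadd/Some 0%N]_(t <- S0) mu (h (Some t)))].
Proof.
have [I EI] := inter_finite; have [L semi] := semicontinuity.
have [e [cs [es [r1 r2 ees rB]]]] := ord_pencil.
have [N [Zs [d [cz [[N0 xs rs H] sZ dP]]]]] := pencil_branches rB.
(* The members that are exceptional on the axis x = 0, on some branch of B, or for
   semicontinuity. *)
pose La := cs :: map cz Zs ++ L.
pose S0 := undup [seq t <- pmap id La | t != 0].
(* The first two entries are f and g; their Milnor numbers will combine to that of f g. *)
pose S := None :: Some 0 :: map Some S0.
have S0n : 0 \notin S0 by rewrite mem_undup mem_filter eqxx.
have uS : uniq S.
  rewrite /= inE negb_or /= (map_inj_uniq (@Some_inj _)) undup_uniq andbT.
  by rewrite (mem_map (@Some_inj _)) S0n andbT; apply/negP => /mapP[].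
have LaS c : c \in La -> c \in S.
  case: c => [t|] // cL; rewrite !inE /=.
  have [->|t0] := eqVneq t 0; first by rewrite eqxx.
  by rewrite (mem_map (@Some_inj _)) mem_undup mem_filter t0 mem_pmap map_id cL orbT.
have nS c : c \notin S -> [/\ c != cs, c \notin map cz Zs & c \notin L].
  by move=> /(contra (@LaS c)); rewrite inE mem_cat !negb_or => /and3P[].
have csS : cs \in S by apply: LaS; rewrite mem_head.
have czS Z : Z \in Zs -> cz Z \in S.
  by move=> ZZ; apply: LaS; rewrite inE mem_cat map_f ?orbT.
set Ds := (\sum_(Z <- Zs) d Z)%N.
have gen c : c \notin S -> emul N (eadd (mu (h c)) (Some (e + I)%N)) = Some Ds.
  move=> /nS[ccs ccz _]; rewrite -(inter_pencil_B (r1 c ccs) EI) H -esum_Some.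
  apply: eq_big_seq => Z ZZ; have [E _ _] := dP Z ZZ; apply: E.
  by apply: contraNneq ccz => ->; apply: map_f.
have [t0 t0S] := exists_notin (0 :: S0).
have c0S : Some t0 \notin S.
  by move: t0S; rewrite !inE /= (mem_map (@Some_inj _)).
have [M EM] : exists M, mu (h (Some t0)) = Some M.
  by have := gen _ c0S; case: (mu _) => [M|]; [exists M|rewrite emul_None].
have genM c : c \notin S -> mu (h c) = Some M.
  move=> cS; have := gen _ c0S; rewrite -(gen _ cS) => /(emul_inj N0).
  by rewrite EM => /eadd_inj ->.
exists M, S0; split; rewrite ?undup_uniq //.
- move=> t tn0 tS; apply: genM; rewrite !inE /= (mem_map (@Some_inj _)) negb_or tS andbT.
  by apply: contra tn0 => /eqP[->].
- by move=> c; rewrite -EM; apply: semi; have [] := nS _ c0S.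
have EDs : Ds = (N * (M + (e + I)))%N.
  by have := gen _ c0S; rewrite EM emul_Some => -[].
have split_sum (F : option C -> option nat) c : c \in S ->
    \big[eadd/Some 0%N]_(x <- S) F x =
    eadd (F c) (\big[eadd/Some 0%N]_(x <- rem c S) F x).
  by move=> cS; rewrite (big_rem c cS).
have sizeS c : c \in S -> size (rem c S) = (size S0).+1.
  by move=> cS; rewrite size_rem //= size_map.
(* [S] has size S0 + 2 members, all but [cz Z] of value d Z. One of these d Z, together with the
   value at [cz Z], makes up the value of A plus N. *)
have perZ Z : Z \in Zs -> eadd (bval N Z A) (Some (N + size S0 * d Z)%N) =
    \big[eadd/Some 0%N]_(c <- S) bval N Z (h c).
  move=> ZZ; have [E1 _ E2] := dP Z ZZ; have {}E2 := E2 (rs Z ZZ).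
  rewrite (split_sum _ _ (czS Z ZZ)).
  rewrite (eq_big_seq (fun=> Some (d Z))) => [|c]; last first.
    by rewrite mem_rem_uniq // inE => /andP[/E1].
  rewrite esum_const sizeS ?czS // mulSn.
  move: E2; case: (bval N Z A) => [a|]; case: (bval N Z _) => [b|] //= [E2].
  by congr Some; lia.
have total : eadd (inter A B) (Some ((e + es).+1 + size S0 * (M + (e + I)))%N) =
    \big[eadd/Some 0%N]_(c <- S) inter (h c) B.
  apply: (emul_inj N0); rewrite emulD emul_sum H emul_Some.
  rewrite (eq_bigr (fun c => \big[eadd/Some 0%N]_(Z <- Zs) bval N Z (h c))) => [|c _];
    last exact: H.
  rewrite exchange_big /= -(eq_big_seq _ perZ) big_split; congr eadd.
  rewrite esum_Some big_split /= big_const_seq iter_addn_0 count_predT sZ.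
  by rewrite -big_distrr /= -/Ds EDs mulnDr [(size S0 * (N * _))%N]mulnCA.
(* Teissier's formula is inserted for each i(h_c, B). The constant collects es once, e for the other
   size S0 + 1 members, and I for all size S0 + 2 of them. *)
have {total} : eadd (inter A B) (Some ((e + es).+1 + size S0 * (M + (e + I)))%N) =
    eadd (\big[eadd/Some 0%N]_(c <- S) mu (h c))
      (Some (es + (size S0).+1 * e + (size S0).+2 * I)%N).
  rewrite total (eq_bigr (fun c =>
    eadd (mu (h c)) (Some ((if c == cs then es else e) + I)%N))); last first.
    move=> c _; have [->|/r1 rc] := eqVneq c cs; first exact: inter_pencil_B.
    exact: inter_pencil_B.
  rewrite big_split; congr eadd; rewrite (split_sum _ _ csS) eqxx.
  rewrite (eq_big_seq (fun=> Some (e + I)%N)) => [|c]; last first.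
    by rewrite mem_rem_uniq // inE => /andP[/negPf -> _].
  by rewrite esum_const sizeS //=; congr Some; lia.
rewrite /S 2!big_cons big_map.
have -> : h (Some 0) = g by rewrite /h rmorph0 mul0r add0r.
have [n rf] := pencil_yreg None; have [n' rg] := pencil_yreg (Some 0).
have Eg : h (Some 0) = g by rewrite /h rmorph0 mul0r add0r.
rewrite Eg in rg; have := @mu_mul _ f g n n' rf rg; rewrite EI.
rewrite -[mu (h None)]/(mu f); move: (\big[_/_]_(_ <- _) _) (mu (f * g)) (mu f) (mu g) (inter A B).
move=> [y|] [a|] [b|] [c|] [x|] //= [E1] [E2].
by congr Some; lia.
Qed.

End Core.

(** * Arbitrary coordinates, and return to the notions of the statement *)

Section Transfer.
Variable R : realType.
Local Notation C := (R[i]).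
Local Notation O := (germ R).
Implicit Types f g h : O.

Lemma pencil_formula_coprime f g : f~[0, 0] = 0 -> g~[0, 0] = 0 -> coprimeg f g ->
  exists (M : nat) (S : seq C),
  [/\ uniq S, 0 \notin S,
      forall t, t != 0 -> t \notin S -> mu (gpencil f g (Some t)) = Some M,
      forall c, ele (Some M) (mu (gpencil f g c)) &
      eadd (inter (pairA f g) (pairB f g)) (Some (size S * M)%N) =
        eadd (mu (f * g)) (\big[eadd/Some 0%N]_(t <- S) mu (gpencil f g (Some t)))].
Proof.
move=> f0 g0' cfg; have [k k0 tfg] := shear_xtransversal f0 g0' cfg.
have sf0 : (shear R k f)~[0, 0] = 0 by rewrite shear_00.
have sg0 : (shear R k g)~[0, 0] = 0 by rewrite shear_00.
have [M [S [uS S0 gen low E]]] := pencil_formula sf0 sg0 (coprimeg_shear k0 cfg) tfg.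
have muE c : mu (gpencil (shear R k f) (shear R k g) c) = mu (gpencil f g c).
  rewrite -[RHS](mu_shear k0); congr mu.
  by case: c => [t|] //; rewrite /gpencil rmorphD rmorphM shear_C.
exists M, S; split=> // [t t0 tS|c|].
- by rewrite -muE gen.
- by rewrite -muE.
rewrite -(mupair_shear k0) E -rmorphM (mu_shear k0); congr eadd.
by apply: eq_bigr => t _; apply: muE.
Qed.

Lemma milnor_germ h : milnor (gval h) = mu h.
Proof. exact: (codim_inter (dx h) (dy h)). Qed.

Lemma psmul_germ f g : psmul (gval f) (gval g) = gval (f * g).
Proof. by apply: funext => i; apply: funext => j; rewrite gM. Qed.
Lemma psadd_germ f g : psadd (gval f) (gval g) = gval (f + g).
Proof. by []. Qed.
Lemma psscale_germ c f : psscale c (gval f) = gval (gC c * f).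
Proof. by apply: funext => i; apply: funext => j; rewrite gCM. Qed.

Lemma milnor_pencil_germ f g al be :
  milnor_pencil (gval f) (gval g) al be = mu (gC al * f + gC be * g).
Proof. by rewrite /milnor_pencil !psscale_germ psadd_germ milnor_germ. Qed.

Lemma milnor_pair_germ f g : milnor_pair (gval f) (gval g) = inter (pairA f g) (pairB f g).
Proof.
have E a b : psadd (psmul (gval a) (gval g)) (psscale (-1) (psmul (gval b) (gval f)))
    = gval (a * g - b * f).
  by rewrite !psmul_germ psscale_germ psadd_germ rmorphN rmorph1 mulN1r.
by rewrite -codim_inter /pairA /pairB -!E.
Qed.

Lemma mu_scale c h : c != 0 -> mu (gC c * h) = mu h.
Proof.
move=> c0; have Cc : gC c^-1 * gC c = 1 by rewrite -rmorphM mulVf // rmorph1.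
rewrite /mu dxM dyM dxC dyC !mul0r !add0r; apply: inter_ext.
- by exists (gC c^-1), 0; rewrite -[LHS]mul1r -Cc mul0r addr0 mulrA.
- by exists 0, (gC c^-1); rewrite -[LHS]mul1r -Cc mul0r add0r mulrA.
- by exists (gC c), 0; ring.
- by exists 0, (gC c); ring.
Qed.

(** [mu_gen] is a chosen generic value; it is unique because two finite exceptional sets miss a
    common point of the projective line. *)
Lemma mu_gen_germ f g M (S : seq C) :
  (forall t, t != 0 -> t \notin S -> mu (gpencil f g (Some t)) = Some M) ->
  mu_gen (gval f) (gval g) = Some M.
Proof.
move=> gen.
have gM : is_generic_value (gval f) (gval g) (Some M).
  exists [:: (1, 0), (0, 1) & [seq (t, 1) | t <- S]] => al be ab0 E.
  have al0 : al != 0.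
    apply/eqP => al0; case: (E (0, 1)); first by rewrite !inE eqxx orbT.
    exists be; rewrite al0 mulr0 mulr1; split=> //.
    by apply: contraNneq ab0 => ->; rewrite al0.
  have be0 : be != 0.
    apply/eqP => be0; case: (E (1, 0)); first by rewrite !inE eqxx.
    by exists al; rewrite be0 mulr0 mulr1.
  have [t0 tS] : al / be != 0 /\ al / be \notin S.
    split; first by rewrite mulf_neq0 ?invr_neq0.
    apply/negP => tS; case: (E (al / be, 1)).
      by rewrite !inE; apply/orP; right; apply/orP; right; apply/mapP; exists (al / be).
    by exists be; rewrite mulr1 mulrC divfK.
  rewrite milnor_pencil_germ -(gen _ t0 tS) -[RHS](mu_scale _ be0); congr mu.
  have -> : gC al = gC be * gC (al / be) by rewrite -rmorphM mulrC divfK.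
  by rewrite /gpencil mulrDr mulrA.
rewrite /mu_gen; case: xgetP => [m -> [E' H']|/(_ _ gM) //].
have [E H] := gM.
(* An exceptional point proportional to (t, 1) has nonzero second entry and ratio t, so avoiding all
   ratios is enough. *)
have [t tE] := exists_notin (0 :: [seq e.1 / e.2 | e <- E ++ E']).
have t1 : (t, 1) != (0, 0) :> C * C by apply/eqP => -[_ /eqP]; rewrite oner_eq0.
have out (T : seq (C * C)) : {subset T <= E ++ E'} -> forall e, e \in T ->
    ~ exists l : C, l != 0 /\ t = l * e.1 /\ 1 = l * e.2.
  move=> TE e eT [l [l0 [tl el]]]; move: tE; rewrite inE negb_or => /andP[_ /negP]; apply.
  apply/mapP; exists e; first exact: TE.
  have e20 : e.2 != 0 by apply/eqP => e20; move: el; rewrite e20 mulr0 => /eqP; rewrite oner_eq0.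
  rewrite tl (_ : l = e.2^-1); first by rewrite mulrC.
  by apply: (mulIf e20); rewrite mulVf.
rewrite -(H' _ _ t1 (out _ _)) ?(H _ _ t1 (out _ _)) // => e eE; by rewrite mem_cat eE ?orbT.
Qed.

End Transfer.

Theorem theorem4p6 (R : realType) (f g : ps R) :
  convergent f -> convergent g -> f 0%N 0%N = 0 -> g 0%N 0%N = 0 ->
  ps_coprime f g ->
  exists B : seq R[i],
    uniq B /\ (forall t, t \in B <-> in_bif_star f g t) /\
    milnor_pair f g =
      eadd (milnor (psmul f g))
           (esum [seq esub (milnor_pencil f g t 1) (mu_gen f g) | t <- B]).
Proof.
move=> cf cg f0 g0' cfg.
rewrite -[f]/(gval (mkgerm cf)) -[g]/(gval (mkgerm cg)) in f0 g0' cfg *.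
move: (mkgerm cf) (mkgerm cg) f0 g0' cfg => {cf cg} {}f {}g f0 g0' cfg.
have cfg' : coprimeg f g.
  move=> d u v Ef Eg; apply/eqP => d0.
  have [||e [_ /(congr1 (fun s => s 0%N 0%N))]] :=
    cfg (gval d) (gval u) (gval v) (germ_conv d) (germ_conv u) (germ_conv v).
  - by rewrite psmul_germ -Ef.
  - by rewrite psmul_germ -Eg.
  by rewrite /psmul !big_ord1 d0 mul0r /ps1 eqxx => /esym/eqP; rewrite oner_eq0.
have [M [S [uS S0 gen low E]]] := pencil_formula_coprime f0 g0' cfg'.
have pE t : milnor_pencil (gval f) (gval g) t 1 = mu (gpencil f g (Some t)).
  by rewrite milnor_pencil_germ rmorph1 mul1r.
rewrite (mu_gen_germ gen) psmul_germ milnor_germ milnor_pair_germ.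
(* S may contain points with generic Milnor number; these are filtered out. *)
exists [seq t <- S | mu (gpencil f g (Some t)) != Some M]; split; first exact: filter_uniq.
split=> [t|].
  rewrite mem_filter /in_bif_star pE (mu_gen_germ gen); split=> [/andP[/eqP tM tS]|[t0 /eqP tM]].
    by split=> //; apply: contraNneq S0 => <-.
  by rewrite tM; apply: contraT => tS; case/eqP: tM; apply: gen.
(* With size S * M added back, a filtered-out point accounts for M on each side. For the others
   [low] gives M <= mu, so the truncated difference plus M is mu. *)
apply: (@eadd_inj (size S * M)); rewrite E -eaddA; congr eadd.
rewrite esumE big_map big_filter.
elim: S {uS S0 gen E} => [|t S IH]; first by rewrite !big_nil.
rewrite !big_cons IH /= mulSn pE; have := low (Some t).
case: eqP => [-> _|_] /=.
  by case: (\big[_/_]_(_ <- _ | _) _) => //= n; congr Some; lia.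
case: (mu _) => [m|] //= Mm; case: (\big[_/_]_(_ <- _ | _) _) => //= n; congr Some; lia.
Qed.
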